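(* Let $\mathsf h=(h_1,\dots,h_n)\in\mathbb R^n$. Let $v$ be a real-analytic function on an open subset $V\subset\mathbb R^{n-1}$ with the property that $\psi=v\circ\mu_{n-1}$ is strictly pseudo-convex on $(\mu_{n-1})^{-1}(V)\subset\mathbb C^{n-1}$. Then there exists an open neighborhood $U\subset\mathbb R^n$ of $V\times\{0\}$ and a real-analytic function $u$ on $U$ with the properties (1) $u(r^1,\ldots,r^{n-1},0)=v(r^1,\ldots,r^{n-1})$ for $(r^1,\ldots,r^{n-1})\in V$; (2) $u$ satisfies $$\det_{1\le i,j\le n}\left(r^i\frac{\partial}{\partial r^i}\left(r^j\frac{\partial u}{\partial r^j}\right)\right)\exp\left(\frac12\sum_{j=1}^n h_j\,r^j\frac{\partial u}{\partial r^j}\right)=r^1r^2\cdots r^n ;$$ (3) $\phi=u\circ\mu_n$ is strictly pseudo-convex on $(\mu_n)^{-1}(U)\subset\mathbb C^n$. Moreover, $u$ is locally unique in the sense that for any other pair $(\tilde U,\tilde u)$ with these properties, there is an open neighborhood $W$ of $V\times\{0\}$ contained in $U\cap\tilde U$ such that $u$ and $\tilde u$ agree on $W$.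
   Context: For each positive integer $m$, $\mu_m:\mathbb C^m\to\mathbb R^m$ is the map $\mu_m(z^1,\ldots,z^m)=(|z^1|^2,\ldots,|z^m|^2)$, and $r^1,\dots,r^n$ are the standard coordinates on $\mathbb R^n$ (with $r^1,\dots,r^{n-1}$ those on $\mathbb R^{n-1}$). A real function $\phi$ on an open subset of $\mathbb C^m$ is strictly pseudo-convex if the Hermitian matrix $\left(\frac{\partial^2\phi}{\partial z^i\partial\bar z^j}\right)$ is positive definite everywhere on that set.
   Formalization: The formal theorem also assumes that det of (∂/∂r^i(r^j ∂v/∂r^j)), i,j<n, is nonzero at points of V with a negative coordinate; such points are invisible to ψ, existence of u forces this, and without it the claim fails (n=2, V=(-2,-1), v=0). *)

(* Defs.v *)
From HB Require Import structures.
From mathcomp Require Import all_boot all_order all_algebra finmap.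
From mathcomp Require Import sesquilinear spectral complex.
From mathcomp Require Import all_classical all_reals all_analysis.
From mathcomp Require Import summability.

Set Implicit Arguments.
Unset Strict Implicit.
Unset Printing Implicit Defensive.

Import Order.TTheory GRing.Theory Num.Theory.
Import numFieldNormedType.Exports.

Local Open Scope classical_set_scope.
Local Open Scope ring_scope.
Local Open Scope complex_scope.
Local Open Scope sesquilinear_scope.

Definition monomial (R : realType) (n : nat) (a : {ffun 'I_n -> nat})
    (x : 'rV[R]_n) : R :=
  \prod_(i < n) x 0 i ^+ a i.

(* [partial_sum] along [totally] is unconditional convergence over all
   multi-indices, so in R it includes absolute convergence. Meant for open U:
   f may take arbitrary values outside U. *)
Definition real_analytic_on (R : realType) (n : nat) (U : set 'rV[R]_n)
    (f : 'rV[R]_n -> R) : Prop :=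
  forall p, U p ->
    exists (c : {ffun 'I_n -> nat} -> R) (rho : R), 0 < rho /\
      forall x, ball p rho x ->
        partial_sum (fun a => c a * monomial a (x - p)) @ totally --> f x.

Definition partial (R : realType) (n : nat) (i : 'I_n) (f : 'rV[R]_n -> R)
    (x : 'rV[R]_n) : R :=
  'D_(delta_mx 0 i) f x.

Definition mu (R : realType) (m : nat) (z : 'rV[R[i]]_m) : 'rV[R]_m :=
  \row_i Normc.normc (z 0 i) ^+ 2.

(* Derivative at 0 of the curve t |-> f (z + t w), t real, computed on real and
   imaginary parts: R[i] is a normed module over itself, not over R. *)
Definition cderive (R : realType) (m : nat) (w : 'rV[R[i]]_m)
    (f : 'rV[R[i]]_m -> R[i]) (z : 'rV[R[i]]_m) : R[i] :=
  derive1 (fun t : R => complex.Re (f (z + t%:C *: w))) 0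
  +i* derive1 (fun t : R => complex.Im (f (z + t%:C *: w))) 0.

(* Wirtinger: d/dz^i = (d/dx^i - i d/dy^i) / 2 where z^i = x^i + i y^i. *)
Definition dz (R : realType) (m : nat) (i : 'I_m)
    (f : 'rV[R[i]]_m -> R[i]) (z : 'rV[R[i]]_m) : R[i] :=
  2^-1 * (cderive (delta_mx 0 i) f z
          - 'i%C * cderive ('i%C *: delta_mx 0 i) f z).

Definition dzbar (R : realType) (m : nat) (i : 'I_m)
    (f : 'rV[R[i]]_m -> R[i]) (z : 'rV[R[i]]_m) : R[i] :=
  2^-1 * (cderive (delta_mx 0 i) f z
          + 'i%C * cderive ('i%C *: delta_mx 0 i) f z).

Definition complex_hessian (R : realType) (m : nat)
    (phi : 'rV[R[i]]_m -> R) (z : 'rV[R[i]]_m) : 'M[R[i]]_m :=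
  \matrix_(i, j) dz i (dzbar j (fun w => (phi w)%:C)) z.

(* In the order of R[i], 0 < x means that x is real and positive. *)
Definition posdefmx (R : realType) (m : nat) (H : 'M[R[i]]_m) : Prop :=
  H \is hermsymmx /\
  forall w : 'rV[R[i]]_m, w != 0 -> 0 < (w *m H *m w ^t*) 0 0.

Definition strictly_pseudo_convex_on (R : realType) (m : nat)
    (S : set 'rV[R[i]]_m) (phi : 'rV[R[i]]_m -> R) : Prop :=
  forall z, S z -> posdefmx (complex_hessian phi z).

Definition zero_section (R : realType) (m : nat) (V : set 'rV[R]_m) :
    set 'rV[R]_(m + 1) :=
  [set row_mx r 0 | r in V].

Definition open_nbhd_of (T : topologicalType) (A U : set T) : Prop :=
  open U /\ A `<=` U.

Definition soliton_equation_at (R : realType) (n : nat) (h : 'rV[R]_n)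
    (u : 'rV[R]_n -> R) (r : 'rV[R]_n) : Prop :=
  \det (\matrix_(i < n, j < n)
          (r 0 i * partial i (fun s => s 0 j * partial j u s) r))
  * expR (2^-1 * \sum_(j < n) h 0 j * (r 0 j * partial j u r))
  = \prod_(i < n) r 0 i.

Definition soliton_extension (R : realType) (m : nat) (h : 'rV[R]_(m + 1))
    (V : set 'rV[R]_m) (v : 'rV[R]_m -> R)
    (U : set 'rV[R]_(m + 1)) (u : 'rV[R]_(m + 1) -> R) : Prop :=
  [/\ open_nbhd_of (zero_section V) U /\ real_analytic_on U u,
      forall r, V r -> u (row_mx r 0) = v r,
      forall r, U r -> soliton_equation_at h u r &
      strictly_pseudo_convex_on (@mu R (m + 1) @^-1` U) (u \o @mu R (m + 1))].

(* det (d/dr^i (r^j dv/dr^j)) is nonzero at the points of V having a negative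
   coordinate. At the other points of V, which are those of the image of mu,
   that determinant at mu z is the determinant of the complex Hessian of v o mu
   at z, so strict pseudo-convexity of v o mu already makes it positive; points
   with a negative coordinate are invisible to v o mu. There the condition is
   forced by the existence of an extension u: after division by r^1 ... r^n the
   equation restricted to r^n = 0 (n = m + 1) reads
     det_(i, j < n) (d/dr^i (r^j dv/dr^j)) * du/dr^n * exp (...) = 1. *)
Definition nondegenerate_off_orthant (R : realType) (m : nat)
    (V : set 'rV[R]_m) (v : 'rV[R]_m -> R) : Prop :=
  forall r, V r -> (exists i, r 0 i < 0) ->
    \det (\matrix_(i < m, j < m)
            partial i (fun s => s 0 j * partial j v s) r) != 0.

(* Main.v *)
From HB Require Import structures.
From mathcomp Require Import all_boot all_order all_algebra finmap.
From mathcomp Require Import sesquilinear complex.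
From mathcomp Require Import all_classical all_reals all_analysis.
From mathcomp Require Import summability.
Require Import Defs.
From mathcomp Require Import ring lra zify perm.

Set Implicit Arguments.
Unset Strict Implicit.
Unset Printing Implicit Defensive.

Import Order.TTheory GRing.Theory Num.Theory.
Import numFieldNormedType.Exports.

Local Open Scope classical_set_scope.
Local Open Scope ring_scope.

(** After division by the product of the coordinates the equation reads
    [det (d_i (r_j d_j u)) * exp L = 1], where
    [L = 1/2 * sum_j h_j r_j d_j u]; a dense set of points allows the division
    ([soliton_reduced_equation]). Write [t] for the last coordinate and [x] for
    the others. On [t = 0] the matrix is block triangular, with the x-block of
    [v] and the corner [d_t u], so that the equation is a Cauchy problem with
    a regular singularity along [t = 0]. Its unknown is [g = d_t (t d_t u)], from
    which [u = v + J g] is recovered by integrating twice ([fps_J]).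

    Formally at a point [(p, 0)], the determinant is [g * D + t * E], where [D] is
    the determinant of the x-block, whose value at the centre is not zero, and
    [E] a bordered determinant ([det_soliton_mx]). Applying Euler's operator to
    [det = exp (- L)] removes the exponential ([fps_eulerI_eq]), and one obtains
    a fixed point problem [g = Phi g] in formal power series. It involves second
    x-derivatives of [g], but only through [J g]: the double integration
    compensates them. Weighted l1 norms express this, the monomial of degrees [a]
    in [x] and [k] in [t] having the weight
    [rho ^ a * tau ^ k / binomial (a + 2 k) a], under which [t] counts as the
    square of a variable ([wt]). The weights are submultiplicative, so that
    determinants are Lipschitz ([wt_det_lip]), and the operators have a small
    norm when [rho], then [tau], are small. [Phi] is then a contraction
    ([Phi_contraction_small]); its fixed point converges ([formal_solution]) and
    is the only convergent one ([formal_unique]).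

    The sum of the formal solution satisfies the equation, because the product of
    the determinant by [exp L] is constant along rays from the centre
    ([formal_reduced_equation]). Local solutions are glued by reading the value
    at [(r, t)] off the expansion at [(r, 0)]: near [(p, 0)] this is the local
    solution at [p], since recentring the latter at [(r, 0)] gives the expansion
    at [r] by uniqueness ([glued_solution]). Uniqueness also shows that any other
    extension has the same expansions, hence agrees with [u] near each point.

    The complex Hessian of [f \o mu] at [z] has the entries
    [delta_ij f_j + conj z_i z_j f_ij] ([complex_hessianE]); up to the phases of
    [z] it is the real symmetric matrix
    [delta_ij f_j + sqrt r_i sqrt r_j f_ij], with the determinant of
    [d_i (r_j d_j f)] ([det_hess_mx]). At [(p, 0)] it is block diagonal, with the
    positive definite block of [v] and the corner [d_t u], which the equation
    forces to be positive; positive definiteness then persists nearby by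
    continuity ([posdef_near]). Points with a negative coordinate are not of the
    form [mu z], so that nothing has to be shown near them. *)

(** * Unconditional sums *)

Section UnconditionalSums.
Variable R : realType.

Definition has_sum (I : choiceType) (f : I -> R) (s : R) : Prop :=
  partial_sum f @ totally --> s.

Lemma partial_sumE (I : choiceType) (f : I -> R) (A : {fset I}) :
  partial_sum f A = \sum_(i <- A) f i.
Proof. by rewrite /partial_sum (big_seq_fsetE _ _ xpredT). Qed.

Lemma has_sumP (I : choiceType) (f : I -> R) (s : R) :
  has_sum f s <-> forall e : R, 0 < e -> exists A : {fset I},
    forall B : {fset I}, (A `<=` B)%fset -> `|s - \sum_(i <- B) f i| < e.
Proof.
split=> [/cvgrPdist_lt fs e e0|fs].
  have [A _ hA] := fs (@totally_filter I) e e0.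
  by exists A => B AB; rewrite -partial_sumE; exact: hA.
apply/(@cvgrPdist_lt _ _ _ _ totally_filter) => e e0; have [A hA] := fs e e0.
by exists A => // B /= AB; rewrite partial_sumE; exact: hA.
Qed.

Lemma has_sum_unique (I : choiceType) (f : I -> R) s s' :
  has_sum f s -> has_sum f s' -> s = s'.
Proof.
move=> h h'.
exact: (@cvg_unique _ (@Rhausdorff R) _ (fmap_proper_filter _ totally_filter) _ _ h h').
Qed.

Lemma eq_has_sum (I : choiceType) (f g : I -> R) s :
  f =1 g -> has_sum f s -> has_sum g s.
Proof. by move=> /funext ->. Qed.

Lemma has_sumD (I : choiceType) (f g : I -> R) s s' :
  has_sum f s -> has_sum g s' -> has_sum (fun i => f i + g i) (s + s').
Proof.
move=> h h'; rewrite /has_sum.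
have -> : partial_sum (fun i => f i + g i) = partial_sum f \+ partial_sum g.
  by apply/funext => A; rewrite /= !partial_sumE big_split.
exact: (@cvgD _ _ _ _ totally_filter).
Qed.

Lemma has_sumZ (I : choiceType) (f : I -> R) s k :
  has_sum f s -> has_sum (fun i => k * f i) (k * s).
Proof.
move=> h; rewrite /has_sum.
have -> : partial_sum (fun i => k * f i) = (fun A => k * partial_sum f A).
  by apply/funext => A; rewrite /= !partial_sumE big_distrr.
exact: (@cvgM _ _ _ totally_filter _ _ _ _ (@cvg_cst _ k _ _ totally_filter) h).
Qed.

Arguments has_sumZ {I f s} k.

Lemma has_sum_finite (I : choiceType) (f : I -> R) (A : {fset I}) :
  (forall i, i \notin A -> f i = 0) -> has_sum f (\sum_(i <- A) f i).
Proof.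
move=> f0; apply/has_sumP => e e0; exists A => B AB.
rewrite [X in _ - X](big_fsetID _ (mem A)) /=.
rewrite [X in _ - (_ + X)]big1_fset ?addr0; last first.
  by move=> i; rewrite !inE => /andP[_ /= iA] _; rewrite f0.
suff -> : [fset x in B | mem A x]%fset = A by rewrite subrr normr0.
apply/fsetP => i; rewrite !inE /=.
by apply/andP/idP => [[]//|iA]; split=> //; exact: (fsubsetP AB).
Qed.

Lemma has_sum0 (I : choiceType) : has_sum (fun _ : I => 0) 0.
Proof.
have := @has_sum_finite I (fun=> 0) fset0 (fun _ _ => erefl).
by rewrite big_seq_fset0.
Qed.

Lemma has_sum_bigsum (I : choiceType) (J : Type) (r : seq J) (P : pred J)
    (f : J -> I -> R) s :
  (forall j, P j -> has_sum (f j) (s j)) ->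
  has_sum (fun i => \sum_(j <- r | P j) f j i) (\sum_(j <- r | P j) s j).
Proof.
move=> h; elim: r => [|j r IH].
  by rewrite big_nil; under eq_fun do rewrite big_nil; exact: has_sum0.
rewrite big_cons; under eq_fun do rewrite big_cons.
by case: ifPn => // Pj; apply: has_sumD => //; exact: h.
Qed.

(** Absolute summability with an explicit bound, usable before any sum is
    known. *)
Definition abs_bounded (I : choiceType) (f : I -> R) (M : R) : Prop :=
  forall A : {fset I}, \sum_(i <- A) `|f i| <= M.

Lemma ler_sum_fset (I : choiceType) (f : I -> R) (A B : {fset I}) :
  (forall i, 0 <= f i) -> (A `<=` B)%fset ->
  \sum_(i <- A) f i <= \sum_(i <- B) f i.
Proof.
move=> f0 AB.
rewrite [leRHS](big_fsetID _ (mem A)) /=.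
have -> : [fset x in B | mem A x]%fset = A.
  apply/fsetP => i; rewrite !inE /=.
  by apply/andP/idP => [[]//|iA]; split=> //; exact: (fsubsetP AB).
by rewrite lerDl; apply: sumr_ge0.
Qed.

Lemma abs_bounded_ge0 (I : choiceType) (f : I -> R) M :
  abs_bounded f M -> 0 <= M.
Proof. by move=> /(_ fset0); rewrite big_seq_fset0. Qed.

Lemma abs_bounded_seq (I : choiceType) (f : I -> R) M (s : seq I) :
  abs_bounded f M -> uniq s -> \sum_(i <- s) `|f i| <= M.
Proof.
move=> h us; have := h [fset i in s]%fset; apply: le_trans.
suff -> : \sum_(i <- s) `|f i| = \sum_(i <- [fset i in s]%fset) `|f i| by [].
apply: perm_big; apply: uniq_perm => // i.
by rewrite in_fset_.
Qed.

Lemma abs_bounded_term (I : choiceType) (f : I -> R) M i :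
  abs_bounded f M -> `|f i| <= M.
Proof. by move=> /(_ [fset i]%fset); rewrite big_seq_fset1. Qed.

Lemma le_abs_bounded (I : choiceType) (f g : I -> R) M :
  (forall i, `|f i| <= `|g i|) -> abs_bounded g M -> abs_bounded f M.
Proof. by move=> fg h A; apply: le_trans (h A); exact: ler_sum. Qed.

Lemma has_sum_ge0_bounded (I : choiceType) (f : I -> R) M :
  (forall i, 0 <= f i) -> abs_bounded f M -> exists s, has_sum f s.
Proof.
move=> f0 hM; set E := [set x | exists A : {fset I}, x = \sum_(i <- A) f i].
have supE : has_sup E.
  split; first by exists (\sum_(i <- fset0) f i); exists fset0.
  exists M => _ [A ->]; apply: le_trans (hM A).
  by apply: ler_sum => i _; rewrite ger0_norm.
exists (sup E); apply/has_sumP => e e0.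
have [_ [A ->] hA] := sup_adherent e0 supE.
exists A => B AB.
have BE : \sum_(i <- B) f i <= sup E.
  by apply: (sup_upper_bound supE); exists B.
rewrite ger0_norm ?subr_ge0// ltrBlDr addrC -ltrBlDr.
by apply: lt_le_trans hA _; exact: ler_sum_fset.
Qed.

(** [f] is the difference of the nonnegative families [|f| + f] and [|f|]. *)
Lemma has_sum_bounded (I : choiceType) (f : I -> R) M :
  abs_bounded f M -> exists s, has_sum f s.
Proof.
move=> h.
have [s hs] : exists s, has_sum (fun i => `|f i|) s.
  apply: (@has_sum_ge0_bounded _ _ M) => // A.
  by under eq_bigr do rewrite normr_id; exact: h.
have [s' hs'] : exists s, has_sum (fun i => `|f i| + f i) s.
  apply: (@has_sum_ge0_bounded _ _ (M + M)) => [i|A].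
    by rewrite -lerBlDr sub0r -normrN ler_norm.
  apply: le_trans (lerD (h A) (h A)); rewrite -big_split /=.
  by apply: ler_sum => i _; apply: le_trans (ler_normD _ _) _; rewrite normr_id.
exists (s' + -1 * s); have := has_sumD hs' (has_sumZ (-1) hs).
by apply: eq_has_sum => i; ring.
Qed.

(** Unconditional convergence forces absolute convergence: two partial sums over
    sets containing [A0] differ by less than 2, so that the positive and the
    negative terms outside [A0] are bounded separately. *)
Lemma abs_bounded_has_sum (I : choiceType) (f : I -> R) s :
  has_sum f s -> exists M, abs_bounded f M.
Proof.
move=> /has_sumP /(_ 1 ltr01)[A0 hA0].
have small (B : {fset I}) : [disjoint A0 & B]%fset -> `|\sum_(i <- B) f i| < 2.
  move=> dB; have h1 := hA0 _ (fsubset_refl A0).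
  have := hA0 (A0 `|` B)%fset (fsubsetUl _ _).
  have -> : \sum_(i <- (A0 `|` B)%fset) f i =
     \sum_(i <- A0) f i + \sum_(i <- B) f i.
    rewrite (big_fsetID _ (mem A0)) /=; congr (_ + _); apply: perm_big.
      apply: uniq_perm => // i; rewrite !inE.
      by apply/andP/idP => [[]//|->].
    apply: uniq_perm => // i; rewrite !inE.
    apply/andP/idP => [[/orP[->//|//]]|iB]; split; rewrite ?iB ?orbT//.
    by apply/negP => iA; move/fdisjointP: dB => /(_ i iA); rewrite iB.
  move=> h2; rewrite ltr_norml; move: h1 h2; rewrite !ltr_norml.
  by move=> /andP[a1 a2] /andP[a3 a4]; apply/andP; split; lra.
exists (\sum_(i <- A0) `|f i| + 4) => A.
have [Ap [An [dp dn hA]]] : exists Ap An : {fset I},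
   [/\ [disjoint A0 & Ap]%fset, [disjoint A0 & An]%fset &
    \sum_(i <- A) `|f i| <= \sum_(i <- A0) `|f i| +
      (\sum_(i <- Ap) f i - \sum_(i <- An) f i)].
  exists [fset i in A | (i \notin A0) && (0 <= f i)]%fset.
  exists [fset i in A | (i \notin A0) && ~~ (0 <= f i)]%fset; split.
  - by apply/fdisjointP => i iA; rewrite !inE iA /= andbF.
  - by apply/fdisjointP => i iA; rewrite !inE iA /= andbF.
  rewrite [leLHS](big_fsetID _ (mem A0)) /=; apply: lerD.
    apply: ler_sum_fset => //; apply/fsubsetP => i.
    by rewrite !inE => /andP[].
  rewrite (big_fsetID _ (fun i => 0 <= f i)) /= -sumrN; apply: lerD.
    rewrite le_eqVlt; apply/orP; left; apply/eqP.
    rewrite [LHS](_ : _ = \sum_(i <- [fset i in A | (i \notin A0) && (0 <= f i)]%fset) `|f i|).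
      by apply: eq_big_seq => i; rewrite !inE => /and3P[_ _ h]; rewrite ger0_norm.
    by apply: perm_big; apply: uniq_perm => // i; rewrite !inE /= andbA.
  rewrite le_eqVlt; apply/orP; left; apply/eqP.
  rewrite [LHS](_ : _ = \sum_(i <- [fset i in A | (i \notin A0) && ~~ (0 <= f i)]%fset) `|f i|).
    apply: eq_big_seq => i; rewrite !inE => /and3P[_ _].
    by rewrite -ltNge => h; rewrite ltr0_norm.
  by apply: perm_big; apply: uniq_perm => // i; rewrite !inE /= andbA.
apply: le_trans hA _; rewrite lerD2l.
have := small _ dp; have := small _ dn; rewrite !ltr_norml.
by move=> /andP[? ?] /andP[? ?]; lra.
Qed.

Lemma has_sum_norm_le (I : choiceType) (f : I -> R) M s :
  abs_bounded f M -> has_sum f s -> `|s| <= M.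
Proof.
move=> hM /has_sumP hs; apply/ler_addgt0Pl => e e0.
have [A hA] := hs e e0.
have := hA A (fsubset_refl _) => /ltW h.
rewrite -[s](subrK (\sum_(i <- A) f i)); apply: le_trans (ler_normD _ _) _.
by apply: lerD => //; apply: le_trans (ler_norm_sum _ _ _) (hM A).
Qed.

(** Change of index set: this serves to exchange rows and columns, to
    differentiate a power series, and to restrict it to part of its exponents. *)
Lemma has_sum_inj (I J : choiceType) (h : I -> J) (f : J -> R) s :
  injective h -> (forall j, (forall i, j != h i) -> f j = 0) ->
  has_sum f s <-> has_sum (f \o h) s.
Proof.
move=> hI f0.
have imE (A : {fset J}) : exists B : {fset I},
    forall C : {fset I}, (B `<=` C)%fset ->
    (forall i, h i \in A -> i \in C).
  elim/finSet_rect: A => A IH.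
  have [->|[j jA]] := fset_0Vmem A.
    by exists fset0 => C _ i; rewrite inE.
  have [B hB] := IH _ (fproperD1 jA).
  have [[i ji]|nj] := pselect (exists i, j = h i).
    exists (i |` B)%fset => C; rewrite fsubUset => /andP[iC BC] k kA.
    have [hkj|hkj] := eqVneq (h k) j.
      move: hkj; rewrite ji => /hI ->; exact: (fsubsetP iC) (fset11 _).
    by apply: (hB _ BC); rewrite !inE hkj.
  exists B => C BC k kA; apply: (hB _ BC); rewrite !inE kA andbT.
  by apply/eqP => e; apply: nj; exists k.
have sumE (C : {fset I}) (A : {fset J}) :
    (forall i, h i \in A -> i \in C) -> (forall i, i \in C -> h i \in A) ->
    \sum_(j <- A) f j = \sum_(i <- C) f (h i).
  move=> h1 h2.
  have -> : \sum_(i <- C) f (h i) = \sum_(j <- (h @` C)%fset) f j.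
    rewrite -(big_map h predT f); apply: perm_big; apply: uniq_perm => //.
      by rewrite map_inj_uniq.
    move=> j; apply/mapP/imfsetP => -[i iC ->]; by exists i.
  rewrite [LHS](big_fsetID _ (mem (h @` C)%fset)) /= [X in _ + X]big1_fset ?addr0.
    apply: perm_big; apply: uniq_perm => // j; rewrite !inE /=.
    apply/andP/idP => [[]//|hj]; split=> //.
    by have /imfsetP[i /= iC ->] := hj; exact: h2.
  move=> j; rewrite !inE /= => /andP[jA jC] _; apply: f0 => i.
  by apply/eqP => e; move/negP: jC; apply; apply/imfsetP; exists i => //; apply: h1; rewrite -e.
split=> /has_sumP hs; apply/has_sumP => e e0; have [A hA] := hs e e0.
  have [B hB] := imE A; exists B => C BC.
  rewrite /= -(sumE C (A `|` h @` C)%fset).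
  - by apply: hA; exact: fsubsetUl.
  - move=> i; rewrite inE => /orP[/(hB _ BC)//|/imfsetP[k /= kC /hI ->]//].
  - by move=> i iC; rewrite inE; apply/orP; right; apply/imfsetP; exists i.
exists (h @` A)%fset => B AB.
have [C0 hC0] := imE B.
pose C := [fset i in C0 | h i \in B]%fset.
rewrite (sumE C B).
- apply: hA; apply/fsubsetP => i iA.
  have hiB : h i \in B by apply: (fsubsetP AB); apply/imfsetP; exists i.
  by rewrite !inE /= hiB andbT; exact: (hC0 _ (fsubset_refl _)).
- by move=> i hi; rewrite !inE /= hi andbT; exact: (hC0 _ (fsubset_refl _)).
- by move=> i; rewrite !inE => /andP[].
Qed.

Lemma sum_fsetM (I J : choiceType) (f : I * J -> R) (B : {fset I}) (C : {fset J}) :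
  \sum_(x <- (B `*` C)%fset) f x = \sum_(i <- B) \sum_(j <- C) f (i, j).
Proof.
transitivity (\sum_(x <- [seq (i, j) | i <- B, j <- C]) f x); last first.
  by rewrite big_allpairs_dep.
apply: perm_big; apply: uniq_perm => //.
  by apply: allpairs_uniq => // -[? ?] [? ?].
move=> -[i j]; rewrite in_fsetM /=; apply/idP/allpairsP.
  by move=> /andP[iB jD]; exists (i, j).
by move=> [[i' j'] [/= iB jD [-> ->]]]; rewrite iB.
Qed.

(** Finite rectangles are cofinal among finite sets of pairs, and the rows of a
    rectangle converge one by one. *)
Lemma has_sum_rows (I J : choiceType) (f : I * J -> R) S (s : I -> R) :
  has_sum f S -> (forall i, has_sum (fun j => f (i, j)) (s i)) -> has_sum s S.
Proof.
move=> /has_sumP hS hs; apply/has_sumP => e e0.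
have e20 : 0 < e / 2 by rewrite divr_gt0.
have [A hA] := hS _ e20.
exists [fset x.1 | x in A]%fset => B AB.
have /has_sumP hB : has_sum (fun j => \sum_(i <- B) f (i, j)) (\sum_(i <- B) s i).
  by apply: has_sum_bigsum => i _; exact: hs.
have [C hC] := hB _ e20.
pose D := (C `|` [fset x.2 | x in A])%fset.
have h1 := hC D (fsubsetUl _ _).
have : `|S - \sum_(x <- (B `*` D)%fset) f x| < e / 2.
  apply: hA; apply/fsubsetP => x xA; rewrite in_fsetM; apply/andP; split.
    by apply: (fsubsetP AB); apply/imfsetP; exists x.
  by rewrite inE; apply/orP; right; apply/imfsetP; exists x.
have -> : \sum_(x <- (B `*` D)%fset) f x = \sum_(j <- D) \sum_(i <- B) f (i, j).
  by rewrite sum_fsetM exchange_big.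
move: h1; rewrite !ltr_norml => /andP[? ?] /andP[? ?].
by apply/andP; split; lra.
Qed.

(** With [h] the addition of exponents, this is the passage from a product of
    two sums to the Cauchy product; [fib] lists the finite fibres. *)
Lemma has_sum_fibres (I K : choiceType) (h : I -> K) (fib : K -> seq I)
    (f : I -> R) S :
  (forall k, uniq (fib k)) -> (forall k i, (i \in fib k) = (h i == k)) ->
  has_sum f S -> has_sum (fun k => \sum_(i <- fib k) f i) S.
Proof.
move=> ufib fibP /has_sumP hS; apply/has_sumP => e e0.
have [A hA] := hS _ e0.
exists [fset h x | x in A]%fset => B AB.
pose C := [fset i in flatten [seq fib k | k <- B]]%fset.
have inC i : (i \in C) = (h i \in B).
  rewrite in_fset_ /=; apply/flatten_mapP/idP.
    by move=> [k kB]; rewrite fibP => /eqP ->.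
  by move=> hB; exists (h i) => //; rewrite fibP.
have -> : \sum_(k <- B) \sum_(i <- fib k) f i = \sum_(i <- C) f i.
  transitivity (\sum_(x <- [seq i | k <- B, i <- fib k]) f x).
    by rewrite big_allpairs_dep.
  apply: perm_big; apply: uniq_perm => //.
    apply: allpairs_uniq_dep => // -[k i] [k' i'] /allpairsPdep[? [? [_]]].
    rewrite fibP => /eqP <- [-> ->] /allpairsPdep[? [? [_]]].
    by rewrite fibP => /eqP <- [-> ->] /= ->.
  move=> i; rewrite inC; apply/allpairsPdep/idP => [[k [j [kB]]]|hB].
    by rewrite fibP => /eqP hj ->; rewrite hj.
  by exists (h i), i; split=> //; rewrite fibP.
apply: hA; apply/fsubsetP => i iA; rewrite inC; apply: (fsubsetP AB).
by apply/imfsetP; exists i.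
Qed.

Lemma abs_bounded_mul (I J : choiceType) (f : I -> R) (g : J -> R) M N :
  abs_bounded f M -> abs_bounded g N ->
  abs_bounded (fun x : I * J => f x.1 * g x.2) (M * N).
Proof.
move=> hf hg A.
pose B := [fset x.1 | x in A]%fset; pose C := [fset x.2 | x in A]%fset.
apply: (@le_trans _ _ (\sum_(x <- (B `*` C)%fset) `|f x.1 * g x.2|)).
  apply: ler_sum_fset => //; apply/fsubsetP => x xA; rewrite in_fsetM.
  by apply/andP; split; apply/imfsetP; exists x.
have -> : \sum_(x <- (B `*` C)%fset) `|f x.1 * g x.2| =
    (\sum_(i <- B) `|f i|) * (\sum_(j <- C) `|g j|).
  rewrite sum_fsetM big_distrl /=; apply: eq_bigr => i _.
  by rewrite big_distrr; apply: eq_bigr => j _; rewrite normrM.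
by apply: ler_pM (hf B) (hg C); apply: sumr_ge0.
Qed.

(** The product family is absolutely summable, hence has some sum, which summation
    by rows identifies. *)
Lemma has_sum_mul (I J : choiceType) (f : I -> R) (g : J -> R) s s' :
  has_sum f s -> has_sum g s' ->
  has_sum (fun x : I * J => f x.1 * g x.2) (s * s').
Proof.
move=> hf hg.
have [M hM] := abs_bounded_has_sum hf; have [N hN] := abs_bounded_has_sum hg.
have [S hS] := has_sum_bounded (abs_bounded_mul hM hN).
suff -> : s * s' = S by [].
apply: has_sum_unique (has_sum_rows hS _); last by move=> i /=; apply: has_sumZ hg.
by have := has_sumZ s' hf; rewrite mulrC; apply: eq_has_sum => i; rewrite mulrC.
Qed.

Lemma sum_le_has_sum (I : choiceType) (f : I -> R) s (A : {fset I}) :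
  (forall i, 0 <= f i) -> has_sum f s -> \sum_(i <- A) f i <= s.
Proof.
move=> f0 /has_sumP hs; apply/ler_addgt0Pr => e e0.
have [B hB] := hs e e0.
have := hB (A `|` B)%fset (fsubsetUr _ _); rewrite ltr_norml => /andP[h _].
have := ler_sum_fset f0 (fsubsetUl A B); lra.
Qed.

Lemma abs_bounded_rows (I J : choiceType) (f : I * J -> R) (r : I -> R) M :
  (forall i, has_sum (fun j => `|f (i, j)|) (r i)) -> abs_bounded r M ->
  abs_bounded f M.
Proof.
move=> hr hM A.
pose B := [fset x.1 | x in A]%fset; pose C := [fset x.2 | x in A]%fset.
apply: (@le_trans _ _ (\sum_(x <- (B `*` C)%fset) `|f x|)).
  apply: ler_sum_fset => //; apply/fsubsetP => x xA; rewrite in_fsetM.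
  by apply/andP; split; apply/imfsetP; exists x.
rewrite sum_fsetM; apply: le_trans (hM B); apply: ler_sum => i _.
by apply: le_trans (ler_norm _); apply: sum_le_has_sum.
Qed.

Lemma has_sum_swap (I J : choiceType) (f : I * J -> R) S :
  has_sum f S -> has_sum (fun x : J * I => f (x.2, x.1)) S.
Proof.
have sI : injective (fun x : J * I => (x.2, x.1)) by move=> [? ?] [? ?] [-> ->].
by case: (has_sum_inj (f := f) S sI) => // -[i j] /(_ (j, i)) /eqP.
Qed.

Lemma abs_bounded_column (I J : choiceType) (f : I * J -> R) M j :
  abs_bounded f M -> abs_bounded (fun i => f (i, j)) M.
Proof.
move=> hM A.
have := abs_bounded_seq hM (s := [seq (i, j) | i <- A]); rewrite big_map; apply.
by rewrite map_inj_uniq// => ? ? [].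
Qed.

Lemma has_sum_delta (I : choiceType) (i0 : I) (k : R) :
  has_sum (fun i => if i == i0 then k else 0) k.
Proof.
have := @has_sum_finite I (fun i => if i == i0 then k else 0) [fset i0]%fset.
rewrite big_seq_fset1 eqxx; apply => i; rewrite inE => /negPf -> //.
Qed.

End UnconditionalSums.

Arguments has_sumZ {R I f s} k.
Arguments has_sum_delta {R I} i0 k.

(** * Formal power series in several variables *)

Notation mindex n := {ffun 'I_n -> nat}.

Section MultiIndices.
Variable n : nat.
Implicit Types a b c : mindex n.

Definition mdeg a : nat := (\sum_i a i)%N.
Definition munit (i : 'I_n) : mindex n := [ffun j => (j == i : nat)].
Definition msub a b : mindex n := [ffun i => (a i - b i)%N].
Definition mle a b : bool := [forall i, (a i <= b i)%N].
Definition mbox d : seq (mindex n) :=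
  [seq [ffun i => nat_of_ord (b i)] | b : {ffun 'I_n -> 'I_d.+1}].
(** The pairs of exponents with sum [a]; the box makes the list finite. *)
Definition antidiag a : seq (mindex n * mindex n) :=
  [seq (b, msub a b) | b <- mbox (mdeg a) & mle b a].

Lemma maddE a b i : (a + b) i = (a i + b i)%N.
Proof. by rewrite ffunE. Qed.

Lemma mzeroE i : (0 : mindex n) i = 0%N.
Proof. by rewrite ffunE. Qed.

Lemma munitE i j : munit i j = (j == i).
Proof. by rewrite ffunE. Qed.

Lemma mleP a b : reflect (forall i, (a i <= b i)%N) (mle a b).
Proof. exact: forallP. Qed.

Lemma maddK a b : msub (a + b) a = b.
Proof. by apply/ffunP => i; rewrite ffunE maddE addnC addnK. Qed.

Lemma msubK a b : mle b a -> b + msub a b = a.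
Proof. by move/mleP => h; apply/ffunP => i; rewrite maddE ffunE subnKC. Qed.

Lemma mle_addr a b : mle a (a + b).
Proof. by apply/mleP => i; rewrite maddE leq_addr. Qed.

Lemma mdegD a b : mdeg (a + b) = (mdeg a + mdeg b)%N.
Proof. by rewrite /mdeg -big_split; apply: eq_bigr => i _; rewrite maddE. Qed.

Lemma mdeg0 : mdeg 0 = 0%N.
Proof. by rewrite /mdeg big1 // => i _; rewrite mzeroE. Qed.

Lemma mdeg_unit i : mdeg (munit i) = 1%N.
Proof.
rewrite /mdeg (bigD1 i) //= munitE eqxx big1 // => j /negPf ji.
by rewrite munitE ji.
Qed.

Lemma mdeg_eq0 a : (mdeg a == 0%N) = (a == 0).
Proof.
rewrite /mdeg sum_nat_eq0; apply/forallP/eqP => [h|-> i].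
  by apply/ffunP => i; rewrite mzeroE; apply/eqP; exact: (h i).
by rewrite mzeroE.
Qed.

Lemma leq_mdeg a i : (a i <= mdeg a)%N.
Proof. by rewrite /mdeg (bigD1 i) //= leq_addr. Qed.

Lemma mle_munit a i : a i != 0%N -> mle (munit i) a.
Proof.
by move=> ai; apply/mleP => j; rewrite munitE; case: eqP => // ->; rewrite lt0n.
Qed.

Lemma mneq0 a : a != 0 -> exists i, a i != 0%N.
Proof.
move=> a0; apply/existsP; rewrite -negb_forall; apply: contra a0 => /forallP h.
by apply/eqP/ffunP => i; rewrite mzeroE; exact/eqP.
Qed.

Lemma mem_mbox d a : (a \in mbox d) = [forall i, (a i <= d)%N].
Proof.
apply/mapP/forallP => [[b _ ->] i|h]; first by rewrite ffunE -ltnS.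
exists [ffun i => inord (a i)]; first by rewrite mem_enum.
by apply/ffunP => i; rewrite !ffunE inordK // ltnS.
Qed.

Lemma uniq_mbox d : uniq (mbox d).
Proof.
rewrite map_inj_uniq ?enum_uniq// => b c /ffunP h.
by apply/ffunP => i; apply: val_inj; have := h i; rewrite !ffunE.
Qed.

Lemma mem_antidiag a (x : mindex n * mindex n) : (x \in antidiag a) = (x.1 + x.2 == a).
Proof.
apply/mapP/eqP => [[b]|<-]; first by rewrite mem_filter => /andP[ba _] ->; exact: msubK.
exists x.1; last by rewrite maddK; case: x.
rewrite mem_filter mle_addr mem_mbox; apply/forallP => i.
by rewrite mdegD (leq_trans (leq_mdeg _ i)) ?leq_addr.
Qed.

Lemma uniq_antidiag a : uniq (antidiag a).
Proof.
by rewrite map_inj_in_uniq ?filter_uniq ?uniq_mbox// => b c _ _ [].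
Qed.

End MultiIndices.

Definition fps (R : Type) (n : nat) := mindex n -> R.

Section FormalSeries.
Variables (R : comNzRingType) (n : nat).
Local Notation mi := (mindex n).
Implicit Types (a b : mi) (c d e : fps R n).

HB.instance Definition _ := GRing.Zmodule.copy (fps R n) (mi -> R).

Definition fps_mul c d : fps R n :=
  fun a => \sum_(x <- antidiag a) c x.1 * d x.2.
Definition fps_const (k : R) : fps R n := fun a => if a == 0 then k else 0.

Lemma fps_mulC : commutative fps_mul.
Proof.
move=> c d; apply/funext => a; rewrite /fps_mul.
transitivity (\sum_(x <- [seq (x.2, x.1) | x <- antidiag a]) d x.1 * c x.2).
  transitivity (\sum_(x <- antidiag a) d x.2 * c x.1); last first.
    by rewrite [RHS]big_map.
  by apply: eq_bigr => x _; exact: mulrC.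
apply: perm_big; apply: uniq_perm; rewrite ?uniq_antidiag//.
  by rewrite map_inj_uniq ?uniq_antidiag// => -[? ?] [? ?] [-> ->].
move=> [x y]; rewrite mem_antidiag addrC; apply/mapP/eqP => [[[x' y']]|h].
  by rewrite mem_antidiag => /eqP h [-> ->].
by exists (y, x); rewrite // mem_antidiag h.
Qed.

Lemma fps_mulDl : left_distributive fps_mul +%R.
Proof.
move=> c d e; apply/funext => a; rewrite /fps_mul.
rewrite -[RHS]big_split /=; apply: eq_bigr => x _; exact: mulrDl.
Qed.

Lemma fps_mulA : associative fps_mul.
Proof.
move=> c d e; apply/funext => a; rewrite /fps_mul.
pose F (t : mi * mi * mi) := c t.1.1 * d t.1.2 * e t.2.
pose L := [seq (x.1, y.1, y.2) | x <- antidiag a, y <- antidiag x.2].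
pose L' := [seq (y.1, y.2, x.2) | x <- antidiag a, y <- antidiag x.1].
transitivity (\sum_(t <- L) F t).
  rewrite big_allpairs_dep; apply: eq_bigr => x _.
  by rewrite mulr_sumr; apply: eq_bigr => y _; rewrite mulrA.
transitivity (\sum_(t <- L') F t); last first.
  rewrite big_allpairs_dep; apply: eq_bigr => x _.
  by rewrite mulr_suml; apply: eq_bigr => y _.
apply: perm_big; apply: uniq_perm; last first.
  move=> [[x y] z]; apply/allpairsPdep/allpairsPdep.
    move=> [[x' w] [[y' z'] [/=]]]; rewrite !mem_antidiag /= => /eqP h1 /eqP h2 [-> -> ->].
    exists (x' + y', z'), (x', y'); rewrite !mem_antidiag /= eqxx; split=> //.
    by rewrite -addrA h2 h1.
  move=> [[w z'] [[x' y'] [/=]]]; rewrite !mem_antidiag /= => /eqP h1 /eqP h2 [-> -> ->].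
  exists (x', y' + z'), (y', z'); rewrite !mem_antidiag /= eqxx; split=> //.
  by rewrite addrA h2 h1.
all: apply: allpairs_uniq_dep => [|x _|]; rewrite ?uniq_antidiag//.
all: move=> -[[x1 x2] [y1 y2]] -[[x1' x2'] [y1' y2']].
all: move=> /allpairsPdep[? [? [_ +]]] [e1 e2]; subst; rewrite /= mem_antidiag => /eqP/= h1.
all: move=> /allpairsPdep[? [? [_ +]]] [e1 e2]; subst; rewrite /= mem_antidiag => /eqP/= h2.
all: by move: h2 => <- [-> -> ->].
Qed.

Definition fps_delta b : fps R n := fun a => (a == b)%:R.

Lemma fps_mul_delta b c a :
  fps_mul (fps_delta b) c a = if mle b a then c (msub a b) else 0.
Proof.
rewrite /fps_mul /fps_delta; case: ifPn => [ba|nba].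
  rewrite (bigD1_seq (b, msub a b)) ?uniq_antidiag ?mem_antidiag ?msubK//=.
  rewrite eqxx mul1r [X in _ + X]big1_seq ?addr0// => -[x y] /=.
  rewrite mem_antidiag /= => /andP[+ /eqP h]; case: (eqVneq x b) => [e1|_ _]; last by rewrite mul0r.
  by rewrite -h e1 maddK eqxx.
rewrite big1_seq // => -[x y] /=; rewrite mem_antidiag => /eqP/= h.
case: (eqVneq x b) => [e1|]; last by rewrite mul0r.
by move: nba; rewrite -h e1 mle_addr.
Qed.

Lemma fps_mul1 : left_id (fps_const 1) fps_mul.
Proof.
have -> : fps_const 1 = fps_delta 0.
  by apply/funext => a; rewrite /fps_const /fps_delta; case: eqP.
move=> c; apply/funext => a; rewrite fps_mul_delta.
have -> : mle 0 a by apply/mleP => i; rewrite mzeroE.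
by congr c; apply/ffunP => i; rewrite ffunE mzeroE subn0.
Qed.

Lemma fps_const1_neq0 : fps_const 1 != 0.
Proof.
apply/eqP => /(congr1 (fun c => c 0)); rewrite /fps_const eqxx.
by move/eqP; rewrite oner_eq0.
Qed.

HB.instance Definition _ := GRing.Zmodule_isComNzRing.Build (fps R n)
  fps_mulA fps_mulC fps_mul1 fps_mulDl fps_const1_neq0.

Definition fps_var i : fps R n := fps_delta (munit i).
Definition fps_deriv i c : fps R n := fun a => (a i).+1%:R * c (a + munit i).

Lemma coefD c d a : (c + d) a = c a + d a. Proof. by []. Qed.
Lemma coefN c a : (- c) a = - c a. Proof. by []. Qed.
Lemma coefB c d a : (c - d) a = c a - d a. Proof. by []. Qed.
Lemma coef0 a : (0 : fps R n) a = 0. Proof. by []. Qed.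
Lemma coefM c d a : (c * d) a = \sum_(x <- antidiag a) c x.1 * d x.2.
Proof. by []. Qed.
Lemma fps_const_1 : fps_const 1 = 1. Proof. by []. Qed.

Lemma coef_sum (I : Type) (r : seq I) (P : pred I) (F : I -> fps R n) a :
  (\sum_(i <- r | P i) F i) a = \sum_(i <- r | P i) F i a.
Proof. by elim/big_rec2: _ => //= i x y _ <-. Qed.

Lemma coefCM k c a : (fps_const k * c) a = k * c a.
Proof.
rewrite coefM (bigD1_seq (0, a)) ?uniq_antidiag ?mem_antidiag ?add0r//=.
rewrite /fps_const eqxx big1_seq ?addr0// => -[x y] /=.
rewrite mem_antidiag /= => /andP[+ /eqP h]; case: (eqVneq x 0) => [e1|]; last by rewrite mul0r.
by rewrite -h e1 add0r eqxx.
Qed.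

Lemma coefXM i c a :
  (fps_var i * c) a = if a i == 0%N then 0 else c (msub a (munit i)).
Proof.
transitivity (fps_mul (fps_delta (munit i)) c a); first by [].
rewrite fps_mul_delta.
have -> : mle (munit i) a = (a i != 0%N); last by rewrite if_neg.
apply/idP/idP => [/mleP/(_ i)|]; last exact: mle_munit.
by rewrite munitE eqxx lt0n.
Qed.

Lemma coef0M c d : (c * d) 0 = c 0 * d 0.
Proof.
rewrite coefM (bigD1_seq (0, 0)) ?uniq_antidiag ?mem_antidiag ?add0r//=.
rewrite big1_seq ?addr0// => -[x y] /=; rewrite mem_antidiag -mdeg_eq0 mdegD /=.
by rewrite addn_eq0 !mdeg_eq0 => /andP[/negP h /andP[/eqP hx /eqP hy]]; case: h; rewrite hx hy.
Qed.

Definition fps_coef0 (c : fps R n) : R := c 0.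

Lemma fps_coef0_is_zmod : zmod_morphism fps_coef0. Proof. by []. Qed.
Lemma fps_coef0_is_monoid : monoid_morphism fps_coef0.
Proof. by split=> [|c d]; rewrite /fps_coef0 ?coef0M// /1%R /= /fps_const eqxx. Qed.
HB.instance Definition _ :=
  GRing.isZmodMorphism.Build (fps R n) R fps_coef0 fps_coef0_is_zmod.
HB.instance Definition _ :=
  GRing.isMonoidMorphism.Build (fps R n) R fps_coef0 fps_coef0_is_monoid.

Lemma fps_constM k l : fps_const k * fps_const l = fps_const (k * l).
Proof.
by apply/funext => a; rewrite coefCM /fps_const; case: eqP => //; rewrite mulr0.
Qed.

Lemma fps_const_is_zmod : zmod_morphism fps_const.
Proof.
by move=> k l; apply/funext => a; rewrite coefB /fps_const; case: eqP; rewrite ?subrr.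
Qed.
Lemma fps_const_is_monoid : monoid_morphism fps_const.
Proof. by split=> // k l; rewrite fps_constM. Qed.
HB.instance Definition _ :=
  GRing.isZmodMorphism.Build R (fps R n) fps_const fps_const_is_zmod.
HB.instance Definition _ :=
  GRing.isMonoidMorphism.Build R (fps R n) fps_const fps_const_is_monoid.

Lemma fps_deriv0 i : fps_deriv i 0 = 0.
Proof. by apply/funext => a; rewrite /fps_deriv !coef0 mulr0. Qed.

Lemma fps_derivD i c d : fps_deriv i (c + d) = fps_deriv i c + fps_deriv i d.
Proof. by apply/funext => a; rewrite /fps_deriv coefD mulrDr. Qed.

Lemma fps_derivB i c d : fps_deriv i (c - d) = fps_deriv i c - fps_deriv i d.
Proof. by apply/funext => a; rewrite /fps_deriv coefB mulrBr. Qed.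

Lemma fps_derivCM i k c : fps_deriv i (fps_const k * c) = fps_const k * fps_deriv i c.
Proof. by apply/funext => a; rewrite coefCM /fps_deriv coefCM mulrCA. Qed.

Lemma coefX_deriv i c a : (fps_var i * fps_deriv i c) a = (a i)%:R * c a.
Proof.
rewrite coefXM; case: eqP => [->|/eqP ai]; first by rewrite mul0r.
rewrite /fps_deriv ffunE munitE eqxx subn1 prednK ?lt0n//.
by congr (_ * c _); rewrite addrC msubK// mle_munit.
Qed.

Lemma fps_derivXM i j c :
  fps_deriv i (fps_var j * c) = (i == j)%:R * c + fps_var j * fps_deriv i c.
Proof.
apply/funext => a; rewrite coefD.
have [->|ij] := eqVneq i j.
  rewrite mul1r coefX_deriv /fps_deriv coefXM maddE munitE eqxx addn1 /=.
  rewrite addrC (maddK (munit j) a) -addn1 natrD mulrDl mul1r addrC //.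
rewrite mul0r coef0 add0r /fps_deriv !coefXM maddE munitE [j == i]eq_sym (negPf ij) addn0.
case: eqP => [_|/eqP aj]; first by rewrite mulr0.
rewrite ffunE munitE (negPf ij) subn0; congr (_ * c _).
apply/ffunP => k; rewrite !(maddE, ffunE); case: (k =P j) => [->|] /=.
  by rewrite [j == i]eq_sym (negPf ij) !addn0.
by rewrite !subn0.
Qed.

Lemma fps_derivC i j c : fps_deriv i (fps_deriv j c) = fps_deriv j (fps_deriv i c).
Proof.
apply/funext => a; rewrite /fps_deriv !maddE !munitE.
rewrite -addrA [munit i + _]addrC addrA !mulrA; congr (_ * _).
by rewrite eq_sym; case: eqP => [->|] /=; rewrite ?addn0 mulrC.
Qed.

End FormalSeries.

(** ** Weighted absolute norms *)

Section WeightedNorms.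
Variables (R : realType) (n : nat).
Local Notation mi := (mindex n).
Implicit Types (a b : mi) (c d e : fps R n) (w : mi -> R).

(** The weighted l1 norm is only ever bounded, never taken, because it may be
    infinite. *)
Definition norm_le w c (M : R) : Prop := abs_bounded (fun a => c a * w a) M.

Lemma norm_le_ge0 w c M : norm_le w c M -> 0 <= M.
Proof. exact: abs_bounded_ge0. Qed.

Lemma norm_leW w c M N : M <= N -> norm_le w c M -> norm_le w c N.
Proof. by move=> MN h A; apply: le_trans (h A) MN. Qed.

Lemma norm_le0 w : norm_le w 0 0.
Proof. by move=> A; rewrite big1 // => a _; rewrite coef0 mul0r normr0. Qed.

Lemma norm_leD w c d M N :
  norm_le w c M -> norm_le w d N -> norm_le w (c + d) (M + N).
Proof.
move=> hc hd A; apply: le_trans (lerD (hc A) (hd A)); rewrite -big_split /=.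
by apply: ler_sum => a _; rewrite coefD mulrDl; exact: ler_normD.
Qed.

Lemma norm_leN w c M : norm_le w c M -> norm_le w (- c) M.
Proof.
by apply: le_abs_bounded => a; rewrite coefN mulNr normrN.
Qed.

Lemma norm_leB w c d M N :
  norm_le w c M -> norm_le w d N -> norm_le w (c - d) (M + N).
Proof. by move=> hc /norm_leN; exact: norm_leD. Qed.

Lemma norm_le_sum w (I : Type) (r : seq I) (F : I -> fps R n) (M : I -> R) :
  (forall i, norm_le w (F i) (M i)) ->
  norm_le w (\sum_(i <- r) F i) (\sum_(i <- r) M i).
Proof.
move=> h; elim: r => [|i r IH]; first by rewrite !big_nil; exact: norm_le0.
by rewrite !big_cons; exact: norm_leD.
Qed.

Lemma norm_le_const w k : 0 <= w 0 <= 1 -> norm_le w (fps_const k) `|k|.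
Proof.
move=> /andP[w0 w1] A.
rewrite -(big_rmcond_in (mem [fset (0 : mi)]%fset)) /=; last first.
  by move=> a _; rewrite inE /fps_const => /negPf ->; rewrite mul0r normr0.
apply: (@le_trans _ _ (\sum_(a <- [fset (0 : mi)]%fset) `|(fps_const k : fps R n) a * w a|)).
  rewrite [leLHS](_ : _ = \sum_(a <- [fset x in A | x \in [fset (0 : mi)]%fset]%fset)
      `|(fps_const k : fps R n) a * w a|); last first.
    by rewrite -big_filter; apply: perm_big; apply: uniq_perm;
      rewrite ?filter_uniq ?fset_uniq// => x; rewrite mem_filter !inE andbC.
  by apply: ler_sum_fset => //; apply/fsubsetP => x; rewrite !inE => /andP[].
by rewrite big_seq_fset1 /fps_const eqxx normrM ler_piMr// ger0_norm.
Qed.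

Lemma norm_le_sub_const w c M : norm_le w c M -> norm_le w (c - fps_const (c 0)) M.
Proof.
apply: le_abs_bounded => a; rewrite coefB /fps_const.
by case: eqP => [->|_]; rewrite ?subr0// subrr mul0r normr0.
Qed.

(** Weights submultiplicative along the addition of exponents make the norm
    submultiplicative; the hypothesis on [e] also covers products in which the
    terms of the convolution have been damped. *)
Lemma norm_le_conv w w' w'' c d e M N :
  (forall a, 0 <= w'' a) -> (forall a b, w'' (a + b) <= w a * w' b) ->
  (forall a, `|e a| <= \sum_(x <- antidiag a) `|c x.1| * `|d x.2|) ->
  norm_le w c M -> norm_le w' d N -> norm_le w'' e (M * N).
Proof.
move=> w0 wM ebound hc hd A.
pose F (x : mi * mi) := (c x.1 * w x.1) * (d x.2 * w' x.2).
apply: (@le_trans _ _ (\sum_(a <- A) \sum_(x <- antidiag a) `|F x|)).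
  apply: ler_sum => a _; rewrite normrM (ger0_norm (w0 a)).
  apply: le_trans (ler_wpM2r (w0 a) (ebound a)) _; rewrite mulr_suml.
  rewrite big_seq [leRHS]big_seq; apply: ler_sum => x.
  rewrite mem_antidiag => /eqP <-; rewrite /F mulrACA normrM -normrM.
  rewrite -normrM [leRHS]normrM; apply: ler_wpM2l => //.
  by apply: le_trans (wM _ _) _; exact: ler_norm.
have -> : \sum_(a <- A) \sum_(x <- antidiag a) `|F x| =
    \sum_(x <- [seq x | a <- A, x <- antidiag a]) `|F x|.
  by rewrite big_allpairs_dep.
apply: (abs_bounded_seq (abs_bounded_mul hc hd)).
apply: allpairs_uniq_dep => [|a _|]; rewrite ?fset_uniq ?uniq_antidiag//.
move=> [a x] [a' x'] /allpairsPdep[? [? [_ +]]] [-> ->] /allpairsPdep[? [? [_ +]]] [-> ->] /=.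
by rewrite !mem_antidiag => /eqP h1 /eqP h2 e1; move: h1 h2; rewrite e1 => -> ->.
Qed.

Lemma norm_leM w w' w'' c d M N :
  (forall a, 0 <= w'' a) -> (forall a b, w'' (a + b) <= w a * w' b) ->
  norm_le w c M -> norm_le w' d N -> norm_le w'' (c * d) (M * N).
Proof.
move=> w0 wM; apply: norm_le_conv => // a.
rewrite coefM; apply: le_trans (ler_norm_sum _ _ _) _.
by apply: ler_sum => x _; rewrite normrM.
Qed.

(** Integration, differentiation and multiplication by a variable all move each
    monomial to another one, up to a factor. *)
Lemma norm_le_shift w w' (s : mi -> mi) c d (P : pred mi) K M :
  0 <= K -> {in P &, injective s} -> (forall a, a \notin P -> d a = 0) ->
  (forall a, a \in P -> `|d a| * `|w' a| <= K * (`|c (s a)| * `|w (s a)|)) ->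
  norm_le w c M -> norm_le w' d (K * M).
Proof.
move=> K0 sI d0 dK hc A.
rewrite -(big_rmcond_in (mem P)) /=; last by move=> a _ aP; rewrite d0// mul0r normr0.
apply: (@le_trans _ _ (\sum_(a <- A | a \in P) K * `|c (s a) * w (s a)|)).
  by apply: ler_sum => a aP; rewrite !normrM; exact: dK.
rewrite -mulr_sumr ler_wpM2l// -big_filter.
rewrite -(big_map s predT (fun b => `|c b * w b|)).
apply: (abs_bounded_seq hc); rewrite map_inj_in_uniq ?filter_uniq ?fset_uniq//.
by move=> a b; rewrite !mem_filter => /andP[aP _] /andP[bP _]; exact: sI.
Qed.

Lemma norm_le_weight w w' c M :
  (forall a, `|w' a| <= `|w a|) -> norm_le w c M -> norm_le w' c M.
Proof.
move=> h; apply: le_abs_bounded => a; rewrite !normrM.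
exact: ler_wpM2l.
Qed.

End WeightedNorms.

Arguments norm_le0 {R n} w.
Arguments norm_le_const {R n} w k.

(** * Power series expansions of functions *)

Section Expansions.
Variables (R : realType) (n : nat).
Local Notation mi := (mindex n).
Implicit Types (a b : mi) (c d : fps R n) (p q v x y z : 'rV[R]_n)
  (f g : 'rV[R]_n -> R) (r s : R).

Lemma ball_rVP p q r : 0 < r -> ball p r q <-> forall i, `|p 0 i - q 0 i| < r.
Proof.
move=> r0; rewrite -ball_normE /ball_ /= /Num.norm /= mx_normrE.
split=> [/bigmax_ltP[_ h] i|h]; first by have := h (0, i) isT; rewrite !mxE.
by apply/bigmax_ltP; split=> // -[i j] _ /=; rewrite (ord1 i) !mxE; exact: h.
Qed.

Lemma ball_rV_norm p q r : ball p r q <-> `|q - p| < r.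
Proof. by rewrite distrC -ball_normE. Qed.

Lemma rV_coord_le x i : `|x 0 i| <= `|x|.
Proof.
rewrite [leRHS]/Num.norm /= mx_normrE.
exact: (le_bigmax _ (fun ij => `|x ij.1 ij.2|) (0, i)).
Qed.

Lemma ball_radius_gt0 p q r : ball p r q -> 0 < r.
Proof. by move=> /ball_rV_norm; exact: le_lt_trans. Qed.

Lemma monomialD a b x : monomial (a + b) x = monomial a x * monomial b x.
Proof.
by rewrite /monomial -big_split /=; apply: eq_bigr => i _; rewrite maddE exprD.
Qed.

Lemma monomial0 x : monomial 0 x = 1.
Proof. by rewrite /monomial big1 // => i _; rewrite mzeroE expr0. Qed.

Lemma monomial_unit i x : monomial (munit i) x = x 0 i.
Proof.
rewrite /monomial (bigD1 i)//= munitE eqxx expr1 big1 ?mulr1// => j /negPf ji.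
by rewrite munitE ji expr0.
Qed.

Lemma norm_monomial a x : `|monomial a x| = \prod_i `|x 0 i| ^+ a i.
Proof. by rewrite normr_prod; apply: eq_bigr => i _; rewrite normrX. Qed.

Lemma monomial_const a s : monomial a (const_mx s) = s ^+ mdeg a.
Proof.
by rewrite /monomial /mdeg -prodrXr; apply: eq_bigr => i _; rewrite mxE.
Qed.

Lemma norm_monomial_le a x s : (forall i, `|x 0 i| <= s) ->
  `|monomial a x| <= s ^+ mdeg a.
Proof.
move=> h; rewrite norm_monomial /mdeg -prodrXr; apply: ler_prod => i _.
by rewrite exprn_ge0//= lerXn2r ?nnegrE// (le_trans _ (h i)).
Qed.

Lemma monomial_at0 a : monomial a (0 : 'rV[R]_n) = (a == 0)%:R.
Proof.
have [->|a0] := eqVneq; first by rewrite monomial0.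
apply/eqP; rewrite /monomial prodf_seq_eq0; apply/hasP.
have [i ai] := mneq0 a0.
by exists i; rewrite ?mem_index_enum//= mxE expr0n (negPf ai).
Qed.

Lemma monomialZ a x k : monomial a (k *: x) = k ^+ mdeg a * monomial a x.
Proof.
rewrite /monomial /mdeg -prodrXr -big_split; apply: eq_bigr => i _.
by rewrite mxE exprMn.
Qed.

Definition expands p r c f : Prop :=
  forall x, ball p r x -> has_sum (fun a => c a * monomial a (x - p)) (f x).

Definition mpow s : mi -> R := fun a => s ^+ mdeg a.

Lemma norm_le_mpow s s' c M : 0 <= s -> s <= s' ->
  norm_le (mpow s') c M -> norm_le (mpow s) c M.
Proof.
move=> s0 ss; apply: norm_le_weight => a; rewrite /mpow.
by rewrite !ger0_norm ?exprn_ge0 ?(le_trans s0)// lerXn2r ?nnegrE// (le_trans s0).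
Qed.

Lemma sub_expands p r r' c f : r' <= r -> expands p r c f -> expands p r' c f.
Proof. by move=> rr h x /(le_ball rr); exact: h. Qed.

Lemma eq_expands p r c f g : (forall x, ball p r x -> f x = g x) ->
  expands p r c f -> expands p r c g.
Proof. by move=> fg h x px; rewrite -fg//; exact: h. Qed.

Lemma expands_bounded p r c f s : 0 <= s < r -> expands p r c f ->
  exists M, norm_le (mpow s) c M.
Proof.
move=> /andP[s0 sr] h.
have r0 : 0 < r by exact: le_lt_trans sr.
have /h/abs_bounded_has_sum[M hM] : ball p r (p + const_mx s).
  by apply/ball_rVP => // i; rewrite !mxE opprD addrA subrr add0r normrN ger0_norm.
by exists M; apply: le_abs_bounded hM => a; rewrite [p + _]addrC addrK monomial_const.
Qed.

Lemma bounded_expands p s c M : norm_le (mpow s) c M -> exists f, expands p s c f.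
Proof.
move=> hM.
suff h x : exists v : R, ball p s x -> has_sum (fun a => c a * monomial a (x - p)) v.
  by exists (fun x => projT1 (cid (h x))) => x px; case: cid => v /= /(_ px).
have [px|npx] := pselect (ball p s x); last by exists 0 => px.
suff [v hv] : exists v : R, has_sum (fun a => c a * monomial a (x - p)) v by exists v.
apply: (has_sum_bounded (M := M)); apply: le_abs_bounded hM => a.
have s0 := ball_radius_gt0 px.
rewrite !normrM ler_wpM2l// /mpow [leRHS]ger0_norm ?exprn_ge0 ?(ltW s0)//.
apply: norm_monomial_le => i; apply: le_trans (rV_coord_le _ _) _.
exact/ltW/ball_rV_norm.
Qed.

Lemma expandsD p r c d f g : expands p r c f -> expands p r d g ->
  expands p r (c + d) (fun x => f x + g x).
Proof.
move=> hf hg x px; have := has_sumD (hf x px) (hg x px).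
by apply: eq_has_sum => a; rewrite coefD mulrDl.
Qed.

Lemma expandsN p r c f : expands p r c f -> expands p r (- c) (fun x => - f x).
Proof.
move=> hf x px; rewrite -[- f x]mulN1r; have := has_sumZ (- 1) (hf x px).
by apply: eq_has_sum => a; rewrite coefN [RHS]mulNr mulN1r.
Qed.

Lemma expands_const p r k : expands p r (fps_const k) (fun=> k).
Proof.
move=> x _; have := has_sum_delta (0 : mi) k; apply: eq_has_sum => a.
by rewrite /fps_const; case: eqP => [->|_]; rewrite ?monomial0 ?mulr1 ?mul0r.
Qed.

Arguments expands_const p r k : clear implicits.

Lemma expands_var p r i : expands p r (fps_var R i) (fun x => x 0 i - p 0 i).
Proof.
move=> x _; have := has_sum_delta (munit i) (x 0 i - p 0 i).
apply: eq_has_sum => a; rewrite /fps_var /fps_delta.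
by case: eqP => [->|_]; rewrite ?monomial_unit ?mxE ?mul1r ?mul0r.
Qed.

Lemma expandsM p r c d f g : expands p r c f -> expands p r d g ->
  expands p r (c * d) (fun x => f x * g x).
Proof.
move=> hf hg x px; have := has_sum_mul (hf x px) (hg x px).
move=> /(has_sum_fibres (h := fun y : mi * mi => y.1 + y.2) (@uniq_antidiag n)).
move=> /(_ (fun a u => mem_antidiag a u)); apply: eq_has_sum => a.
rewrite coefM mulr_suml big_seq [RHS]big_seq; apply: eq_bigr => y.
by rewrite mem_antidiag => /eqP <-; rewrite monomialD mulrACA.
Qed.

Lemma expands_sum p r (I : Type) (t : seq I) (c : I -> fps R n)
    (f : I -> 'rV[R]_n -> R) : (forall i, expands p r (c i) (f i)) ->
  expands p r (\sum_(i <- t) c i) (fun x => \sum_(i <- t) f i x).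
Proof.
move=> h x px; have := has_sum_bigsum (r := t) (P := xpredT) (fun i _ => h i x px).
by apply: eq_has_sum => a; rewrite coef_sum mulr_suml.
Qed.

Lemma expands_prod p r (I : Type) (t : seq I) (c : I -> fps R n)
    (f : I -> 'rV[R]_n -> R) : (forall i, expands p r (c i) (f i)) ->
  expands p r (\prod_(i <- t) c i) (fun x => \prod_(i <- t) f i x).
Proof.
move=> h; elim: t => [|i t IH].
  rewrite big_nil -fps_const_1; apply: (eq_expands _ (expands_const p r 1)) => x _.
  by rewrite big_nil.
rewrite big_cons; apply: (eq_expands _ (expandsM (h i) IH)) => x _.
by rewrite big_cons.
Qed.

Lemma expands_det p r k (c : 'M[fps R n]_k) (f : 'I_k -> 'I_k -> 'rV[R]_n -> R) :
  (forall i j, expands p r (c i j) (f i j)) ->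
  expands p r (\det c) (fun x => \det (\matrix_(i, j) f i j x)).
Proof.
move=> h; pose F (s : 'S_k) x := (-1) ^+ s * \prod_i f i (s i) x.
apply: (eq_expands (f := fun x => \sum_s F s x)).
  by move=> x _; apply: eq_bigr => s _; congr (_ * _); apply: eq_bigr => i _; rewrite mxE.
apply: expands_sum => s; apply: expandsM; last by apply: expands_prod => i.
have := @expands_const p r ((-1) ^+ s); congr (expands p r _ _).
case: (s : bool); rewrite ?expr0 // !expr1.
by apply/funext => a; rewrite coefN /fps_const -fps_const_1 /fps_const; case: eqP => // _; rewrite oppr0.
Qed.

(** ** Recentering *)

Definition mbin a b : nat := (\prod_i 'C(a i, b i))%N.

(** The summands, indexed by [a], of the coefficient of exponent [b] after a
    translation of the centre by [y]. *)
Definition taylor_term c y (b a : mi) : R :=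
  c a * (mbin a b)%:R * monomial (msub a b) y.

Lemma has_sum_binomial a y z :
  has_sum (fun b => (mbin a b)%:R * monomial (msub a b) y * monomial b z)
    (monomial a (y + z)).
Proof.
set F := fun b => _.
have -> : monomial a (y + z) = \sum_(b <- [fset b in mbox n (mdeg a)]%fset) F b.
  transitivity (\sum_(b <- mbox n (mdeg a)) F b); last first.
    by apply: perm_big; apply: uniq_perm;
      rewrite ?uniq_mbox ?fset_uniq// => b; rewrite in_fset_.
  rewrite big_map big_enum /monomial.
  transitivity (\prod_i \sum_(j < (mdeg a).+1)
      'C(a i, j)%:R * y 0 i ^+ (a i - j) * z 0 i ^+ j).
    apply: eq_bigr => i _; rewrite mxE exprDn.
    rewrite (big_ord_widen _ (fun j => y 0 i ^+ (a i - j) * z 0 i ^+ j *+ 'C(a i, j)) (leq_mdeg a i : ((a i).+1 <= (mdeg a).+1)%N)).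
    rewrite big_mkcond; apply: eq_bigr => j _; rewrite ltnS.
    case: leqP => [_|aj]; first by rewrite -mulr_natl mulrA.
    by rewrite bin_small// !mul0r.
  rewrite bigA_distr_bigA; apply: eq_bigr => b _ /=.
  rewrite /F /mbin /monomial natr_prod -!big_split /=; apply: eq_bigr => i _.
  by rewrite !ffunE.
apply: has_sum_finite => b; rewrite in_fset_ /= mem_mbox => /forallPn [k].
rewrite -ltnNge => hb; rewrite /F /mbin (bigD1 k)//= bin_small ?mul0n ?mul0r//.
exact: leq_ltn_trans (leq_mdeg a k) hb.
Qed.

Arguments has_sum_binomial a y z : clear implicits.

(** The binomial theorem turns the series into a double series. It is absolutely
    summable because taking absolute values everywhere amounts to evaluating the
    original series at another point of the ball at [p]; its columns give the new
    coefficients. *)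
Lemma expands_recenter p r c f q s : 0 < s <= r ->
  (forall i, `|q 0 i - p 0 i| + s <= r) -> expands p r c f ->
  exists d, expands q s d f /\ forall b, has_sum (taylor_term c (q - p) b) (d b).
Proof.
move=> /andP[s0 sr] qs hf; have r0 : 0 < r by exact: lt_le_trans sr.
pose y := q - p.
pose T z (x : mi * mi) := taylor_term c y x.2 x.1 * monomial x.2 z.
have bndT z : (forall i, `|z 0 i| < s) -> exists M, abs_bounded (T z) M.
  move=> zs; pose Y := \row_i (`|y 0 i| + `|z 0 i|) : 'rV[R]_n.
  have /hf/abs_bounded_has_sum[M hM] : ball p r (p + Y).
    apply/ball_rVP => // i; rewrite !mxE opprD addrA subrr add0r normrN.
    by rewrite ger0_norm ?addr_ge0//; have := zs i; have := qs i; lra.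
  exists M; apply: (abs_bounded_rows (r := fun a => `|c a * monomial a Y|)).
    move=> a; pose yy := \row_i `|y 0 i| : 'rV[R]_n; pose zz := \row_i `|z 0 i| : 'rV[R]_n.
    have -> : `|c a * monomial a Y| = `|c a| * monomial a (yy + zz).
      rewrite normrM norm_monomial; congr (_ * _); apply: eq_bigr => i _.
      by rewrite !mxE ger0_norm ?addr_ge0.
    have := has_sumZ `|c a| (has_sum_binomial a yy zz).
    apply: eq_has_sum => b; rewrite /T /taylor_term /= !normrM !norm_monomial.
    rewrite !mulrA [X in _ = _ * X * _ * _]ger0_norm ?ler0n//; congr (_ * _ * _).
      by apply: eq_bigr => i _; rewrite !mxE.
    by apply: eq_bigr => i _; rewrite !mxE.
  by move: hM; rewrite [p + _]addrC addrK => hM A; under eq_bigr do rewrite normr_id; exact: hM.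
have dP b : exists v : R, has_sum (taylor_term c y b) v.
  have s2 : 0 < s / 2 by lra.
  have [|M /(abs_bounded_column b)] := bndT (const_mx (s / 2)).
    by move=> i; rewrite mxE gtr0_norm//; lra.
  rewrite /T /= monomial_const => hM.
  apply: (has_sum_bounded (M := M / (s / 2) ^+ mdeg b)) => A.
  rewrite ler_pdivlMr ?exprn_gt0// mulr_suml; apply: le_trans (hM A).
  by apply: ler_sum => a _; rewrite [leRHS]normrM ler_wpM2l// ler_norm.
exists (fun b => projT1 (cid (dP b))); split; last by move=> b; case: cid.
move=> x qx; pose z := x - q.
have [M /has_sum_bounded[S hS]] : exists M, abs_bounded (T z) M.
  by apply: bndT => i; have /ball_rVP-/(_ s0 i) := qx; rewrite distrC !mxE.
have SE : has_sum (fun a => c a * monomial a (x - p)) S.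
  apply: (has_sum_rows hS) => a.
  have -> : x - p = y + z by rewrite [y + z]addrC /y /z addrA subrK.
  have := has_sumZ (c a) (has_sum_binomial a y z).
  by apply: eq_has_sum => b; rewrite /T /taylor_term /= !mulrA.
have -> : f x = S.
  apply: has_sum_unique SE; apply: hf; apply/ball_rVP => // i.
  have /ball_rVP-/(_ s0 i) := qx; have := qs i.
  move=> h1 h2; rewrite -[p 0 i](subrK (q 0 i)) -addrA.
  apply: le_lt_trans (ler_normD _ _) _; rewrite distrC; lra.
apply: (has_sum_rows (has_sum_swap hS)) => b /=; case: cid => v hv /=.
rewrite /T /=; have := has_sumZ (monomial b z) hv; rewrite mulrC.
by apply: eq_has_sum => a; rewrite mulrC.
Qed.

Lemma ball_room p q r : ball p r q ->
  exists2 s, 0 < s <= r & forall i, `|q 0 i - p 0 i| + s <= r.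
Proof.
move=> /ball_rV_norm pq; exists (r - `|q - p|).
  by rewrite subr_gt0 pq lerBlDr lerDl normr_ge0.
by move=> i; have := rV_coord_le (q - p) i; rewrite !mxE; lra.
Qed.

Lemma mdeg1_unit a : mdeg a = 1%N -> exists i, a = munit i.
Proof.
move=> a1; have [i ai] : exists i, a i != 0%N by apply: mneq0; rewrite -mdeg_eq0 a1.
exists i; have le1 := mle_munit ai.
have := mdegD (munit i) (msub a (munit i)); rewrite msubK// a1 mdeg_unit.
by move=> [] /esym/eqP; rewrite mdeg_eq0 => /eqP e; rewrite -[LHS](msubK le1) e addr0.
Qed.

Lemma munit_inj : injective (@munit n).
Proof. by move=> i j /ffunP/(_ j); rewrite !munitE eqxx; case: eqP. Qed.

Lemma expands_center p r c f : 0 < r -> expands p r c f -> f p = c 0.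
Proof.
move=> r0 /(_ p (ballxx _ r0)); rewrite subrr => hf.
apply: has_sum_unique hf _; have := has_sum_delta (0 : mi) (c 0).
apply: eq_has_sum => a; rewrite monomial_at0.
by case: eqP => [->|_]; rewrite ?mulr1 ?mulr0.
Qed.

(** Removing the constant and linear terms leaves terms of degree at least two,
    each of which gains a factor [h ^+ 2]. *)
Lemma expands_remainder q s d f M v : 0 < s -> norm_le (mpow s) d M ->
  expands q (s + s) d f -> (forall i, `|v 0 i| <= s) ->
  forall h, `|h| <= 1 ->
  `|f (q + h *: v) - (d 0 + h * \sum_i v 0 i * d (munit i))| <= `|h| ^+ 2 * M.
Proof.
move=> s0 hM hf vs h h1.
have qx : ball q (s + s) (q + h *: v).
  apply/ball_rVP => [|i]; first by lra.
  rewrite !mxE opprD addrA subrr add0r normrN normrM.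
  by apply: le_lt_trans (ler_piMl (normr_ge0 _) h1) _; have := vs i; lra.
have := hf _ qx; rewrite addrAC subrr add0r => hsum.
pose low a : R := if a == 0 then d 0 else 0.
pose lin i a : R := if a == munit i then h * (v 0 i * d (munit i)) else 0.
have hlow : has_sum low (d 0) by exact: has_sum_delta.
have hlin : has_sum (fun a => \sum_i lin i a) (\sum_i h * (v 0 i * d (munit i))).
  by apply: has_sum_bigsum => i _; exact: has_sum_delta.
have := has_sumD hsum (has_sumZ (- 1) (has_sumD hlow hlin)).
rewrite mulN1r mulr_sumr => hrem; apply: has_sum_norm_le hrem.
apply: (le_abs_bounded (g := fun a => `|h| ^+ 2 * (d a * mpow s a))); last first.
  move=> A; under eq_bigr do rewrite normrM ger0_norm ?exprn_ge0//.
  by rewrite -mulr_sumr ler_wpM2l ?exprn_ge0//; exact: hM.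
move=> a; rewrite monomialZ mulN1r /low /lin.
have [->|a0] := eqVneq a 0.
  rewrite mdeg0 expr0 mul1r monomial0 mulr1 big1 ?addr0 ?subrr ?normr0//.
  by move=> i _; rewrite eq_sym -mdeg_eq0 mdeg_unit.
rewrite add0r; have [a1|a1] := eqVneq (mdeg a) 1%N.
  have [i ->] := mdeg1_unit a1; rewrite mdeg_unit expr1 monomial_unit.
  rewrite (bigD1 i)//= eqxx big1 ?addr0; last first.
    by move=> j ji; rewrite (inj_eq munit_inj) eq_sym (negPf ji).
  by rewrite [d _ * _]mulrC -mulrA subrr normr0 normr_ge0.
rewrite big1 ?subr0; last first.
  by move=> i _; case: eqP => // e; move: a1; rewrite e mdeg_unit.
have a2 : (2 <= mdeg a)%N.
  by move: a0 a1; rewrite -mdeg_eq0; case: (mdeg a) => [|[]].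
rewrite !normrM mulrCA ler_pM ?mulr_ge0//.
  by rewrite normrX normr_id -expr2; apply: ler_wiXn2l.
rewrite ler_wpM2l// /mpow [leRHS]ger0_norm ?exprn_ge0 ?(ltW s0)//.
exact: norm_monomial_le.
Qed.

Lemma expands_is_derive_center q r d f v : 0 < r -> expands q r d f ->
  is_derive q v f (\sum_i v 0 i * d (munit i)).
Proof.
move=> r0 hf; set l := \sum_i _.
have s0 : 0 < r / 2 by rewrite divr_gt0.
set s := r / 2 in s0.
have [M hM] : exists M, norm_le (mpow s) d M.
  by apply: expands_bounded hf; rewrite ltW//= /s; lra.
have M0 := norm_le_ge0 hM.
pose k := s / (`|v| + 1).
have v1 : 0 < `|v| + 1 by rewrite ltr_wpDl.
have k0 : 0 < k by rewrite divr_gt0.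
have kv i : `|(k *: v) 0 i| <= s.
  rewrite mxE normrM gtr0_norm// /k mulrAC ler_pdivrMr// ler_pM2l//.
  by have := rV_coord_le v i; lra.
have hf' : expands q (s + s) d f by apply: sub_expands hf; rewrite /s; lra.
have est (h : R) : h != 0 -> `|h| <= k ->
    `|l - h^-1 * (f (h *: v + q) - f q)| <= `|h| * (M / k ^+ 2).
  move=> h0 hk.
  have hk1 : `|h / k| <= 1 by rewrite normrM normfV (gtr0_norm k0) ler_pdivrMr// mul1r.
  have := expands_remainder s0 hM hf' kv hk1.
  rewrite scalerA divfK ?gt_eqF// (expands_center r0 hf) [q + _]addrC.
  have -> : h / k * \sum_i (k *: v) 0 i * d (munit i) = h * l.
    rewrite /l !mulr_sumr; apply: eq_bigr => i _; rewrite mxE.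
    by rewrite mulrA [_ * (k * _)]mulrA divfK ?gt_eqF// !mulrA.
  move=> e1; rewrite -[l](mulKf h0) -mulrBr normrM normfV mulrC.
  rewrite ler_pdivrMr ?normr_gt0// distrC.
  have -> : f (h *: v + q) - d 0 - h * l = f (h *: v + q) - (d 0 + h * l).
    by rewrite opprD addrA.
  apply: le_trans e1 _; rewrite normrM normfV (gtr0_norm k0) exprMn exprVn.
  by rewrite le_eqVlt; apply/orP; left; apply/eqP; rewrite expr2; ring.
have lim : h^-1 *: ((f \o shift q) (h *: v) - f q) @[h --> 0^'] --> l.
  apply/cvgrPdist_le => e e0; near=> h.
  have h0 : h != 0 by near: h; exact: nbhs_dnbhs_neq.
  have hk : `|h| <= k by near: h; apply: dnbhs0_le.
  apply: le_trans (est h h0 hk) _.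
  have he : `|h| <= e / (M / k ^+ 2 + 1).
    near: h; apply: dnbhs0_le; rewrite divr_gt0// ltr_wpDl// divr_ge0// exprn_ge0// ltW//.
  have K0 : 0 <= M / k ^+ 2 by rewrite divr_ge0// exprn_ge0// ltW.
  apply: le_trans (ler_wpM2r K0 he) _.
  by rewrite mulrAC ler_pdivrMr ?ltr_wpDl// ler_pM2l// lerDl.
by apply: DeriveDef; [apply/cvg_ex; exists l | exact: cvg_lim].
Unshelve. all: by end_near.
Qed.

Lemma mbin_unit a i : mbin a (munit i) = a i.
Proof.
rewrite /mbin (bigD1 i)//= munitE eqxx bin1 big1 ?muln1// => j /negPf ji.
by rewrite munitE ji bin0.
Qed.

(** Recentring reduces the derivative at any point to the linear coefficients of a
    new series, which the binomial coefficients identify with the sums of the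
    differentiated series. *)
Lemma expands_deriv_at p r c f q v : ball p r q -> expands p r c f ->
  exists2 d : 'I_n -> R, is_derive q v f (\sum_i v 0 i * d i) &
  forall i, has_sum (fun a => fps_deriv i c a * monomial a (q - p)) (d i).
Proof.
move=> pq hf; have [s s0 sr] := ball_room pq.
have [d [hd dP]] := expands_recenter s0 sr hf.
exists (fun i => d (munit i)).
  by apply: expands_is_derive_center hd; case/andP: s0.
move=> i; have := dP (munit i).
have inj_i : injective (fun a => a + munit i) 
    by move=> a b /= e; rewrite -[a](maddK (munit i)) addrC e addrC maddK.
case: (has_sum_inj (f := taylor_term c (q - p) (munit i)) (d (munit i)) inj_i).
  move=> a na; rewrite /taylor_term mbin_unit.
  suff -> : a i = 0%N by rewrite mulr0 mul0r.
  apply/eqP/negPn/negP => ai; have /eqP[] := na (msub a (munit i)).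
  by rewrite addrC msubK// mle_munit.
move=> + _ => /[apply]; apply: eq_has_sum => a /=.
rewrite /taylor_term mbin_unit maddE munitE eqxx addn1 /fps_deriv.
rewrite [c _ * _]mulrC; congr (_ * monomial _ _).
by rewrite addrC maddK.
Qed.

Lemma sum_delta_mx i (F : 'I_n -> R) :
  \sum_j (delta_mx 0 i : 'rV[R]_n) 0 j * F j = F i.
Proof.
rewrite (bigD1 i)//= mxE !eqxx mul1r big1 ?addr0// => j /negPf ji.
by rewrite mxE ji andbF mul0r.
Qed.

Lemma expands_deriv p r c f i :
  expands p r c f -> expands p r (fps_deriv i c) (partial i f).
Proof.
move=> hf q pq; have [d dP sP] := expands_deriv_at (delta_mx 0 i) pq hf.
by rewrite /partial (@derive_val _ _ _ _ _ _ _ dP) sum_delta_mx; exact: sP.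
Qed.

Lemma expands_is_derive p r c f q v : ball p r q -> expands p r c f ->
  is_derive q v f (\sum_i v 0 i * partial i f q).
Proof.
move=> pq hf; have [d dP sP] := expands_deriv_at v pq hf.
suff -> : \sum_i v 0 i * partial i f q = \sum_i v 0 i * d i by [].
apply: eq_bigr => i _; congr (_ * _).
exact: has_sum_unique (expands_deriv (i := i) hf pq) (sP i).
Qed.

(** The coefficients are read off the iterated derivatives at the centre. *)
Lemma expands_inj p r c d f : 0 < r ->
  expands p r c f -> expands p r d f -> c = d.
Proof.
move=> r0 hc hd; apply/funext => a.
move: {2}(mdeg a) (erefl (mdeg a)) => N; elim: N a c d f hc hd => [|N IH] a c d f hc hd.
  move/eqP; rewrite mdeg_eq0 => /eqP ->.
  by rewrite -(expands_center r0 hc) (expands_center r0 hd).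
move=> aN; have [i ai] : exists i, a i != 0%N by apply: mneq0; rewrite -mdeg_eq0 aN.
have le1 := mle_munit ai.
have := IH (msub a (munit i)) _ _ _ (expands_deriv (i := i) hc) (expands_deriv (i := i) hd).
rewrite /fps_deriv [_ + munit i]addrC msubK// => H; apply: (mulfI _ (H _)).
  by rewrite pnatr_eq0.
by have := mdegD (munit i) (msub a (munit i)); rewrite msubK// aN mdeg_unit => -[].
Qed.

Lemma expands_partial_center p r c f i : 0 < r -> expands p r c f ->
  partial i f p = c (munit i).
Proof.
move=> r0 /(expands_deriv (i := i))/(expands_center r0) ->.
by rewrite /fps_deriv mzeroE mul1r add0r.
Qed.

End Expansions.

Arguments expands_const {R n} p r k.
Arguments has_sum_binomial {R n} a y z.

(** * Fixed points in weighted spaces of formal series *)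

Section FixedPoint.
Variables (R : realType) (n : nat) (w : mindex n -> R).
Hypothesis w_gt0 : forall a, 0 < w a.
Variables (Phi : fps R n -> fps R n) (G : R).
Hypothesis contraction : forall c d (e : R), norm_le w c G -> norm_le w d G ->
  norm_le w (c - d) e -> norm_le w (Phi c - Phi d) (e / 2).

Lemma exp_half_small (e : R) : 0 < e -> forall K : R, exists k, K / 2 ^+ k <= e.
Proof.
move=> e0 K.
have [K0|K0] := lerP K 0.
  by exists 0%N; rewrite expr0 divr1; lra.
exists (Num.bound (K / e)); rewrite ler_pdivrMr ?exprn_gt0//.
have h1 : K / e < (Num.bound (K / e))%:R by apply: archi_boundP; rewrite divr_ge0 ?ltW.
have h2 k : (k%:R : R) <= 2 ^+ k by rewrite -natrX ler_nat ltnW // ltn_expl.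
move: (lt_le_trans h1 (h2 _)); rewrite ltr_pdivrMr// => /ltW; by rewrite mulrC.
Qed.

Lemma norm_le_small_eq (c d : fps R n) (K : R) :
  (forall k, norm_le w (c - d) (K / 2 ^+ k)) -> c = d.
Proof.
move=> h; apply/funext => a; apply/eqP; rewrite -subr_eq0 -normr_le0.
rewrite -(pmulr_lle0 _ (w_gt0 a)); apply/ler_addgt0Pr => e e0; rewrite add0r.
have [k hk] := exp_half_small e0 K.
have := abs_bounded_term a (h k); rewrite coefB normrM (gtr0_norm (w_gt0 a)).
by move/le_trans; apply.
Qed.

Lemma contraction_unique c d : norm_le w c G -> norm_le w d G ->
  Phi c = c -> Phi d = d -> c = d.
Proof.
move=> hc hd fc fd; apply: (@norm_le_small_eq _ _ (G + G)) => k.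
elim: k => [|k IH]; first by rewrite expr0 divr1; exact: norm_leB.
have := contraction hc hd IH; rewrite fc fd; apply: norm_leW.
by rewrite exprSr invfM mulrA.
Qed.

Hypothesis Phi0 : norm_le w (Phi 0) (G / 2).

Let G0 : 0 <= G.
Proof. by have := norm_le_ge0 Phi0; lra. Qed.

Let it k := iter k Phi 0.

Let it_bound k : norm_le w (it k) G /\ norm_le w (it k.+1 - it k) (G / 2 ^+ k.+1).
Proof.
elim/ltn_ind: k => k IH.
have hk : norm_le w (it k) (G - G / 2 ^+ k).
  elim: k IH => [|k IHk] IH; first by rewrite expr0 divr1 subrr; exact: norm_le0.
  have [_ h] := IH k (leqnn _).
  have := norm_leD (IHk (fun j jk => IH j (ltnW jk))) h.
  rewrite addrC subrK; apply: norm_leW.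
  have -> : G / 2 ^+ k = G / 2 ^+ k.+1 * 2 by rewrite exprSr invfM mulrA divfK.
  lra.
have hG : norm_le w (it k) G.
  by apply: norm_leW hk; rewrite gerBl divr_ge0 ?exprn_ge0.
split=> //; case: k IH hk hG => [|k] IH hk hG.
  by rewrite expr1 /it /= subr0.
have [h1 h2] := IH k (leqnn _).
have := contraction hG h1 h2; apply: norm_leW.
by rewrite [in leRHS]exprSr invfM mulrA.
Qed.

Let it_dist k l : norm_le w (it (k + l)%N - it k) (G / 2 ^+ k - G / 2 ^+ (k + l)).
Proof.
elim: l => [|l IH]; first by rewrite addn0 !subrr; exact: norm_le0.
have [_ h] := it_bound (k + l).
have := norm_leD h IH; rewrite addrA subrK addnS; apply: norm_leW.
have -> : G / 2 ^+ (k + l) = G / 2 ^+ (k + l).+1 * 2.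
  by rewrite exprSr invfM mulrA divfK.
lra.
Qed.

Let it_dist' k l : norm_le w (it (k + l)%N - it k) (G / 2 ^+ k).
Proof.
apply: norm_leW (it_dist k l); rewrite gerBl divr_ge0 ?exprn_ge0//.
Qed.

Let it_cvg a : cvgn (fun k => it k a).
Proof.
apply/cauchy_cvgP/cauchyP => e e0.
have ew : 0 < e * w a / 2 by rewrite divr_gt0 ?mulr_gt0.
have [k hk] := exp_half_small ew G.
exists (it k a); exists k => // l /= kl; rewrite -ball_normE /ball_ /=.
have := abs_bounded_term a (it_dist' k (l - k)).
rewrite subnKC// coefB normrM (gtr0_norm (w_gt0 a)) distrC => h.
rewrite -(ltr_pM2r (w_gt0 a)); apply: le_lt_trans h _; apply: le_lt_trans hk _.
by rewrite gtr_pMr ?mulr_gt0//; lra.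
Qed.

Let g : fps R n := fun a => limn (fun k => it k a).

Let it_lim k : norm_le w (g - it k) (G / 2 ^+ k).
Proof.
move=> A.
have h : \sum_(a <- A) `|(it l - it k) a * w a| @[l --> \oo] -->
    \sum_(a <- A) `|(g - it k) a * w a|.
  apply: (cvg_big (op := +%R)) => [|a _]; first exact: add_continuous.
  apply: cvg_norm; apply: cvgMl; rewrite coefB.
  by apply: cvgB; [exact: it_cvg | exact: cvg_cst].
rewrite -(cvg_lim (@Rhausdorff R) h); apply: limr_le.
  by apply/cvg_ex; eexists; exact: h.
exists k => // l /= kl; have := it_dist' k (l - k) A.
by rewrite subnKC.
Qed.

(** The iterates of [Phi] from 0 stay in the ball of radius [G] and are Cauchy in
    each coefficient; bounds on finite sums pass to the limit, so that the limit
    is approached in norm as well. *)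
Lemma contraction_fixpoint : exists2 c, norm_le w c G & Phi c = c.
Proof.
have gG : norm_le w g G.
  by have := it_lim 0; rewrite expr0 divr1 /it /= subr0.
exists g => //; apply: (@norm_le_small_eq _ _ (G + G)) => k.
have := norm_leB (contraction gG (it_bound k).1 (it_lim k)) (it_lim k.+1).
have -> : Phi (it k) = it k.+1 by [].
rewrite opprB addrA subrK; apply: norm_leW.
have -> : G / 2 ^+ k.+1 = G / 2 ^+ k / 2 by rewrite exprSr invfM mulrA.
by rewrite mulrDl; have : 0 <= G / 2 ^+ k; [rewrite divr_ge0 ?exprn_ge0 | lra].
Qed.

End FixedPoint.

(** * Weights adapted to the singular Cauchy problem *)

(** One term of the Vandermonde convolution. *)
Lemma bin_supermul a b c d :
  ('C(a, c) * 'C(b, d) <= 'C(a + b, c + d))%N.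
Proof.
have [cd|cd] := leqP (c + d) (a + b); last first.
  have [ac|ac] := ltnP a c; first by rewrite bin_small.
  by rewrite [X in (_ * X)%N]bin_small ?muln0//; lia.
rewrite -binomial.Vandermonde (bigD1 (inord c)) //= inordK ?ltnS ?leq_addr//.
by rewrite addKn leq_addr.
Qed.

Section Weights.
Variables (R : realType) (m : nat).
Local Notation mi := (mindex (m + 1)).
Local Notation xx := (lshift 1).
Local Notation tt := (rshift m (ord0 : 'I_1)).
Implicit Types (a b : mi) (i j : 'I_m) (e : nat).

Definition xdeg a : nat := (\sum_(i < m) a (xx i))%N.
Definition tdeg a : nat := a tt.

Lemma xdegD a b : xdeg (a + b) = (xdeg a + xdeg b)%N.
Proof. by rewrite /xdeg -big_split; apply: eq_bigr => i _; rewrite maddE. Qed.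

Lemma tdegD a b : tdeg (a + b) = (tdeg a + tdeg b)%N.
Proof. by rewrite /tdeg maddE. Qed.

Lemma mdeg_split a : mdeg a = (xdeg a + tdeg a)%N.
Proof. by rewrite /mdeg big_split_ord big_ord1. Qed.

Lemma leq_xdeg a i : (a (xx i) <= xdeg a)%N.
Proof. by rewrite /xdeg (bigD1 i) //= leq_addr. Qed.

Lemma xdeg0 : xdeg 0 = 0%N.
Proof. by rewrite /xdeg big1 // => i _; rewrite mzeroE. Qed.

Lemma xdeg_x i : xdeg (munit (xx i)) = 1%N.
Proof.
rewrite /xdeg (bigD1 i)//= munitE eqxx big1 // => j /negPf ji.
by rewrite munitE (inj_eq (@lshift_inj _ _)) ji.
Qed.

Lemma tdeg_x i : tdeg (munit (xx i)) = 0%N.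
Proof. by rewrite /tdeg munitE eq_rlshift. Qed.

Lemma xdeg_t : xdeg (munit tt) = 0%N.
Proof. by rewrite /xdeg big1 // => j _; rewrite munitE eq_lrshift. Qed.

Lemma tdeg_t : tdeg (munit tt) = 1%N.
Proof. by rewrite /tdeg munitE eqxx. Qed.

(** Up to scaling, a monomial of degree [k] in t is weighted as if t were the
    square of a variable, and the binomial denominators make one x-derivative
    cost as much as one integration in that variable gains.  The shift [e]
    records half-integral powers of t. *)
Definition wt (rho tau : R) e : mi -> R := fun a =>
  rho ^+ xdeg a * tau ^+ tdeg a / ('C(xdeg a + (2 * tdeg a + e), xdeg a))%:R.

Variables (rho tau : R).
Hypotheses (rho0 : 0 < rho) (tau0 : 0 < tau).
Let rho_ge0 : 0 <= rho. Proof. exact: ltW. Qed.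
Let tau_ge0 : 0 <= tau. Proof. exact: ltW. Qed.
Local Notation w := (wt rho tau).

Lemma bin_wt_gt0 a e : 0 < ('C(xdeg a + (2 * tdeg a + e), xdeg a))%:R :> R.
Proof. by rewrite ltr0n bin_gt0 leq_addr. Qed.

Lemma wt_gt0 e a : 0 < w e a.
Proof. by rewrite divr_gt0 ?bin_wt_gt0// mulr_gt0// exprn_gt0. Qed.

Lemma wt_ge0 e a : 0 <= w e a.
Proof. exact/ltW/wt_gt0. Qed.

Lemma wt_zero e : w e 0 = 1.
Proof.
by rewrite /wt xdeg0 /tdeg mzeroE bin0 !expr0 invr1 !mulr1.
Qed.

Lemma wtM e e' a b : w (e + e')%N (a + b) <= w e a * w e' b.
Proof.
rewrite /wt xdegD tdegD !exprD.
rewrite [leRHS]mulrACA -invfM -natrM [X in _ <= X * _]mulrACA.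
rewrite ler_wpM2l ?mulr_ge0 ?exprn_ge0 ?rho_ge0 ?tau_ge0//.
rewrite lef_pV2 ?posrE ?ltr0n ?muln_gt0 ?bin_gt0; first last.
- by rewrite !leq_addr.
- exact: leq_addr.
rewrite ler_nat; apply: leq_trans (bin_supermul _ _ _ _) _.
by apply: eq_leq; congr ('C(_, _)); lia.
Qed.

Lemma wt_norm_leM e e' c d (M N : R) :
  norm_le (w e) c M -> norm_le (w e') d N -> norm_le (w (e + e')) (c * d) (M * N).
Proof. apply: norm_leM => *; [exact: wt_ge0 | exact: wtM]. Qed.

(** The integration operator: [u = v + J g] solves [(d/dt) (t (d/dt) u) = g]
    with [u = v] at t = 0. *)
Definition fps_J (g : fps R (m + 1)) : fps R (m + 1) := fun a =>
  if tdeg a == 0%N then 0 else g (msub a (munit tt)) / (tdeg a)%:R ^+ 2.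

Lemma fps_JB g h : fps_J (g - h) = fps_J g - fps_J h.
Proof.
apply/funext => a; rewrite coefB /fps_J; case: eqP => _; first by rewrite subr0.
by rewrite coefB mulrBl.
Qed.

Lemma fps_J0 : fps_J 0 = 0.
Proof.
apply/funext => a; rewrite /fps_J; case: eqP => // _.
by rewrite !coef0 mul0r.
Qed.

Lemma tle_munit a : tdeg a != 0%N -> mle (munit tt) a.
Proof. exact: mle_munit. Qed.

Lemma shift_inj (u : mi) :
  {in [pred a : mi | tdeg a != 0%N] &, injective (fun a => msub (a + u) (munit tt))}.
Proof.
move=> a b ha hb /= e.
have le1 c : tdeg c != 0%N -> mle (munit tt) (c + u).
  by move=> hc; apply: tle_munit; rewrite tdegD; move: hc; case: (tdeg c).
have : a + u = b + u by rewrite -[LHS](msubK (le1 _ ha)) e msubK//; exact: le1.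
by move=> e'; rewrite -[a](maddK u) addrC e' addrC maddK.
Qed.

Lemma xdeg_shift a u : tdeg a != 0%N ->
  xdeg (msub (a + u) (munit tt)) = (xdeg a + xdeg u)%N.
Proof.
move=> ha; have le1 : mle (munit tt) (a + u).
  by apply: tle_munit; rewrite tdegD; move: ha; case: (tdeg a).
by have := congr1 xdeg (msubK le1); rewrite !xdegD xdeg_t.
Qed.

Lemma tdeg_shift a u : tdeg a != 0%N ->
  tdeg (msub (a + u) (munit tt)) = ((tdeg a).-1 + tdeg u)%N.
Proof.
move=> ha; have le1 : mle (munit tt) (a + u).
  by apply: tle_munit; rewrite tdegD; move: ha; case: (tdeg a).
have := congr1 tdeg (msubK le1); rewrite !tdegD tdeg_t.
by move: ha; case: (tdeg a) => //= k _; rewrite add1n addSn => -[].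
Qed.

Lemma wt_op e e' (s : mi -> mi) (kap : mi -> R) (P : pred mi) (c d : fps R (m + 1)) K M :
  0 <= K -> {in P &, injective s} -> (forall a, a \notin P -> d a = 0) ->
  (forall a, a \in P -> d a = kap a * c (s a)) ->
  (forall a, a \in P -> 0 <= kap a) ->
  (forall a, a \in P -> kap a * w e' a <= K * w e (s a)) ->
  norm_le (w e) c M -> norm_le (w e') d (K * M).
Proof.
move=> K0 sI d0 dE k0 hk; apply: (norm_le_shift K0 sI d0) => a aP.
rewrite dE// normrM !(ger0_norm (wt_ge0 _ _)) (ger0_norm (k0 _ aP)).
have -> : kap a * `|c (s a)| * w e' a = `|c (s a)| * (kap a * w e' a) by ring.
rewrite [leRHS]mulrCA; apply: ler_wpM2l => //; exact: hk.
Qed.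

(** The powers of the radii cancel up to [K], so that a comparison of weights is
    an inequality between integers; [x / y] bounds the factor produced by the
    operator. *)
Lemma wt_compare e e' a b (kap K : R) (x y l : nat) : 0 <= K -> (0 < y)%N ->
  kap <= x%:R / y%:R ->
  rho ^+ xdeg a * tau ^+ tdeg a = K * (rho ^+ xdeg b * tau ^+ tdeg b) ->
  (x * 'C(xdeg b + (2 * tdeg b + e), xdeg b) <=
     l * y * 'C(xdeg a + (2 * tdeg a + e'), xdeg a))%N ->
  kap * w e' a <= (l%:R * K) * w e b.
Proof.
move=> K0 y0 hk hE hN.
apply: le_trans (ler_wpM2r (wt_ge0 _ _) hk) _.
rewrite /wt hE; have Ca := bin_wt_gt0 a e'; have Cb := bin_wt_gt0 b e.
set A := rho ^+ _ * _; have A0 : 0 <= A by rewrite mulr_ge0 ?exprn_ge0 ?rho_ge0 ?tau_ge0.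
have -> : x%:R / y%:R * (K * A / ('C(xdeg a + (2 * tdeg a + e'), xdeg a))%:R) =
   (K * A) * (x%:R / (y%:R * ('C(xdeg a + (2 * tdeg a + e'), xdeg a))%:R)).
  by rewrite invfM; ring.
have -> : l%:R * K * (A / ('C(xdeg b + (2 * tdeg b + e), xdeg b))%:R) =
   (K * A) * (l%:R / ('C(xdeg b + (2 * tdeg b + e), xdeg b))%:R) by ring.
apply: ler_wpM2l; first by rewrite mulr_ge0.
have yR : 0 < y%:R :> R by rewrite ltr0n.
rewrite ler_pdivrMr ?mulr_gt0// [leRHS]mulrAC ler_pdivlMr//.
by rewrite mulrA -!natrM ler_nat.
Qed.

(** Two x-derivatives cost two degrees in x, and the double integration in t gains
    two units in the square root of t, so that the binomial coefficients absorb
    the factors produced. The power of [tau] makes the bound small. *)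
Lemma wt_deriv2_J i j g M : norm_le (w 0) g M ->
  norm_le (w 0) (fps_deriv (xx i) (fps_deriv (xx j) (fps_J g)))
    ((4 * (tau / rho ^+ 2)) * M).
Proof.
pose u := munit (xx i) + munit (xx j) : mi.
have tu a : tdeg (a + u) = tdeg a by rewrite !tdegD !tdeg_x !addn0.
move=> hg; have := (@wt_op 0 0 (fun a => msub (a + u) (munit tt))
   (fun a => (a (xx i)).+1%:R * (a (xx j) + (xx j == xx i :> 'I_(m + 1)))%N.+1%:R / (tdeg a)%:R ^+ 2)
   [pred a | tdeg a != 0%N] g (fps_deriv (xx i) (fps_deriv (xx j) (fps_J g))) (4 * (tau / rho ^+ 2)) M); apply => //.
- by rewrite mulr_ge0// divr_ge0 ?exprn_ge0 ?rho_ge0 ?tau_ge0.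
- exact: shift_inj.
- move=> a; rewrite inE negbK => /eqP ha.
  by rewrite /fps_deriv /fps_J -addrA tu ha /= !mulr0.
- move=> a; rewrite inE => ha.
  rewrite /fps_deriv /fps_J -addrA tu (negPf ha) maddE munitE; ring.
move=> a; rewrite inE => ha.
have [k ak] : exists k, tdeg a = k.+1 by case: (tdeg a) ha => // k; exists k.
have xs : xdeg (msub (a + u) (munit tt)) = (xdeg a).+2.
  by rewrite xdeg_shift// xdegD !xdeg_x addn2.
have ts : tdeg (msub (a + u) (munit tt)) = k.
  by rewrite tdeg_shift// ak tdegD !tdeg_x !addn0.
apply: (@wt_compare 0 0 a _ _ _ ((xdeg a).+1 * (xdeg a).+2) (k.+1 ^ 2) 4) => //.
- by rewrite divr_ge0 ?exprn_ge0 ?rho_ge0 ?tau_ge0.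
- rewrite ak natrX ler_wpM2r ?invr_ge0 ?exprn_ge0// -natrM ler_nat leq_mul//.
    by rewrite ltnS leq_xdeg.
  by rewrite !ltnS; have := leq_xdeg a j; case: eqP => _ /=; lia.
- rewrite xs ts ak !exprS; field.
  by rewrite gt_eqF.
rewrite xs ts ak; set x := xdeg a.
have E : (x.+2 + (2 * k + 0) = x + (2 * k.+1 + 0))%N by lia.
rewrite E; set T := (x + _)%N.
have h1 := mul_bin_left T x; have h2 := mul_bin_left T x.+1.
have T1 : (T - x = 2 * k + 2)%N by rewrite /T; lia.
have T2 : (T - x.+1 = 2 * k + 1)%N by rewrite /T; lia.
rewrite T1 in h1; rewrite T2 in h2.
have -> : (x.+1 * x.+2 * 'C(T, x.+2) = (2 * k + 1) * (2 * k + 2) * 'C(T, x))%N.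
  by rewrite -mulnA h2 mulnCA h1 mulnA.
rewrite leq_mul2r; apply/orP; right; nia.
Qed.

Lemma wt_deriv_J j g M : norm_le (w 0) g M ->
  norm_le (w 0) (fps_deriv (xx j) (fps_J g)) ((4 * (tau / rho)) * M).
Proof.
pose u := munit (xx j) : mi.
have tu a : tdeg (a + u) = tdeg a by rewrite !tdegD !tdeg_x !addn0.
apply: (@wt_op 0 0 (fun a => msub (a + u) (munit tt))
   (fun a => (a (xx j)).+1%:R / (tdeg a)%:R ^+ 2)
   [pred a | tdeg a != 0%N]).
- by rewrite mulr_ge0// divr_ge0 ?rho_ge0 ?tau_ge0.
- exact: shift_inj.
- move=> a; rewrite inE negbK => /eqP ha.
  by rewrite /fps_deriv /fps_J tu ha /= !mulr0.
- move=> a; rewrite inE => ha.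
  rewrite /fps_deriv /fps_J tu (negPf ha); ring.
- by move=> a _; rewrite divr_ge0 ?exprn_ge0.
move=> a; rewrite inE => ha.
have [k ak] : exists k, tdeg a = k.+1 by case: (tdeg a) ha => // k; exists k.
have xs : xdeg (msub (a + u) (munit tt)) = (xdeg a).+1.
  by rewrite xdeg_shift// !xdeg_x addn1.
have ts : tdeg (msub (a + u) (munit tt)) = k.
  by rewrite tdeg_shift// ak !tdeg_x addn0.
apply: (@wt_compare 0 0 a _ _ _ ((xdeg a).+1) (k.+1 ^ 2) 4) => //.
- by rewrite divr_ge0 ?rho_ge0 ?tau_ge0.
- rewrite ak natrX ler_wpM2r ?invr_ge0 ?exprn_ge0// ler_nat.
  by rewrite ltnS leq_xdeg.
- rewrite xs ts ak !exprS; field.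
  by rewrite gt_eqF.
rewrite xs ts ak; set x := xdeg a.
have E : (x.+1 + (2 * k + 0) = x + (2 * k + 1))%N by lia.
rewrite E; set T := (x + _)%N.
have h1 := mul_bin_left T x.
have T1 : (T - x = 2 * k + 1)%N by rewrite /T; lia.
rewrite T1 in h1; rewrite h1 leq_mul//; first by nia.
by apply: leq_bin2l; rewrite /T; lia.
Qed.

(** The t-derivative undoes half of the gain of the integration: the x-derivative
    is then short of half a power of t, and the shift of the weight grows by
    one. *)
Lemma wt_deriv_tJ j g M : norm_le (w 0) g M ->
  norm_le (w 1) (fps_deriv (xx j) (fps_deriv tt (fps_J g))) ((2 * rho^-1) * M).
Proof.
pose u := munit (xx j) + munit tt : mi.
have tu a : tdeg (a + u) = (tdeg a).+1 by rewrite !tdegD tdeg_x tdeg_t add0n addn1.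
apply: (@wt_op 0 1 (fun a => a + munit (xx j))
   (fun a => (a (xx j)).+1%:R / (tdeg a).+1%:R)
   predT).
- by rewrite mulr_ge0// invr_ge0 ltW.
- by move=> a b _ _ /= e'; rewrite -[a](maddK (munit (xx j))) addrC e' addrC maddK.
- by [].
- move=> a _; rewrite /fps_deriv /fps_J -addrA tu /=.
  have -> : (a + munit (xx j)) tt = tdeg a by rewrite -[LHS]/(tdeg _) tdegD tdeg_x addn0.
  rewrite /u addrA [_ + munit tt]addrC maddK; field.
  by rewrite gt_eqF// ltr_pwDl.
- by move=> a _; rewrite divr_ge0.
move=> a _.
have xs : xdeg (a + munit (xx j)) = (xdeg a).+1 by rewrite xdegD xdeg_x addn1.
have ts : tdeg (a + munit (xx j)) = tdeg a by rewrite tdegD tdeg_x addn0.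
apply: (@wt_compare 0 1 a _ _ _ ((xdeg a).+1) ((tdeg a).+1) 2) => //.
- by rewrite invr_ge0 ltW.
- by rewrite ler_wpM2r ?invr_ge0// ler_nat ltnS leq_xdeg.
- rewrite xs ts exprS; field.
  by rewrite gt_eqF.
rewrite xs ts; set x := xdeg a; set k := tdeg a.
have E : (x.+1 + (2 * k + 0) = x + (2 * k + 1))%N by lia.
rewrite E; set T := (x + _)%N.
have h1 := mul_bin_left T x.
have T1 : (T - x = 2 * k + 1)%N by rewrite /T; lia.
rewrite T1 in h1; rewrite h1 leq_mul//; nia.
Qed.

Lemma wt_theta_J g M : norm_le (w 0) g M ->
  norm_le (w 0) (fps_var R tt * fps_deriv tt (fps_J g)) ((1 * tau) * M).
Proof.
apply: (@wt_op 0 0 (fun a => msub (a + 0) (munit tt))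
   (fun a => (tdeg a)%:R^-1) [pred a | tdeg a != 0%N]).
- by rewrite mul1r ltW.
- exact: shift_inj.
- by move=> a; rewrite inE negbK => /eqP ha; rewrite coefX_deriv -/(tdeg a) ha mul0r.
- move=> a; rewrite inE => ha; rewrite coefX_deriv /fps_J addr0 (negPf ha) -/(tdeg a).
  by field; rewrite pnatr_eq0.
- by move=> a _; rewrite invr_ge0.
move=> a; rewrite inE => ha.
have [k ak] : exists k, tdeg a = k.+1 by case: (tdeg a) ha => // k; exists k.
have xs : xdeg (msub (a + 0) (munit tt)) = xdeg a.
  by rewrite xdeg_shift// xdeg0 addn0.
have ts : tdeg (msub (a + 0) (munit tt)) = k.
  by rewrite tdeg_shift// ak /tdeg mzeroE addn0.
apply: (@wt_compare 0 0 a _ _ _ 1 1 1) => //.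
- by rewrite divr1 invf_le1 ?ltr0n ?lt0n// ler1n lt0n.
- by rewrite xs ts ak exprS mulrCA.
rewrite xs ts ak !mul1n; apply: leq_bin2l; lia.
Qed.

(** A factor t pays for two half powers of t. *)
Lemma wt_tM c M : norm_le (w 2) c M -> norm_le (w 0) (fps_var R tt * c) (tau * M).
Proof.
rewrite -[X in norm_le _ _ (X * _)]mul1r.
apply: (@wt_op 2 0 (fun a => msub (a + 0) (munit tt)) (fun=> 1)
  [pred a | tdeg a != 0%N]).
- by rewrite mul1r ltW.
- exact: shift_inj.
- by move=> a; rewrite inE negbK => /eqP ha; rewrite coefXM -/(tdeg a) ha.
- by move=> a; rewrite inE => ha; rewrite coefXM -/(tdeg a) (negPf ha) mul1r addr0.
- by [].
move=> a; rewrite inE => ha.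
have [k ak] : exists k, tdeg a = k.+1 by case: (tdeg a) ha => // k; exists k.
have xs : xdeg (msub (a + 0) (munit tt)) = xdeg a.
  by rewrite xdeg_shift// xdeg0 addn0.
have ts : tdeg (msub (a + 0) (munit tt)) = k.
  by rewrite tdeg_shift// ak /tdeg mzeroE addn0.
apply: (@wt_compare 2 0 a _ _ _ 1 1 1) => //.
- by rewrite divr1.
- by rewrite xs ts ak exprS mulrCA.
by rewrite xs ts ak !mul1n; apply: leq_bin2l; lia.
Qed.

(** Every monomial but the constant one has a weight at most [rho / rho1] times
    the one for the radius [rho1]. *)
Lemma wt_sub_const (rho1 B : R) (c : fps R (m + 1)) :
  tau <= rho -> rho <= rho1 -> norm_le (mpow rho1) c B ->
  norm_le (w 0) (c - fps_const (c 0)) (rho / rho1 * B).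
Proof.
move=> tr r1 hB.
have r10 : 0 < rho1 by exact: lt_le_trans r1.
apply: (norm_le_shift (s := id) (P := predT) _ _ _ _ hB) => //.
  by rewrite divr_ge0 ?rho_ge0 ?(ltW r10).
move=> a _; rewrite coefB /fps_const; have [->|a0] := eqVneq a 0.
  by rewrite subrr normr0 mul0r mulr_ge0 ?divr_ge0 ?mulr_ge0 ?(ltW r10).
rewrite subr0 mulrCA ler_wpM2l// !ger0_norm ?wt_ge0 ?exprn_ge0 ?(ltW r10)//.
have hw : w 0 a <= rho ^+ mdeg a.
  rewrite /wt ler_pdivrMr ?bin_wt_gt0// mdeg_split exprD.
  apply: (@le_trans _ _ (rho ^+ xdeg a * rho ^+ tdeg a)).
    by rewrite ler_wpM2l ?exprn_ge0 ?rho_ge0 ?tau_ge0// lerXn2r ?nnegrE ?rho_ge0 ?tau_ge0.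
  by rewrite ler_peMr ?mulr_ge0 ?exprn_ge0 ?rho_ge0 ?tau_ge0// ler1n bin_gt0 leq_addr.
apply: le_trans hw _; rewrite /mpow.
have [k ->] : exists k, mdeg a = k.+1.
  by move: a0; rewrite -mdeg_eq0; case: (mdeg a) => // k _; exists k.
rewrite !exprS mulrA divfK ?gt_eqF// ler_wpM2l ?rho_ge0//.
by rewrite lerXn2r ?nnegrE ?rho_ge0 ?(ltW r10).
Qed.

(** The binomial denominators grow at most geometrically. *)
Lemma wt_ge_mpow (s : R) c M : 0 <= s -> s + s <= rho -> s * 4 <= tau ->
  norm_le (w 0) c M -> norm_le (mpow s) c M.
Proof.
move=> s0 sr st; apply: norm_le_weight => a.
rewrite !ger0_norm ?wt_ge0 ?exprn_ge0// /mpow /wt mdeg_split exprD.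
rewrite ler_pdivlMr ?bin_wt_gt0//.
have b2 p q : ('C(p + q, p) <= 2 ^ (p + q))%N.
  rewrite -[2%N]/(1 + 1)%N expnDn (bigD1 (inord p)) //= inordK ?ltnS ?leq_addr//.
  by rewrite !exp1n !muln1 leq_addr.
apply: (@le_trans _ _ (s ^+ xdeg a * s ^+ tdeg a * (2 ^+ xdeg a * 4 ^+ tdeg a))).
  rewrite ler_wpM2l ?mulr_ge0 ?exprn_ge0//.
  have -> : 4 ^+ tdeg a = 2 ^+ (2 * tdeg a) :> R by rewrite exprM expr2 -natrM.
  by rewrite -exprD -natrX ler_nat addn0.
rewrite mulrACA -!exprMn ler_pM ?exprn_ge0 ?mulr_ge0//.
  by rewrite lerXn2r ?nnegrE ?mulr_ge0 ?rho_ge0//; lra.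
by rewrite lerXn2r ?nnegrE ?mulr_ge0 ?tau_ge0.
Qed.

Lemma mpow_J (s : R) g M : 0 <= s -> norm_le (mpow s) g M ->
  norm_le (mpow s) (fps_J g) (s * M).
Proof.
move=> s0; apply: (norm_le_shift (s := fun a => msub (a + 0) (munit tt))
   (P := [pred a | tdeg a != 0%N])) => //.
- exact: shift_inj.
- by move=> a; rewrite inE negbK /fps_J => ->.
move=> a; rewrite inE => ha; rewrite addr0 /fps_J (negPf ha).
have -> : mpow s a = s * mpow s (msub a (munit tt)).
  rewrite /mpow -exprS; congr (_ ^+ _).
  by rewrite -[a in LHS](msubK (tle_munit ha)) mdegD mdeg_unit.
rewrite normrM [X in _ * X <= _]normrM (ger0_norm s0) mulrCA ler_wpM2l//.
rewrite ler_wpM2r// ler_piMr// ger0_norm ?invr_ge0 ?exprn_ge0// invf_le1.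
  by rewrite exprn_ege1// ler1n lt0n.
by rewrite exprn_gt0// ltr0n lt0n.
Qed.

End Weights.

(** * The formal Cauchy problem *)

(** Linearity in the last row separates the corner entry [s]; then [t] factors
    out of the last column. *)
Lemma det_block_border (S : comNzRingType) (k : nat) (A : 'M[S]_k)
    (b : 'cV[S]_k) (c : 'rV[S]_k) (s t : S) :
  \det (block_mx A (t *: b) c s%:M) = s * \det A + t * \det (block_mx A b c 0).
Proof.
pose i0 := rshift k (ord0 : 'I_1).
pose B := block_mx A (t *: b) 0 (1%:M : 'M[S]_1).
pose C := block_mx A (t *: b) c (0 : 'M[S]_1).
have rowlast (X : 'M[S]_(k, k + 1)) (u u' : 'M[S]_(1, k + 1)) :
    row' i0 (col_mx X u) = row' i0 (col_mx X u').
  apply/matrixP => i j; rewrite !mxE; case: (split_ordP (lift i0 i)) => l e.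
    by [].
  by have := neq_lift i0 i; rewrite e (ord1 l) eqxx.
have -> : \det (block_mx A (t *: b) c s%:M) = s * \det B + 1 * \det C.
  apply: (determinant_multilinear (i0 := i0)); first last.
  - exact: rowlast.
  - exact: rowlast.
  rewrite /block_mx !rowKd -[row_mx c _]/(row_mx c s%:M); apply/rowP => j.
  rewrite !mxE; case: splitP => l _; rewrite !mxE ?mulr0 ?add0r ?mul1r//.
  by rewrite addr0 mulr_natr.
rewrite det_ublock det1 mulr1 mul1r; congr (_ + _).
have -> : C = block_mx A b c 0 *m block_mx 1%:M 0 0 (t%:M : 'M[S]_1).
  by rewrite mulmx_block !mulmx1 !mulmx0 !addr0 !add0r mul0mx mul_mx_scalar.
by rewrite det_mulmx det_ublock det1 mul1r det_scalar1 mulrC.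
Qed.

Section DetNorm.
Variables (R : realType) (m : nat) (rho tau : R).
Hypotheses (rho0 : 0 < rho) (tau0 : 0 < tau).
Local Notation N e := (norm_le (@wt R m rho tau e)).

Lemma wt_prod_lip (I : Type) (r : seq I) (e : I -> nat) (c d : I -> fps R (m + 1))
    (K del : R) : 1 <= K -> 0 <= del ->
  (forall i, N (e i) (c i) K) -> (forall i, N (e i) (d i) K) ->
  (forall i, N (e i) (c i - d i) del) ->
  N (\sum_(i <- r) e i)%N (\prod_(i <- r) c i) (K ^+ size r) /\
  N (\sum_(i <- r) e i)%N (\prod_(i <- r) c i - \prod_(i <- r) d i)
    ((size r)%:R * K ^+ size r * del).
Proof.
move=> K1 del0 hc hd hcd; have K0 : 0 <= K by lra.
elim: r => [|i r [IH1 IH2]].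
  rewrite !big_nil /= expr0 mul0r mul0r subrr; split; last exact: norm_le0.
  rewrite -fps_const_1 -[X in norm_le _ _ X]normr1; apply: norm_le_const.
  by rewrite wt_zero ler01 lexx.
rewrite !big_cons /= exprS; split; first exact: wt_norm_leM.
have -> : c i * \prod_(j <- r) c j - d i * \prod_(j <- r) d j =
   (c i - d i) * \prod_(j <- r) c j + d i * (\prod_(j <- r) c j - \prod_(j <- r) d j).
  by rewrite mulrBl mulrBr addrA subrK.
apply: norm_leW (norm_leD (wt_norm_leM rho0 tau0 (hcd i) IH1)
  (wt_norm_leM rho0 tau0 (hd i) IH2)).
have Kr : 0 <= K ^+ size r by rewrite exprn_ge0.
rewrite -natr1 mulrDl mul1r mulrDl addrC.
have -> : K * ((size r)%:R * K ^+ size r * del) = (size r)%:R * (K * K ^+ size r) * del by ring.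
rewrite lerD2l mulrC ler_wpM2r// ler_peMl//.
Qed.

Definition det_const (k : nat) (K : R) : R := k`!%:R * (k%:R * K ^+ k).

Lemma det_const_ge0 k K : 0 <= K -> 0 <= det_const k K.
Proof. by move=> K0; rewrite /det_const !mulr_ge0 ?exprn_ge0. Qed.

Lemma wt_signM e (b : bool) c M : N e c M -> N e ((-1) ^+ b * c) M.
Proof. by case: b; rewrite ?expr0 ?mul1r// expr1 mulN1r; exact: norm_leN. Qed.

(** Each product of the Leibniz formula takes one entry per row and per column, so
    that its shifts add up to twice the sum of the [e i]. *)
Lemma wt_det_lip k (e : 'I_k -> nat) (A B : 'M[fps R (m + 1)]_k) (K del : R) :
  1 <= K -> 0 <= del ->
  (forall i j, N (e i + e j)%N (A i j) K) ->
  (forall i j, N (e i + e j)%N (B i j) K) ->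
  (forall i j, N (e i + e j)%N (A i j - B i j) del) ->
  N (\sum_i e i + \sum_i e i)%N (\det A - \det B) (det_const k K * del).
Proof.
move=> K1 del0 hA hB hAB; rewrite /determinant -sumrB.
have -> : det_const k K * del =
    \sum_(s <- index_enum {perm 'I_k}) k%:R * K ^+ k * del.
  by rewrite sumr_const card_Sn -[RHS]mulr_natl /det_const !mulrA.
apply: norm_le_sum => s.
rewrite -mulrBr; apply: wt_signM.
have Es : (\sum_i e i + \sum_i e i = \sum_i (e i + e (s i)))%N.
  by rewrite big_split /=; congr addn; rewrite [LHS](reindex_inj (@perm_inj _ s)).
have [_] := wt_prod_lip (index_enum 'I_k) K1 del0 (fun i => hA i (s i))
  (fun i => hB i (s i)) (fun i => hAB i (s i)).
have -> : size (index_enum 'I_k) = k by rewrite /index_enum unlock -enumT size_enum_ord.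
by rewrite -Es.
Qed.

End DetNorm.

Section Euler.
Variables (R : realType) (n : nat).
Implicit Types c d : fps R n.

Definition fps_euler c : fps R n := fun a => (mdeg a)%:R * c a.
Definition fps_eulerI c : fps R n := fun a => c a / (mdeg a)%:R.

Lemma fps_eulerB c d : fps_euler (c - d) = fps_euler c - fps_euler d.
Proof. by apply/funext => a; rewrite coefB /fps_euler coefB mulrBr. Qed.

Lemma fps_eulerIB c d : fps_eulerI (c - d) = fps_eulerI c - fps_eulerI d.
Proof. by apply/funext => a; rewrite coefB /fps_eulerI coefB mulrBl. Qed.

Lemma fps_eulerID c d : fps_eulerI (c + d) = fps_eulerI c + fps_eulerI d.
Proof. by apply/funext => a; rewrite coefD /fps_eulerI coefD mulrDl. Qed.

Lemma fps_euler_sum c : fps_euler c = \sum_i fps_var R i * fps_deriv i c.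
Proof.
apply/funext => a; rewrite coef_sum /fps_euler /mdeg natr_sum mulr_suml.
by apply: eq_bigr => i _; rewrite coefX_deriv.
Qed.

(** Euler's operator loses a degree that its inverse recovers, so that only the
    factor being differentiated, without its constant term, is measured. *)
Lemma norm_le_eulerI (w : mindex n -> R) c d M N :
  (forall a, 0 <= w a) -> (forall a b, w (a + b) <= w a * w b) ->
  norm_le w c M -> norm_le w (d - fps_const (d 0)) N ->
  norm_le w (fps_eulerI (c * fps_euler d)) (M * N).
Proof.
move=> w0 wM hc hd; apply: norm_le_conv hc hd => // a.
rewrite /fps_eulerI coefM mulr_suml; apply: le_trans (ler_norm_sum _ _ _) _.
rewrite big_seq [leRHS]big_seq; apply: ler_sum => x.
rewrite mem_antidiag => /eqP <-; rewrite -mulrA normrM ler_wpM2l//.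
rewrite coefB /fps_const /fps_euler; have [->|x0] := eqVneq x.2 0.
  by rewrite mdeg0 !mul0r normr0.
rewrite subr0 mulrAC normrM ler_piMl// ger0_norm ?divr_ge0//.
by rewrite ler_pdivrMr ?mul1r ?ler_nat mdegD ?leq_addl// ltr0n addn_gt0 orbC lt0n mdeg_eq0 x0.
Qed.

(** Euler's operator determines a series up to its constant term, so that a
    differential equation and an initial value combine into one integral
    equation. *)
Lemma fps_eulerI_eq c d (k : R) :
  c = fps_const k - fps_eulerI (c * fps_euler d) <->
  c 0 = k /\ fps_euler c = - (c * fps_euler d).
Proof.
split=> [e|[e0 e]].
  have e0 : c 0 = k.
    by rewrite e coefB /fps_const eqxx /fps_eulerI mdeg0 invr0 mulr0 subr0.
  split=> //; apply/funext => a; rewrite coefN.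
  have [->|a0] := eqVneq a 0.
    by rewrite /fps_euler mdeg0 mul0r coef0M mdeg0 mul0r mulr0 oppr0.
  rewrite {1}/fps_euler {1}e coefB /fps_const (negPf a0) sub0r /fps_eulerI.
  by rewrite mulrN mulrC divfK// pnatr_eq0 mdeg_eq0.
apply/funext => a; rewrite coefB /fps_const /fps_eulerI.
have [->|a0] := eqVneq a 0; first by rewrite mdeg0 invr0 mulr0 subr0.
have := congr1 (fun c => c a) e; rewrite coefN {1}/fps_euler => e1.
rewrite sub0r -mulNr -e1 mulrC mulKf// pnatr_eq0 mdeg_eq0//.
Qed.

End Euler.

Section SolitonSeries.
Variables (R : realType) (n : nat).
Implicit Types (q h : 'rV[R]_n) (c d : fps R n).

Definition fps_coord q j : fps R n := fps_const (q 0 j) + fps_var R j.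

Definition soliton_mx q c : 'M[fps R n]_n :=
  \matrix_(i, j) fps_deriv i (fps_coord q j * fps_deriv j c).

Definition soliton_exponent h q c : fps R n :=
  fps_const 2^-1 * \sum_j fps_const (h 0 j) * (fps_coord q j * fps_deriv j c).

Lemma soliton_mxE q c i j : soliton_mx q c i j =
  (i == j)%:R * fps_deriv j c + fps_coord q j * fps_deriv i (fps_deriv j c).
Proof.
rewrite mxE /fps_coord !mulrDl fps_derivD fps_derivCM fps_derivXM.
by rewrite addrCA.
Qed.

Lemma soliton_mxB q c d i j :
  soliton_mx q c i j - soliton_mx q d i j = soliton_mx q (c - d) i j.
Proof. by rewrite !mxE -fps_derivB -mulrBr -fps_derivB. Qed.

Lemma soliton_exponentB h q c d :
  soliton_exponent h q c - soliton_exponent h q d = soliton_exponent h q (c - d).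
Proof.
rewrite /soliton_exponent -mulrBr -sumrB; congr (_ * _); apply: eq_bigr => j _.
by rewrite -mulrBr -mulrBr -fps_derivB.
Qed.

Lemma expands_coord (p : 'rV[R]_n) r j :
  expands p r (fps_coord p j) (fun x => x 0 j).
Proof.
have := expandsD (expands_const p r (p 0 j)) (@expands_var R n p r j).
by apply: eq_expands => x _; rewrite addrC subrK.
Qed.

Lemma expands_soliton_mx (p : 'rV[R]_n) r c f i j : expands p r c f ->
  expands p r (soliton_mx p c i j) (partial i (fun s => s 0 j * partial j f s)).
Proof.
move=> hf; rewrite mxE; apply: expands_deriv; apply: expandsM.
  exact: expands_coord.
exact: expands_deriv.
Qed.

Lemma expands_soliton_exponent (p : 'rV[R]_n) r c f h : expands p r c f ->
  expands p r (soliton_exponent h p c)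
    (fun x => 2^-1 * \sum_j h 0 j * (x 0 j * partial j f x)).
Proof.
move=> hf; apply: expandsM; first exact: expands_const.
apply: expands_sum => j; apply: expandsM; first exact: expands_const.
by apply: expandsM; [exact: expands_coord|exact: expands_deriv].
Qed.

Lemma norm_le_delta (w : mindex n -> R) b : 0 <= w b ->
  norm_le w (fps_delta R b) (w b).
Proof.
move=> wb A; have [bA|bA] := boolP (b \in A).
  rewrite (big_fsetD1 b bA) /= {1}/fps_delta eqxx mul1r big1_fset ?addr0 ?ger0_norm//.
  by move=> a; rewrite !inE /fps_delta => /andP[/negPf -> _] _; rewrite mul0r normr0.
rewrite big1_fset// => a aA _; rewrite /fps_delta.
by case: eqP => [e|_]; [move: bA; rewrite -e aA|rewrite mul0r normr0].
Qed.

End SolitonSeries.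

(** ** The contraction *)

Section Contraction.
Variables (R : realType) (m : nat) (q h : 'rV[R]_(m + 1)) (v : fps R (m + 1)).
Local Notation xx := (lshift 1).
Local Notation tt := (rshift m (ord0 : 'I_1)).
Local Notation fpsn := (fps R (m + 1)).
Hypothesis q_t : q 0 tt = 0.
Hypothesis v_t : forall a, tdeg a != 0%N -> v a = 0.
Implicit Types g : fpsn.

Definition ser g : fpsn := v + fps_J g.
Definition mx_x g : 'M[fpsn]_m :=
  \matrix_(i, j) soliton_mx q (ser g) (xx i) (xx j).
(** The factor t that the entries of the last column of the soliton matrix contain
    has been taken out of it. *)
Definition mx_border g : 'M[fpsn]_(m + 1) :=
  block_mx (mx_x g)
    (\col_i fps_deriv (xx i) (fps_deriv tt (fps_J g)))
    (\row_j (fps_coord q (xx j) * fps_deriv (xx j) (fps_deriv tt (fps_J g)))) 0.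

Lemma mx_xE g i j : mx_x g i j = soliton_mx q (ser g) (xx i) (xx j).
Proof. by rewrite [LHS]mxE. Qed.

Lemma deriv_t_v : fps_deriv tt v = 0.
Proof.
apply/funext => a; rewrite /fps_deriv v_t ?mulr0//.
by rewrite tdegD tdeg_t addn1.
Qed.

Lemma coord_t : fps_coord q tt = fps_var R tt.
Proof.
rewrite /fps_coord q_t -[RHS]add0r; congr (_ + _).
by apply/funext => a; rewrite /fps_const; case: eqP.
Qed.

Lemma deriv_t_ser g : fps_deriv tt (ser g) = fps_deriv tt (fps_J g).
Proof. by rewrite /ser fps_derivD deriv_t_v add0r. Qed.

(** The operator [fps_J] is designed so that the corner entry of the matrix is the
    unknown itself. *)
Lemma soliton_mx_tt g : soliton_mx q (ser g) tt tt = g.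
Proof.
rewrite mxE coord_t deriv_t_ser; apply/funext => a.
rewrite /fps_deriv coefX_deriv /fps_J.
have -> : tdeg (a + munit tt) = (a tt).+1 by rewrite tdegD tdeg_t addn1.
rewrite /= [a + _]addrC maddK maddE munitE eqxx add1n.
by field; rewrite gt_eqF// ltr_pwDl.
Qed.

Lemma det_soliton_mx g :
  \det (soliton_mx q (ser g)) = g * \det (mx_x g) + fps_var R tt * \det (mx_border g).
Proof.
rewrite -det_block_border; congr (\det _); rewrite -[LHS]submxK; congr block_mx.
- by apply/matrixP => i j; rewrite !mxE.
- apply/matrixP => i j; rewrite (ord1 j) !(mxE, soliton_mxE) coord_t deriv_t_ser.
  by rewrite eq_lrshift mul0r add0r.
- apply/matrixP => i j; rewrite (ord1 i) !(mxE, soliton_mxE) eq_rlshift mul0r add0r.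
  by rewrite fps_derivC deriv_t_ser.
by apply/matrixP => i j; rewrite (ord1 i) (ord1 j) [RHS]mxE eqxx mulr1n -[RHS]soliton_mx_tt !mxE.
Qed.

Variables (D0 F0 : R).
Hypothesis D0E : D0 = (\det (mx_x 0)) 0.
Hypothesis D0_neq0 : D0 != 0.

(** By [det_soliton_mx] the determinant is [D0 * g] up to terms that are small near
    the centre, so that the integral equation can be solved for this occurrence
    of [g]. *)
Definition Phi g : fpsn := fps_const D0^-1 *
  (fps_const F0
   - fps_eulerI (\det (soliton_mx q (ser g)) * fps_euler (soliton_exponent h q (ser g)))
   - g * (\det (mx_x g) - fps_const D0) - fps_var R tt * \det (mx_border g)).

Lemma Phi_fix g : Phi g = g <->
  \det (soliton_mx q (ser g)) = fps_const F0
   - fps_eulerI (\det (soliton_mx q (ser g)) * fps_euler (soliton_exponent h q (ser g))).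
Proof.
rewrite /Phi; set X := fps_const F0 - _; rewrite [in X in _ <-> X]det_soliton_mx.
set A := \det (mx_x g); set T := fps_var R tt * _.
have DV : fps_const D0 * fps_const D0^-1 = 1 :> fpsn by rewrite fps_constM divff.
split=> [e|e].
  have : fps_const D0 * (fps_const D0^-1 * (X - g * (A - fps_const D0) - T)) =
     fps_const D0 * g by rewrite e.
  rewrite mulrA DV mul1r => e1.
  have -> : X = (X - g * (A - fps_const D0) - T) + g * (A - fps_const D0) + T.
    by ring.
  by rewrite e1; ring.
rewrite -e; have -> : g * A + T - g * (A - fps_const D0) - T = fps_const D0 * g by ring.
by rewrite mulrA [fps_const D0^-1 * _]mulrC DV mul1r.
Qed.

Lemma mx_border0_det : \det (mx_border 0) = 0.
Proof.
rewrite (expand_det_row _ tt) big1// => j _.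
suff -> : mx_border 0 tt j = 0 by rewrite mul0r.
rewrite /mx_border fps_J0; case: (split_ordP j) => l ->.
  rewrite block_mxEdl mxE.
  by rewrite !fps_deriv0 mulr0.
by rewrite block_mxEdr mxE.
Qed.

Lemma Phi0E : Phi 0 = fps_const (F0 / D0).
Proof.
rewrite /Phi det_soliton_mx mx_border0_det !mul0r mulr0 addr0 mul0r.
have -> : fps_eulerI (0 : fpsn) = 0 by apply/funext => a; rewrite /fps_eulerI coef0 mul0r.
by rewrite !subr0 fps_constM mulrC.
Qed.

End Contraction.

(** ** The contraction estimate *)

Section Estimates.
Variables (R : realType) (m : nat) (q h : 'rV[R]_(m + 1)) (v : fps R (m + 1)).
Local Notation xx := (lshift 1).
Local Notation tt := (rshift m (ord0 : 'I_1)).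
Local Notation fpsn := (fps R (m + 1)).
Hypothesis q_t : q 0 tt = 0.
Hypothesis v_t : forall a, tdeg a != 0%N -> v a = 0.
Variables (D0 F0 : R).
Hypothesis D0E : D0 = (\det (mx_x q v 0)) 0.
Hypothesis D0_neq0 : D0 != 0.
Variables (rho1 B : R).
Hypothesis rho1_gt0 : 0 < rho1.
Hypothesis mx_bound : forall i j, norm_le (mpow rho1) (mx_x q v 0 i j) B.
Hypothesis exponent_bound : norm_le (mpow rho1) (soliton_exponent h q v) B.
Hypothesis B_ge0 : 0 <= B.

Variables (G R0 : R).
Hypotheses (G_ge0 : 0 <= G) (R0_ge1 : 1 <= R0).
Hypothesis coord_le : forall j, `|q 0 j| + 1 <= R0.
Local Notation Hs := (\sum_j `|h 0 j|).
Implicit Types (g : fpsn) (del : R).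

Section FixedRadii.
Variables (rho tau eps : R).
Hypotheses (rho0 : 0 < rho) (tau0 : 0 < tau) (tau_rho : tau <= rho)
  (rho_rho1 : rho <= rho1) (rho_le1 : rho <= 1) (eps0 : 0 < eps) (eps2 : eps <= 2^-1).

(** Lipschitz constants: [k1] for the x-block of the matrix, [k3] for the exponent,
    [k4] for the bordered matrix, [C1] and [C2] for the determinants of the first
    and of the last, [Lam] for the full determinant; [K1] bounds the bordered
    entries. *)
Let k1 : R := (4 * (tau / rho) + R0 * (4 * (tau / rho ^+ 2))).
Let k3 : R := (2^-1 * (Hs * (R0 * (4 * (tau / rho)) + tau))).
Let k4 : R := (1 + R0 * (2 * rho^-1)).
Let K1 : R := (B + 2 + k4 * G).
Let C1 : R := (det_const m (B + 1)).
Let C2 : R := (det_const (m + 1) K1).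
Let Lam : R := (`|D0| + 3 * C1 + 1).

Hypotheses (H1 : rho / rho1 * B <= eps) (H2 : k1 * (1 + G) <= eps)
  (H3 : k3 * (1 + G) <= eps) (H4 : tau * (C2 * k4) * (1 + G) <= eps)
  (H5 : (3 * Lam + 3 * C1 + 1) * eps <= `|D0| / 2).

Local Notation N e := (norm_le (@wt R m rho tau e)).

Local Ltac slra := move: B_ge0 G_ge0 R0_ge1 eps0 eps2 rho_le1; lra.

Let rho_ge0 : 0 <= rho. Proof. exact: ltW. Qed.
Let tau_ge0 : 0 <= tau. Proof. exact: ltW. Qed.
Let R00 : 0 <= R0. Proof. slra. Qed.
Let tr_ge0 : 0 <= tau / rho. Proof. exact: divr_ge0. Qed.
Let k1_ge0 : 0 <= k1.
Proof.
rewrite /k1; apply: addr_ge0; first exact: mulr_ge0.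
by apply: mulr_ge0 => //; apply: mulr_ge0 => //; apply: divr_ge0 => //; exact: exprn_ge0.
Qed.
Let rhoV_ge0 : 0 <= 2 * rho^-1. Proof. by apply: mulr_ge0 => //; rewrite invr_ge0. Qed.
Let k4_ge1 : 1 <= k4. Proof. by rewrite /k4 lerDl mulr_ge0. Qed.
Let k4_ge0 : 0 <= k4. Proof. exact: le_trans k4_ge1. Qed.
Let k3_ge0 : 0 <= k3.
Proof.
rewrite /k3; apply: mulr_ge0; first by rewrite invr_ge0.
apply: mulr_ge0; first exact: sumr_ge0.
by apply: addr_ge0 => //; apply: mulr_ge0 => //; exact: mulr_ge0.
Qed.
Let B1_ge0 : 0 <= B + 1. Proof. slra. Qed.
Let C1_ge0 : 0 <= C1. Proof. exact: det_const_ge0. Qed.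
Let K1_ge1 : 1 <= K1.
Proof. by rewrite /K1; move: (mulr_ge0 k4_ge0 G_ge0); slra. Qed.
Let C2_ge0 : 0 <= C2. Proof. apply: det_const_ge0; exact: le_trans K1_ge1. Qed.
Let oneG : 1 <= 1 + G. Proof. slra. Qed.
Let GG : G <= 1 + G. Proof. slra. Qed.
Let k1_eps : k1 <= eps.
Proof. by apply: le_trans H2; rewrite ler_peMr. Qed.
Let k1G_eps : k1 * G <= eps.
Proof. by apply: le_trans H2; rewrite ler_wpM2l. Qed.
Let k3G_eps : k3 * G <= eps.
Proof. by apply: le_trans H3; rewrite ler_wpM2l. Qed.
Let k5_ge0 : 0 <= tau * (C2 * k4). Proof. by apply: mulr_ge0 => //; exact: mulr_ge0. Qed.
Let k5_eps : tau * (C2 * k4) <= eps.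
Proof. by apply: le_trans H4; rewrite ler_peMr. Qed.

Let N_coord j : N 0 (fps_coord q (xx j)) R0.
Proof.
rewrite /fps_coord; apply: (norm_leW _ (norm_leD (M := `|q 0 (xx j)|) (N := rho) _ _)).
- by have := coord_le (xx j); slra.
- by apply: norm_le_const; rewrite wt_zero ler01 lexx.
have := norm_le_delta (wt_ge0 rho0 tau0 0 (munit (xx j))).
by rewrite {2}/wt xdeg_x tdeg_x expr1 expr0 mulr1 addn0 bin1 invr1 mulr1.
Qed.

Let N_mul c d M M' : N 0 c M -> N 0 d M' -> N 0 (c * d) (M * M').
Proof. exact: wt_norm_leM. Qed.

Let N_bool (b : bool) c M : N 0 c M -> N 0 (b%:R * c) M.
Proof.
by case: b => hc; rewrite ?mul1r// mul0r; apply: norm_leW (norm_le_ge0 hc) (norm_le0 _).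
Qed.

Let serB g g' : ser v g - ser v g' = fps_J (g - g').
Proof. by rewrite /ser fps_JB opprD addrACA subrr add0r. Qed.

Let N_mxB g g' del : N 0 (g - g') del ->
  forall i j, N 0 (mx_x q v g i j - mx_x q v g' i j) (k1 * del).
Proof.
move=> hg i j; rewrite !mx_xE soliton_mxB serB soliton_mxE /k1 [X in norm_le _ _ X]mulrDl; apply: norm_leD.
  by apply: N_bool; exact: wt_deriv_J.
rewrite -mulrA; apply: N_mul => //; exact: wt_deriv2_J.
Qed.

Let N_mx_const i j : N 0 (mx_x q v 0 i j - fps_const (mx_x q v 0 i j 0)) eps.
Proof. exact: norm_leW H1 (wt_sub_const rho0 tau0 tau_rho rho_rho1 (mx_bound i j)). Qed.

Let mx_coef0 i j : `|mx_x q v 0 i j 0| <= B.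
Proof.
have := abs_bounded_term 0 (mx_bound i j).
by rewrite /mpow mdeg0 expr0 mulr1.
Qed.

Let N_const (k : R) : N 0 (fps_const k) `|k|.
Proof. by apply: norm_le_const; rewrite wt_zero ler01 lexx. Qed.

Let g_sub0 g : N 0 g G -> N 0 (g - 0) G. Proof. by rewrite subr0. Qed.

Let N_mxD g i j : N 0 g G -> N 0 (mx_x q v g i j - fps_const (mx_x q v 0 i j 0)) (2 * eps).
Proof.
move=> hg; have := norm_leD (N_mxB (g_sub0 hg) i j) (N_mx_const i j).
rewrite addrA subrK; apply: norm_leW; move: k1G_eps; slra.
Qed.

Let N_mx g i j : N 0 g G -> N 0 (mx_x q v g i j) (B + 1).
Proof.
move=> hg; have := norm_leD (N_mxD i j hg) (N_const (mx_x q v 0 i j 0)).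
by rewrite subrK; apply: norm_leW; have := mx_coef0 i j; move: eps2; slra.
Qed.

Let B1 : 1 <= B + 1. Proof. slra. Qed.

Let N_detB g g' del : N 0 g G -> N 0 g' G -> N 0 (g - g') del ->
  N 0 (\det (mx_x q v g) - \det (mx_x q v g')) (C1 * (k1 * del)).
Proof.
move=> hg hg' hgg.
have := wt_det_lip rho0 tau0 (e := fun=> 0%N) B1 (mulr_ge0 k1_ge0 (norm_le_ge0 hgg))
  (fun i j => N_mx i j hg) (fun i j => N_mx i j hg') (N_mxB hgg).
by rewrite big1_eq.
Qed.

Let N_detD g : N 0 g G ->
  N 0 (\det (mx_x q v g) - fps_const D0) (C1 * (2 * eps)).
Proof.
move=> hg; pose A := map_mx (@fps_const R (m + 1) \o @fps_coef0 R (m + 1)) (mx_x q v 0).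
have -> : fps_const D0 = \det A :> fpsn.
  by rewrite /A map_mx_comp !det_map_mx D0E.
have hA i j : N 0 (A i j) (B + 1).
  rewrite /A mxE /=; apply: norm_leW (N_const _).
  by apply: le_trans (mx_coef0 i j) _; slra.
have := wt_det_lip rho0 tau0 (e := fun=> 0%N) (del := 2 * eps) B1 _
  (fun i j => N_mx i j hg) hA.
rewrite big1_eq; apply; first slra.
by move=> i j; have := N_mxD i j hg; rewrite /A [X in _ -> N _ (_ - X) _]mxE.
Qed.

Let N_tB g g' del j : N 0 (g - g') del ->
  N 1 (fps_deriv (xx j) (fps_deriv tt (fps_J g)) -
       fps_deriv (xx j) (fps_deriv tt (fps_J g'))) (2 * rho^-1 * del).
Proof. by move=> hg; rewrite -!fps_derivB -fps_JB; exact: wt_deriv_tJ. Qed.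

(** The last row and the last column carry one half power of t each, so that the
    bordered determinant has shift two, which its factor t pays for. *)
Let eps_t (i : 'I_(m + 1)) : nat := (i == tt).

Let N_border_B g g' del i j : N 0 (g - g') del ->
  N (eps_t i + eps_t j)%N (mx_border q v g i j - mx_border q v g' i j) (k4 * del).
Proof.
move=> hg; have del0 := norm_le_ge0 hg.
have k2 : 2 * rho^-1 <= k4.
  have : 2 * rho^-1 <= R0 * (2 * rho^-1) by rewrite ler_peMl.
  rewrite /k4; slra.
rewrite /eps_t /mx_border.
case: (split_ordP i) => i' ->; case: (split_ordP j) => j' ->.
- rewrite !block_mxEul !eq_lrshift; apply: norm_leW (N_mxB hg i' j').
  by rewrite ler_wpM2r//; move: k1_eps k4_ge1 eps2; slra.
- rewrite !block_mxEur (ord1 j') eqxx eq_lrshift [X in N _ (X - _)]mxE [X in N _ (_ - X)]mxE.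
  by apply: norm_leW (N_tB i' hg); rewrite ler_wpM2r.
- rewrite !block_mxEdl (ord1 i') eqxx eq_lrshift [X in N _ (X - _)]mxE [X in N _ (_ - X)]mxE.
  rewrite -mulrBr; apply: norm_leW (wt_norm_leM rho0 tau0 (N_coord j') (N_tB j' hg)).
  by rewrite mulrA ler_wpM2r// lerDr.
rewrite !block_mxEdr !mxE subrr; apply: norm_leW (norm_le0 _).
by rewrite mulr_ge0//; slra.
Qed.

Let N_border g i j : N 0 g G -> N (eps_t i + eps_t j)%N (mx_border q v g i j) K1.
Proof.
move=> hg.
suff hb : N (eps_t i + eps_t j)%N (mx_border q v 0 i j) (B + 2).
  by have := norm_leD (N_border_B i j (g_sub0 hg)) hb; rewrite subrK addrC.
have g0 : N 0 (0 : fpsn) G by apply: norm_leW (norm_le0 _).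
rewrite /eps_t /mx_border fps_J0.
have B2 : 0 <= B + 2 by slra.
case: (split_ordP i) => i' ->; case: (split_ordP j) => j' ->.
- rewrite !block_mxEul !eq_lrshift; apply: norm_leW (N_mx i' j' g0); slra.
- by rewrite !block_mxEur mxE !fps_deriv0; apply: norm_leW (norm_le0 _).
- by rewrite !block_mxEdl mxE !fps_deriv0 mulr0; apply: norm_leW (norm_le0 _).
by rewrite !block_mxEdr mxE; apply: norm_leW (norm_le0 _).
Qed.

Let N_detborder_B g g' del : N 0 g G -> N 0 g' G -> N 0 (g - g') del ->
  N 0 (fps_var R tt * \det (mx_border q v g) - fps_var R tt * \det (mx_border q v g'))
    (tau * (C2 * (k4 * del))).
Proof.
move=> hg hg' hgg; rewrite -mulrBr; apply: wt_tM => //.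
have k4d : 0 <= k4 * del by apply: mulr_ge0 k4_ge0 (norm_le_ge0 hgg).
have := wt_det_lip rho0 tau0 (e := eps_t) K1_ge1 k4d
  (fun i j => N_border i j hg) (fun i j => N_border i j hg')
  (fun i j => N_border_B i j hgg).
suff -> : (\sum_i eps_t i = 1)%N by [].
rewrite (bigD1 tt)//= big1 /eps_t ?eqxx// => i /negPf ->//.
Qed.

Let P g := \det (soliton_mx q (ser v g)).
Let L g := soliton_exponent h q (ser v g).

Let N_LB g g' del : N 0 (g - g') del -> N 0 (L g - L g') (k3 * del).
Proof.
move=> hg; have del0 := norm_le_ge0 hg.
rewrite /L soliton_exponentB serB /soliton_exponent /k3 -mulrA.
apply: N_mul.
  by apply: norm_leW (N_const _); rewrite ger0_norm// invr_ge0.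
rewrite -mulrA mulr_suml; apply: norm_le_sum => j; apply: N_mul => //.
have t1 : 0 <= R0 * (4 * (tau / rho)) 
  by apply: mulr_ge0 => //; exact: mulr_ge0.
case: (split_ordP j) => j' ->.
  apply: norm_leW (N_mul (N_coord j') (wt_deriv_J rho0 tau0 j' hg)).
  by rewrite mulrA ler_wpM2r// lerDl.
rewrite (ord1 j') coord_t//.
apply: norm_leW (wt_theta_J rho0 tau0 hg).
by rewrite mul1r ler_wpM2r// lerDr.
Qed.

Let ser0 : ser v 0 = v. Proof. by rewrite /ser fps_J0 addr0. Qed.

Let N_LD g : N 0 g G -> N 0 (L g - fps_const (L g 0)) (2 * eps).
Proof.
move=> hg.
have h1 := norm_le_sub_const (N_LB (g_sub0 hg)).
have h2 : N 0 (L 0 - fps_const (L 0 0)) eps.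
  rewrite /L ser0.
  exact: norm_leW H1 (wt_sub_const rho0 tau0 tau_rho rho_rho1 exponent_bound).
have := norm_leD h1 h2; rewrite coefB raddfB /=.
have -> : L g - L 0 - (fps_const (L g 0) - fps_const (L 0 0)) + (L 0 - fps_const (L 0 0))
   = L g - fps_const (L g 0) by ring.
by apply: norm_leW; move: k3G_eps; slra.
Qed.

Let N_PB g g' del : N 0 g G -> N 0 g' G -> N 0 (g - g') del -> N 0 (P g - P g') (Lam * del).
Proof.
move=> hg hg' hgg; have del0 := norm_le_ge0 hgg.
rewrite /P !det_soliton_mx//.
set A := \det (mx_x q v g); set A' := \det (mx_x q v g').
set T := fps_var R tt * _; set T' := fps_var R tt * _.
have -> : g * A + T - (g' * A' + T') = (g - g') * ((A - fps_const D0) + fps_const D0)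
  + g' * (A - A') + (T - T') by ring.
have hA := N_mul hgg (norm_leD (N_detD hg) (N_const D0)).
have := norm_leD (norm_leD hA (N_mul hg' (N_detB hg hg' hgg))) (N_detborder_B hg hg' hgg).
apply: norm_leW.
have e1 : G * (C1 * (k1 * del)) <= C1 * del.
  have -> : G * (C1 * (k1 * del)) = (C1 * del) * (k1 * G) by ring.
  have Cd : 0 <= C1 * del by exact: mulr_ge0.
  by rewrite ler_piMr//; apply: le_trans k1G_eps _; slra.
have e2 : tau * (C2 * (k4 * del)) <= del.
  have -> : tau * (C2 * (k4 * del)) = del * (tau * (C2 * k4)) by ring.
  rewrite ler_piMr//; apply: le_trans k5_eps _; slra.
have e3 : del * (C1 * (2 * eps) + `|D0|) <= del * (C1 + `|D0|).
  rewrite ler_wpM2l// lerD2r ler_piMr//; slra.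
have e4 : 0 <= C1 * del by rewrite mulr_ge0.
apply: le_trans (lerD (lerD e3 e1) e2) _; 
have -> : Lam * del = `|D0| * del + 3 * (C1 * del) + del by rewrite /Lam; ring.
rewrite mulrDr [del * C1]mulrC [del * `|D0|]mulrC; slra.
Qed.

Let N_P g : N 0 g G -> N 0 (P g) (Lam * G).
Proof.
move=> hg; have g0 : N 0 (0 : fpsn) G by apply: norm_leW (norm_le0 _).
have := N_PB hg g0 (g_sub0 hg).
by rewrite {2}/P det_soliton_mx// mx_border0_det mul0r mulr0 addr0 subr0.
Qed.

(** Every difference is either multiplied by an entry without its constant term,
    small with [rho], or is an integral, possibly differentiated, small
    with [tau]. *)
Lemma Phi_contraction g g' del : N 0 g G -> N 0 g' G -> N 0 (g - g') del ->
  N 0 (Phi q h v D0 F0 g - Phi q h v D0 F0 g') (del / 2).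
Proof.
move=> hg hg' hgg; have del0 := norm_le_ge0 hgg.
rewrite /Phi -mulrBr -/(P g) -/(P g') -/(L g) -/(L g').
set A := \det (mx_x q v g); set A' := \det (mx_x q v g').
set T := fps_var R tt * _; set T' := fps_var R tt * _.
have w0 := wt_ge0 (m := m) rho0 tau0 0.
have wM : forall a b, @wt R m rho tau 0 (a + b) <= wt rho tau 0 a * wt rho tau 0 b.
  by move=> a b; exact: (wtM rho0 tau0 0 0).
have E1 : N 0 (fps_eulerI (P g * fps_euler (L g)) - fps_eulerI (P g' * fps_euler (L g')))
    (Lam * del * (2 * eps) + Lam * G * (k3 * del)).
  have -> : fps_eulerI (P g * fps_euler (L g)) - fps_eulerI (P g' * fps_euler (L g')) =
     fps_eulerI ((P g - P g') * fps_euler (L g)) + fps_eulerI (P g' * fps_euler (L g - L g')).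
    rewrite -fps_eulerIB -fps_eulerID fps_eulerB; congr fps_eulerI.
    by rewrite mulrBl mulrBr addrA subrK.
  apply: norm_leD.
    exact: norm_le_eulerI w0 wM (N_PB hg hg' hgg) (N_LD hg).
  apply: norm_le_eulerI w0 wM (N_P hg') _.
  exact: norm_le_sub_const (N_LB hgg).
have E2 : N 0 (g * (A - fps_const D0) - g' * (A' - fps_const D0))
    (del * (C1 * (2 * eps)) + G * (C1 * (k1 * del))).
  have -> : g * (A - fps_const D0) - g' * (A' - fps_const D0) =
    (g - g') * (A - fps_const D0) + g' * (A - A') by ring.
  by apply: norm_leD; apply: N_mul => //; [exact: N_detD | exact: N_detB].
have E3 := N_detborder_B hg hg' hgg.
have -> : fps_const F0 - fps_eulerI (P g * fps_euler (L g)) - g * (A - fps_const D0) - T -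
   (fps_const F0 - fps_eulerI (P g' * fps_euler (L g')) - g' * (A' - fps_const D0) - T') =
   - (fps_eulerI (P g * fps_euler (L g)) - fps_eulerI (P g' * fps_euler (L g'))
   + (g * (A - fps_const D0) - g' * (A' - fps_const D0)) + (T - T')) by ring.
apply: norm_leW (N_mul (N_const _) (norm_leN (norm_leD (norm_leD E1 E2) E3))).
have D0p : 0 < `|D0| by rewrite normr_gt0.
rewrite normfV mulrC ler_pdivrMr//.
have -> : del / 2 * `|D0| = del * (`|D0| / 2) by ring.
have Lam0 : 0 <= Lam by rewrite /Lam; move: C1_ge0 (normr_ge0 D0); slra.
have e1 : Lam * G * (k3 * del) <= Lam * eps * del.
  have -> : Lam * G * (k3 * del) = (Lam * del) * (k3 * G) by ring.
  by rewrite [leRHS]mulrAC; apply: ler_wpM2l => //; exact: mulr_ge0.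
have e2 : G * (C1 * (k1 * del)) <= C1 * eps * del.
  have -> : G * (C1 * (k1 * del)) = (C1 * del) * (k1 * G) by ring.
  by rewrite [leRHS]mulrAC; apply: ler_wpM2l => //; exact: mulr_ge0.
have e3 : tau * (C2 * (k4 * del)) <= eps * del.
  have -> : tau * (C2 * (k4 * del)) = (tau * (C2 * k4)) * del by ring.
  by rewrite ler_wpM2r.
have e4 := ler_wpM2l del0 H5.
apply: le_trans (lerD (lerD (lerD (lexx _) e1) (lerD (lexx _) e2)) e3) _.
apply: le_trans e4; rewrite le_eqVlt; apply/orP; left; apply/eqP; rewrite /Lam; ring.
Qed.

End FixedRadii.

(** First [rho] is taken small, which brings the given series close to their
    constant terms; the constants of the remaining estimates then depend on
    [rho], and [tau] is taken small against them. *)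
Lemma Phi_contraction_small : exists2 r0 : R, 0 < r0 &
  forall rho, 0 < rho -> rho <= r0 -> exists2 t0 : R, 0 < t0 &
  forall tau, 0 < tau -> tau <= t0 -> tau <= rho /\
    forall g g' del, norm_le (wt rho tau 0) g G -> norm_le (wt rho tau 0) g' G ->
    norm_le (wt rho tau 0) (g - g') del ->
    norm_le (wt rho tau 0) (Phi q h v D0 F0 g - Phi q h v D0 F0 g') (del / 2).
Proof.
have small (K e t : R) : 0 <= K -> 0 <= t -> 0 < e -> t <= e / (K + 1) -> t * K <= e.
  move=> K0 t0 e0; rewrite ler_pdivlMr; last by lra.
  by apply: le_trans; rewrite ler_wpM2l//; lra.
have B0 := B_ge0; have R1 := R0_ge1; have G0 := G_ge0; have r10 := rho1_gt0.
pose C1 := det_const m (B + 1).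
have C10 : 0 <= C1 by apply: det_const_ge0; lra.
pose Lam := `|D0| + 3 * C1 + 1.
have D0p : 0 < `|D0| by rewrite normr_gt0.
have Lp : 0 < 3 * Lam + 3 * C1 + 1 by rewrite /Lam; lra.
pose eps := Num.min (2^-1) (`|D0| / 2 / (3 * Lam + 3 * C1 + 1)).
have eps0 : 0 < eps by rewrite lt_min invr_gt0 ltr0n/= !divr_gt0.
have eps2 : eps <= 2^-1 by rewrite ge_min lexx.
have H5 : (3 * Lam + 3 * C1 + 1) * eps <= `|D0| / 2.
  by rewrite mulrC -ler_pdivlMr// ge_min lexx orbT.
exists (Num.min (Num.min 1 rho1) (eps * rho1 / (B + 1))).
  by rewrite !lt_min ltr01 r10 divr_gt0 ?mulr_gt0//; lra.
move=> rho rho0; rewrite !le_min => /andP[/andP[rho_le1 rho_rho1] rho_eps].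
have H1 : rho / rho1 * B <= eps.
  rewrite mulrAC ler_pdivrMr//; apply: small => //; first exact: ltW.
  exact: mulr_gt0.
pose Hs := \sum_j `|h 0 j|.
have Hs0 : 0 <= Hs by exact: sumr_ge0.
pose k4 := 1 + R0 * (2 * rho^-1).
pose C2 := det_const (m + 1) (B + 2 + k4 * G).
have rV : 0 <= rho^-1 by rewrite invr_ge0 ltW.
have R00 : 0 <= R0 by lra.
have k40 : 0 <= k4 by rewrite /k4 addr_ge0// !mulr_ge0.
have C20 : 0 <= C2 by apply: det_const_ge0; rewrite !addr_ge0// mulr_ge0.
pose X1 := (4 / rho + R0 * (4 / rho ^+ 2)) * (1 + G).
pose X3 := 2^-1 * (Hs * (R0 * (4 / rho) + 1)) * (1 + G).
pose X4 := C2 * k4 * (1 + G).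
have G1 : 0 <= 1 + G by lra.
have X10 : 0 <= X1.
  rewrite /X1; apply: mulr_ge0 => //; apply: addr_ge0; first exact: mulr_ge0.
  by apply: mulr_ge0 => //; apply: divr_ge0 => //; apply: exprn_ge0; exact: ltW.
have X30 : 0 <= X3.
  rewrite mulr_ge0// mulr_ge0 ?invr_ge0// mulr_ge0// addr_ge0// mulr_ge0// divr_ge0// ltW//.
have X40 : 0 <= X4 by rewrite mulr_ge0// mulr_ge0.
exists (Num.min (Num.min rho (eps / (X1 + 1))) (Num.min (eps / (X3 + 1)) (eps / (X4 + 1)))).
  by rewrite !lt_min rho0 !divr_gt0//; lra.
move=> tau tau0; rewrite !le_min => /andP[/andP[tau_rho t1] /andP[t3 t4]].
have tau_ge0 := ltW tau0.
have H2 : (4 * (tau / rho) + R0 * (4 * (tau / rho ^+ 2))) * (1 + G) <= eps.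
  have -> : (4 * (tau / rho) + R0 * (4 * (tau / rho ^+ 2))) * (1 + G) = tau * X1.
    by rewrite /X1; ring.
  exact: small.
have H3 : 2^-1 * (Hs * (R0 * (4 * (tau / rho)) + tau)) * (1 + G) <= eps.
  have -> : 2^-1 * (Hs * (R0 * (4 * (tau / rho)) + tau)) * (1 + G) = tau * X3.
    by rewrite /X3; ring.
  exact: small.
have H4 : tau * (C2 * k4) * (1 + G) <= eps.
  by rewrite -mulrA -/X4; exact: small.
split=> // g g' del.
exact: (Phi_contraction rho0 tau0 tau_rho rho_rho1 rho_le1 eps0 eps2 H1 H2 H3 H4 H5).
Qed.

End Estimates.

(** ** Solving the formal problem *)

Section FormalSolution.
Variables (R : realType) (m : nat) (q h : 'rV[R]_(m + 1)) (v : fps R (m + 1)).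
Local Notation xx := (lshift 1).
Local Notation tt := (rshift m (ord0 : 'I_1)).
Local Notation fpsn := (fps R (m + 1)).
Hypothesis q_t : q 0 tt = 0.
Hypothesis v_t : forall a, tdeg a != 0%N -> v a = 0.
Variables (D0 F0 : R).
Hypothesis D0E : D0 = (\det (mx_x q v 0)) 0.
Hypothesis D0_neq0 : D0 != 0.
Variable (rho1 : R).
Hypothesis rho1_gt0 : 0 < rho1.
Hypothesis mx_bound : forall i j, exists B, norm_le (mpow rho1) (mx_x q v 0 i j) B.
Hypothesis exponent_bound : exists B, norm_le (mpow rho1) (soliton_exponent h q v) B.

Lemma uniform_contraction (G : R) : 0 <= G -> exists2 r0 : R, 0 < r0 &
  forall rho, 0 < rho -> rho <= r0 -> exists2 t0 : R, 0 < t0 &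
  forall tau, 0 < tau -> tau <= t0 -> tau <= rho /\
    forall g g' del, norm_le (wt rho tau 0) g G -> norm_le (wt rho tau 0) g' G ->
    norm_le (wt rho tau 0) (g - g') del ->
    norm_le (wt rho tau 0) (Phi q h v D0 F0 g - Phi q h v D0 F0 g') (del / 2).
Proof.
move=> G0; have [BL hBL] := exponent_bound.
pose Bm i j := projT1 (cid (mx_bound i j)).
have hBm i j : norm_le (mpow rho1) (mx_x q v 0 i j) (Bm i j) by rewrite /Bm; case: cid.
have Bm0 i j : 0 <= Bm i j := norm_le_ge0 (hBm i j).
have BL0 := norm_le_ge0 hBL.
pose B := BL + \sum_i \sum_j Bm i j.
have S0 : 0 <= \sum_i \sum_j Bm i j by apply: sumr_ge0 => i _; apply: sumr_ge0.
apply: (@Phi_contraction_small R m q h v q_t v_t D0 F0 D0E D0_neq0 rho1 B rho1_gt0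
   _ _ _ G (\sum_j `|q 0 j| + 1)) => //.
- move=> i j; apply: norm_leW (hBm i j).
  rewrite /B (bigD1 i)//= (bigD1 j)//= addrA [BL + _]addrC -!addrA lerDl !addr_ge0//.
    by apply: sumr_ge0.
  by apply: sumr_ge0 => k _; apply: sumr_ge0.
- by apply: norm_leW hBL; rewrite lerDl.
- exact: addr_ge0.
- by rewrite lerDr; exact: sumr_ge0.
by move=> j; rewrite lerD2r (bigD1 j)//= lerDl; exact: sumr_ge0.
Qed.

(** [Phi 0] is the constant [F0 / D0], whence the choice of [G]; the weights dominate
    a geometric sequence, which gives a radius of convergence. *)
Lemma formal_solution : exists g, Phi q h v D0 F0 g = g /\
  exists2 s : R, 0 < s & exists M, norm_le (mpow s) g M.
Proof.
pose G := 2 * `|F0 / D0|.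
have G0 : 0 <= G by exact: mulr_ge0.
have [r0 r00 hr] := uniform_contraction G0.
have [t0 t00 ht] := hr r0 r00 (lexx _).
have [tr hc] := ht t0 t00 (lexx _).
have wp := wt_gt0 (m := m) r00 t00 0.
have [|g gG gfix] := contraction_fixpoint wp hc.
  have -> : G / 2 = `|F0 / D0| by rewrite /G mulrC mulKf.
  rewrite Phi0E//; apply: norm_le_const.
  by rewrite wt_zero ler01 lexx.
exists g; split=> //; exists (t0 / 4); first by rewrite divr_gt0.
exists G; apply: wt_ge_mpow gG => //; rewrite ?divfK//; lra.
Qed.

(** When the radii shrink, the norm of a convergent series tends to its constant
    term, so that both solutions end up in a ball on which [Phi] contracts. *)
Lemma formal_unique g g' (s : R) M M' : 0 < s ->
  norm_le (mpow s) g M -> norm_le (mpow s) g' M' ->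
  Phi q h v D0 F0 g = g -> Phi q h v D0 F0 g' = g' -> g = g'.
Proof.
move=> s0 hg hg' fg fg'.
have M0 := norm_le_ge0 hg; have M0' := norm_le_ge0 hg'.
pose G := `|g 0| + `|g' 0| + 1.
have n1 := normr_ge0 (g 0); have n2 := normr_ge0 (g' 0).
have G0 : 0 <= G by rewrite /G; lra.
have [r0 r00 hr] := uniform_contraction G0.
pose rho := Num.min r0 (Num.min s (s / (M + M' + 1))).
have MM : 0 < M + M' + 1 by lra.
have rho0 : 0 < rho by rewrite !lt_min r00 s0 divr_gt0.
have rr : rho <= r0 by rewrite ge_min lexx.
have rs : rho <= s by rewrite !ge_min lexx !orbT.
have rM : rho * (M + M' + 1) <= s by rewrite -ler_pdivlMr// !ge_min lexx !orbT.
have [t0 t00 ht] := hr rho rho0 rr.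
have [tr hc] := ht t0 t00 (lexx _).
have inG c N : 0 <= N -> N <= M + M' -> `|c 0| <= `|g 0| + `|g' 0| ->
    norm_le (mpow s) c N -> norm_le (@wt R m rho t0 0) c G.
  move=> N0 NM c0 hN; have := wt_sub_const rho0 t00 tr rs hN.
  have hk : norm_le (@wt R m rho t0 0) (fps_const (c 0)) `|c 0|.
    by apply: norm_le_const; rewrite wt_zero ler01 lexx.
  move=> hd; have := norm_leD hd hk; rewrite subrK; apply: norm_leW.
  have : rho / s * N <= 1.
    rewrite mulrAC ler_pdivrMr// mul1r; apply: le_trans rM.
    by rewrite ler_wpM2l ?ltW//; lra.
  rewrite /G; lra.
apply: (contraction_unique (wt_gt0 (m := m) rho0 t00 0) hc) => //.
  by apply: (inG _ M) => //; lra.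
by apply: (inG _ M') => //; lra.
Qed.

End FormalSolution.

(** * From functions to formal series and back *)

Section Lines.
Variables (R : realType) (n : nat).
Implicit Types (p q v x : 'rV[R]_n) (f : 'rV[R]_n -> R).

Lemma is_derive_line f x v s df : is_derive (s *: v + x) v f df ->
  is_derive s (1 : R) (fun t => f (t *: v + x)) df.
Proof.
move=> [hd hv]; have E : (fun h : R => h^-1 *: (((fun t => f (t *: v + x)) \o shift s) (h *: (1 : R)) -
    f (s *: v + x))) = (fun h : R => h^-1 *: ((f \o shift (s *: v + x)) (h *: v) - f (s *: v + x))).
  apply/funext => h; congr (_ *: (f _ - _)) => /=.
  by rewrite -[h *: 1]/(h * 1) mulr1 scalerDl addrA.
by apply: DeriveDef; rewrite ?/derivable ?/derive E.
Qed.

Lemma line_is_derive f x v df :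
  is_derive (0 : R) (1 : R) (fun t => f (t *: v + x)) df -> is_derive x v f df.
Proof.
move=> [hd hv]; have E : (fun h : R => h^-1 *: (((fun t => f (t *: v + x)) \o shift 0) (h *: (1 : R)) -
    f (0 *: v + x))) = (fun h : R => h^-1 *: ((f \o shift x) (h *: v) - f x)).
  apply/funext => h; rewrite scale0r add0r; congr (_ *: (f _ - _)) => /=.
  by rewrite -[h *: 1]/(h * 1) mulr1 addr0.
by apply: DeriveDef; rewrite ?/derivable ?/derive -E.
Qed.

Lemma sub_ball p x y r s : 0 < r -> (forall i, `|x 0 i - p 0 i| + s <= r) ->
  ball x s y -> ball p r y.
Proof.
move=> r0 sR /ball_rV_norm xy; apply/ball_rVP => // i.
have := rV_coord_le (y - x) i; rewrite !mxE => h1; have := sR i.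
have := ler_normD (p 0 i - x 0 i) (x 0 i - y 0 i); rewrite addrA subrK.
by rewrite [ `|p 0 i - x 0 i|]distrC [ `|x 0 i - y 0 i|]distrC; lra.
Qed.

Lemma is_derive_exp_comp (F : R -> R) (s a : R) : is_derive s (1 : R) F a ->
  is_derive s (1 : R) (fun t => expR (F t)) (expR (F s) * a).
Proof. by move=> hF; exact: (is_derive1_comp (f := expR) (is_derive_expR (F s)) hF). Qed.

Lemma expands_continuous p r c f x : ball p r x -> expands p r c f ->
  f y @[y --> x] --> f x.
Proof.
move=> px hf; have [s /andP[s0 sr] sR] := ball_room px.
have [d [hd _]] := expands_recenter (introT andP (conj s0 sr)) sR hf.
have s2 : 0 <= s / 2 < s by apply/andP; split; lra.
have [M hM] := expands_bounded s2 hd.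
have M0 := norm_le_ge0 hM.
set t := s / 2 in s2 hM; have t0 : 0 < t by rewrite divr_gt0.
apply/(@cvgrPdist_le _ _ _ _ (nbhs_filter (x : 'rV[R]_n))) => e e0.
have M1 : 0 < M + 1 by lra.
apply/nbhs_ballP; exists (Num.min t (e * t / (M + 1))).
  by rewrite /= lt_min t0 !(divr_gt0, mulr_gt0).
move=> y /ball_rV_norm; rewrite lt_min => /andP[yt /ltW ye].
have xy : ball x s y by apply/ball_rV_norm; apply: lt_trans yt _; case/andP: s2.
have hc := hd _ xy.
have h0 := has_sum_delta (0 : mindex n) (d 0).
have := has_sumD hc (has_sumZ (- 1) h0); rewrite mulN1r.
have -> : d 0 = f x by rewrite (expands_center s0 hd).
move=> hs; rewrite distrC.
apply: le_trans (_ : `|y - x| / t * M <= e); last first.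
  rewrite mulrAC ler_pdivrMr//; move: ye; rewrite ler_pdivlMr; last by lra.
  apply: le_trans; rewrite ler_wpM2l//; lra.
apply: has_sum_norm_le hs.
apply: (le_abs_bounded (g := fun a => `|y - x| / t * (d a * mpow t a))); last first.
  have K0 : 0 <= `|y - x| / t by rewrite divr_ge0 ?(ltW t0).
  move=> A; under eq_bigr do rewrite normrM [X in X * _](ger0_norm K0).
  by rewrite -mulr_sumr ler_wpM2l//; exact: hM.
move=> a; have [->|a0] := eqVneq a 0.
  by rewrite monomial0 mulr1 mulN1r -(expands_center s0 hd) subrr normr0.
rewrite mulr0 addr0 !normrM mulrCA ler_wpM2l//.
have [k ak] : exists k, mdeg a = k.+1.
  by move: a0; rewrite -mdeg_eq0; case: (mdeg a) => // k _; exists k.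
apply: le_trans (norm_monomial_le (s := `|y - x|) _ _) _; first exact: rV_coord_le.
rewrite /mpow ak !exprS normrM normfV normr_id normrX !(gtr0_norm t0) -mulrA.
rewrite mulKf ?gt_eqF//; apply: ler_wpM2l => //.
by rewrite lerXn2r ?nnegrE// ltW.
Qed.

Lemma derive_ball_eq p r f g x v : ball p r x -> (forall y, ball p r y -> f y = g y) ->
  'D_v f x = 'D_v g x.
Proof.
move=> px fg; apply: near_eq_derive.
have [s /andP[s0 _] sR] := ball_room px.
apply/nbhs_ballP; exists s => // y xy; apply: fg.
exact: sub_ball (ball_radius_gt0 px) sR xy.
Qed.

End Lines.

Section Equation.
Variables (R : realType) (n : nat) (h : 'rV[R]_n).
Implicit Types (q x : 'rV[R]_n) (u : 'rV[R]_n -> R).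

(** The matrix of the equation without the factors [x 0 i] of its rows. *)
Definition reduced_mx u x : 'M[R]_n :=
  \matrix_(i, j) partial i (fun s => s 0 j * partial j u s) x.

Definition exponent u x : R := 2^-1 * \sum_j h 0 j * (x 0 j * partial j u x).

Definition reduced_equation u x : Prop :=
  \det (reduced_mx u x) * expR (exponent u x) = 1.

Lemma soliton_detE u x :
  \det (\matrix_(i < n, j < n) (x 0 i * partial i (fun s => s 0 j * partial j u s) x))
  = \prod_i x 0 i * \det (reduced_mx u x).
Proof.
have -> : \matrix_(i < n, j < n) (x 0 i * partial i (fun s => s 0 j * partial j u s) x)
   = diag_mx x *m reduced_mx u x.
  by apply/matrixP => i j; rewrite mul_diag_mx !mxE.
by rewrite det_mulmx det_diag.
Qed.

Lemma reduced_equation_soliton u x :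
  reduced_equation u x -> soliton_equation_at h u x.
Proof.
by rewrite /soliton_equation_at soliton_detE -mulrA => ->; rewrite mulr1.
Qed.

Lemma expands_det_mx q r c u : expands q r c u ->
  expands q r (\det (soliton_mx q c)) (fun x => \det (reduced_mx u x)).
Proof.
by move=> hu; apply: expands_det => i j; exact: expands_soliton_mx.
Qed.

Lemma expands_exponent q r c u : expands q r c u ->
  expands q r (soliton_exponent h q c) (exponent u).
Proof. exact: expands_soliton_exponent. Qed.

(** Division is harmless where no coordinate vanishes, and such points are
    dense. *)
Lemma soliton_reduced_equation q r c u : expands q r c u ->
  (forall x, ball q r x -> soliton_equation_at h u x) ->
  forall x, ball q r x -> reduced_equation u x.
Proof.
move=> hu sol x qx.
pose y (t : R) : 'rV[R]_n := t *: const_mx 1 + x.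
have ycvg : y t @[t --> 0^'] --> x.
  have : y t @[t --> (0 : R)] --> y 0.
    by apply: cvgD; [apply: cvgZl; exact: cvg_id | exact: cvg_cst].
  rewrite /y scale0r add0r => h1; apply: cvg_trans h1.
  by apply: cvg_app; exact: cvg_within.
have hd : \det (reduced_mx u (y t)) @[t --> 0^'] --> \det (reduced_mx u x).
  exact: cvg_comp ycvg (expands_continuous qx (expands_det_mx hu)).
have he : exponent u (y t) @[t --> 0^'] --> exponent u x.
  exact: cvg_comp ycvg (expands_continuous qx (expands_exponent hu)).
have hE : expR (exponent u (y t)) @[t --> 0^'] --> expR (exponent u x).
  exact: cvg_comp he (@continuous_expR R _).
have hm : \det (reduced_mx u (y t)) * expR (exponent u (y t)) @[t --> 0^'] -->
    \det (reduced_mx u x) * expR (exponent u x) by exact: cvgM.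
apply: (cvg_unique (@Rhausdorff R) hm).
have [s /andP[s0 _] sR] := ball_room qx.
apply: cvg_near_cst; near=> t.
have t0 : t != 0 by near: t; exact: nbhs_dnbhs_neq.
have qy : ball q r (y t).
  apply: (sub_ball (ball_radius_gt0 qx) sR); apply/ball_rV_norm.
  rewrite /y addrK normrZ.
  have c0 : 0 < `|const_mx 1 : 'rV[R]_n| + 1 by rewrite ltr_wpDl.
  have ts : `|t| < s / (`|const_mx 1 : 'rV[R]_n| + 1).
    by near: t; apply: dnbhs0_lt; exact: divr_gt0.
  apply: le_lt_trans (_ : `|t| * (`|const_mx 1 : 'rV[R]_n| + 1) < s).
    by rewrite ler_wpM2l// lerDl.
  by rewrite -ltr_pdivlMr.
have yn0 : \prod_i y t 0 i != 0.
  apply/prodf_neq0 => i _; rewrite !mxE mulr1.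
  move: i; near: t; apply: filter_forall => i.
  have [xi0|xi0] := eqVneq (x 0 i) 0.
    by near=> t; rewrite xi0 addr0; near: t; exact: nbhs_dnbhs_neq.
  near=> t; rewrite addr_eq0; apply/eqP => e.
  have : `|t| < `|x 0 i| by near: t; apply: dnbhs0_lt; rewrite normr_gt0.
  by rewrite e normrN ltxx.
have := sol _ qy; rewrite /soliton_equation_at soliton_detE -mulrA.
by move=> /(canRL (mulKf yn0)); rewrite mulVf.
Unshelve. all: by end_near.
Qed.

(** Differentiating [det = exp (- L)] turns the equation into a linear
    first-order system for the formal determinant. *)
Lemma reduced_equation_formal q r c u : 0 < r -> expands q r c u ->
  (forall x, ball q r x -> reduced_equation u x) ->
  (\det (soliton_mx q c)) 0 = expR (- (soliton_exponent h q c) 0) /\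
  fps_euler (\det (soliton_mx q c)) =
    - (\det (soliton_mx q c) * fps_euler (soliton_exponent h q c)).
Proof.
move=> r0 hu sol.
set P := \det _; set L := soliton_exponent h q c.
have hP : expands q r P (fun x => \det (reduced_mx u x)) := expands_det_mx hu.
have hL : expands q r L (exponent u) := expands_exponent hu.
have detE x : ball q r x -> \det (reduced_mx u x) = expR (- exponent u x).
  by move=> /sol e; rewrite expRN -[LHS](mulfK (lt0r_neq0 (expR_gt0 (exponent u x)))) e mul1r.
split.
  by rewrite -(expands_center r0 hP) detE ?(expands_center r0 hL)//; exact: ballxx.
have dP i : fps_deriv i P = - (P * fps_deriv i L).
  apply: (expands_inj r0 (expands_deriv (i := i) hP)).
  have := expandsN (expandsM hP (expands_deriv (i := i) hL)).
  apply: eq_expands => x qx.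
  have := expands_is_derive (delta_mx 0 i) qx hL.
  rewrite sum_delta_mx => dL; rewrite /partial.
  rewrite (derive_ball_eq _ qx detE) detE//.
  have dline : is_derive (0 : R) (1 : R) (fun t => exponent u (t *: delta_mx 0 i + x))
      (partial i (exponent u) x).
    by apply: is_derive_line; rewrite scale0r add0r.
  have : is_derive x (delta_mx 0 i) (fun x => expR (- exponent u x))
     (- (expR (- exponent u x) * partial i (exponent u) x)).
    apply: line_is_derive.
    have := is_derive_exp_comp (is_deriveN dline).
    by rewrite /= [X in expR X](_ : _ = - exponent u x) ?mulrN// -[LHS]/(- _) scale0r add0r.
  by move=> dd; rewrite (@derive_val _ _ _ _ _ _ _ dd).
rewrite !fps_euler_sum mulr_sumr -sumrN; apply: eq_bigr => i _.
by rewrite dP mulrN mulrCA.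
Qed.

(** Conversely the product of the determinant by [exp L] is constant along rays
    issued from the centre. *)
Lemma formal_reduced_equation q r c u : expands q r c u ->
  (\det (soliton_mx q c)) 0 = expR (- (soliton_exponent h q c) 0) ->
  fps_euler (\det (soliton_mx q c)) =
    - (\det (soliton_mx q c) * fps_euler (soliton_exponent h q c)) ->
  forall x, ball q r x -> reduced_equation u x.
Proof.
move=> hu.
set P := \det _; set L := soliton_exponent h q c => P0 PE x qx.
have r0 := ball_radius_gt0 qx.
have hP : expands q r P (fun x => \det (reduced_mx u x)) := expands_det_mx hu.
have hL : expands q r L (exponent u) := expands_exponent hu.
pose D x := \det (reduced_mx u x); pose v := x - q.
pose y (s : R) := s *: v + q.
have qy (s : R) : 0 <= s <= 1 -> ball q r (y s).
  move=> /andP[s0 s1]; apply/ball_rV_norm; rewrite /y addrK normrZ ger0_norm//.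
  by apply: le_lt_trans (ler_piMl _ _) _ => //; exact/ball_rV_norm.
pose dD s := \sum_i v 0 i * partial i D (y s).
pose dL s := \sum_i v 0 i * partial i (exponent u) (y s).
pose g s := D (y s) * expR (exponent u (y s)).
have dg (s : R) : 0 <= s <= 1 ->
    is_derive s (1 : R) g ((dD s + D (y s) * dL s) * expR (exponent u (y s))).
  move=> /qy qs.
  have h1 := is_derive_line (expands_is_derive v qs hP).
  have h2 := is_derive_line (expands_is_derive v qs hL).
  have h3 := is_deriveM h1 (is_derive_exp_comp h2).
  apply: (is_derive_eq h3); rewrite /= -/(y s) -/(dD s) -/(dL s) -/(D (y s)).
  by rewrite /GRing.scale /=; ring.
have eul c' f' : expands q r c' f' ->
    expands q r (fps_euler c') (fun x => \sum_i (x 0 i - q 0 i) * partial i f' x).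
  move=> hf; rewrite fps_euler_sum; apply: expands_sum => i.
  exact: expandsM (@expands_var R n q r i) (expands_deriv (i := i) hf).
have zero (s : R) : 0 < s -> s <= 1 -> dD s + D (y s) * dL s = 0.
  move=> s0 s1; have qs : ball q r (y s) by apply: qy; rewrite ltW.
  have e1 := eul _ _ hP _ qs; have e2 := expandsN (expandsM hP (eul _ _ hL)) qs.
  have scl f' : \sum_i (y s 0 i - q 0 i) * partial i f' (y s) =
      s * \sum_i v 0 i * partial i f' (y s).
    by rewrite mulr_sumr; apply: eq_bigr => i _; rewrite !mxE addrK mulrA.
  move: e1 e2; rewrite -/P -/L -PE !scl -/(dL s) -/(dD s) => e1 e2.
  have := has_sum_unique e1 e2; rewrite -/(D (y s)) => e3.
  apply: (mulfI (lt0r_neq0 s0)); rewrite mulr0 mulrDr e3; ring.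
have gc : {within `[0, 1], continuous g}.
  apply: derivable_within_continuous => s; rewrite in_itv /= => hs.
  exact: (@ex_derive _ _ _ _ _ _ _ (dg s hs)).
have [|s] := @MVT R g (fun s => (dD s + D (y s) * dL s) * expR (exponent u (y s))) 0 1 ltr01 _ gc.
  by move=> s; rewrite in_itv /= => /andP[s0 s1]; apply: dg; rewrite !ltW.
rewrite in_itv /= => /andP[s0 s1]; rewrite zero ?ltW// !mul0r => /eqP.
rewrite subr_eq0 => /eqP; rewrite /g /y scale1r subrK scale0r add0r /reduced_equation => ->.
by rewrite /D (expands_center r0 hP) P0 (expands_center r0 hL) -expRD addNr expR0.
Qed.

End Equation.

(** * The initial hyperplane *)

Section InitialHyperplane.
Variables (R : realType) (m : nat).
Local Notation xx := (lshift 1).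
Local Notation tt := (rshift m (ord0 : 'I_1)).
Implicit Types (a : mindex (m + 1)) (b : mindex m) (p r : 'rV[R]_m)
  (x : 'rV[R]_(m + 1)).

Definition memb b : mindex (m + 1) :=
  [ffun k : 'I_(m + 1) => if fintype.split k is inl i then b i else 0%N].
Definition xpart a : mindex m := [ffun i => a (xx i)].
Definition tpow k : mindex (m + 1) := [ffun j => (j == tt : nat) * k]%N.
(** The series of a function that does not depend on t. *)
Definition fps_lift (c : fps R m) : fps R (m + 1) :=
  fun a => if tdeg a == 0%N then c (xpart a) else 0.
Definition base p : 'rV[R]_(m + 1) := row_mx p 0.

Lemma memb_x b i : memb b (xx i) = b i.
Proof. rewrite ffunE; case: split_ordP => [j /lshift_inj -> //|j /eqP].
by rewrite eq_lrshift. Qed.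

Lemma memb_t b : memb b tt = 0%N.
Proof. by rewrite ffunE; case: split_ordP => // j /eqP; rewrite eq_rlshift. Qed.

Lemma xpart_memb b : xpart (memb b) = b.
Proof. by apply/ffunP => i; rewrite ffunE memb_x. Qed.

Lemma memb_inj : injective memb.
Proof. by move=> b b' e; rewrite -[b]xpart_memb e xpart_memb. Qed.

Lemma memb_xpart a : tdeg a = 0%N -> memb (xpart a) = a.
Proof.
move=> ta; apply/ffunP => k; case: (split_ordP k) => j ->.
  by rewrite memb_x ffunE.
by rewrite (ord1 j) memb_t; exact: esym ta.
Qed.

Lemma memb0 : memb 0 = 0.
Proof.
apply/ffunP => k; case: (split_ordP k) => j ->; first by rewrite memb_x !mzeroE.
by rewrite (ord1 j) memb_t mzeroE.
Qed.

Lemma memb_munit i : memb (munit i) = munit (xx i).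
Proof.
apply/ffunP => k; case: (split_ordP k) => j ->.
  by rewrite memb_x !munitE (inj_eq (@lshift_inj _ _)).
by rewrite (ord1 j) memb_t munitE eq_rlshift.
Qed.

Lemma membD b b' : memb (b + b') = memb b + memb b'.
Proof.
apply/ffunP => k; rewrite maddE; case: (split_ordP k) => j ->.
  by rewrite !memb_x maddE.
by rewrite (ord1 j) !memb_t.
Qed.

Lemma tdeg_memb b : tdeg (memb b) = 0%N. Proof. exact: memb_t. Qed.

Lemma monomial_memb b x : monomial (memb b) x = monomial b (lsubmx x).
Proof.
rewrite /monomial big_split_ord big_ord1 memb_t expr0 [LHS]mulr1.
by apply: eq_bigr => i _; rewrite memb_x mxE.
Qed.

Lemma base_x p i : base p 0 (xx i) = p 0 i. Proof. by rewrite row_mxEl. Qed.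
Lemma base_t p : base p 0 tt = 0. Proof. by rewrite row_mxEr mxE. Qed.

Lemma lsub_base p : lsubmx (base p) = p. Proof. exact: row_mxKl. Qed.

Lemma ball_lsub p s x : ball (base p) s x -> ball p s (lsubmx x).
Proof.
move=> h; have s0 := ball_radius_gt0 h; apply/ball_rVP => // i.
by have /ball_rVP-/(_ s0 (xx i)) := h; rewrite base_x mxE.
Qed.

Lemma ball_base p r s : ball p s r -> ball (base p) s (base r).
Proof.
move=> h; have s0 := ball_radius_gt0 h; apply/ball_rVP => // i.
case: (split_ordP i) => j ->; rewrite ?base_x; first by move/ball_rVP: h; exact.
by rewrite (ord1 j) !base_t subrr normr0.
Qed.

Lemma fps_lift_t c a : tdeg a != 0%N -> fps_lift c a = 0.
Proof. by rewrite /fps_lift => /negPf ->. Qed.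

Lemma fps_lift_memb c b : fps_lift c (memb b) = c b.
Proof. by rewrite /fps_lift tdeg_memb eqxx xpart_memb. Qed.

Lemma fps_deriv_lift c i : fps_deriv (xx i) (fps_lift c) = fps_lift (fps_deriv i c).
Proof.
apply/funext => a; have [ta|ta] := eqVneq (tdeg a) 0%N; last first.
  by rewrite fps_lift_t// /fps_deriv fps_lift_t ?mulr0// tdegD tdeg_x addn0.
rewrite -(memb_xpart ta); move: (xpart a) => b.
by rewrite fps_lift_memb /fps_deriv memb_x -memb_munit -membD fps_lift_memb.
Qed.

Lemma expands_lift p s c (f : 'rV[R]_m -> R) : expands p s c f ->
  expands (base p) s (fps_lift c) (fun x => f (lsubmx x)).
Proof.
move=> hf x qx; have hs := hf _ (ball_lsub qx).
apply: (proj2 (has_sum_inj _ memb_inj _)).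
  move=> a na; rewrite fps_lift_t ?mul0r//; apply/negP => /eqP ta.
  by have := na (xpart a); rewrite memb_xpart// eqxx.
apply: eq_has_sum hs => b /=; rewrite fps_lift_memb monomial_memb.
by congr (_ * monomial _ _); rewrite raddfB /= lsub_base.
Qed.

Lemma expands_restrict p s c (f : 'rV[R]_(m + 1) -> R) : expands (base p) s c f ->
  expands p s (c \o memb) (fun r => f (base r)).
Proof.
move=> hf r pr; have hs := hf _ (ball_base pr).
have := proj1 (has_sum_inj _ memb_inj _) hs; move=> h1.
have : has_sum (fun b => c (memb b) * monomial (memb b) (base r - base p)) (f (base r)).
  apply: h1 => a na; have ta : tdeg a != 0%N.
    by apply/negP => /eqP ta; have := na (xpart a); rewrite memb_xpart// eqxx.
  rewrite /monomial (bigD1 tt)//=.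
  have -> : (base r - base p) 0 tt = 0.
    by rewrite [LHS]mxE [(- base p) _ _]mxE !base_t subrr.
  by rewrite expr0n (negPf ta) !(mul0r, mulr0).
apply: eq_has_sum => b /=; rewrite monomial_memb.
by congr (_ * monomial _ _); rewrite raddfB /= !lsub_base.
Qed.

Lemma monomial_tpow k x : monomial (tpow k) x = x 0 tt ^+ k.
Proof.
rewrite /monomial (bigD1 tt)//= ffunE eqxx mul1n big1 ?mulr1// => j /negPf ji.
by rewrite ffunE ji mul0n expr0.
Qed.

Lemma tpow_inj : injective tpow.
Proof. by move=> k l /ffunP/(_ tt); rewrite !ffunE eqxx !mul1n. Qed.

(** On the vertical line through the centre only the pure powers of t
    contribute, so that the values there depend on few coefficients. *)
Lemma expands_vertical p s c (f : 'rV[R]_(m + 1) -> R) x : expands (base p) s c f ->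
  ball (base p) s x -> lsubmx x = p ->
  has_sum (fun k => c (tpow k) * x 0 tt ^+ k) (f x).
Proof.
move=> hf px xp; have hs := hf _ px.
have xb i : (x - base p) 0 (xx i) = 0.
  by rewrite [LHS]mxE [(- base p) _ _]mxE base_x -xp mxE subrr.
have xt : (x - base p) 0 tt = x 0 tt.
  by rewrite [LHS]mxE [(- base p) _ _]mxE base_t subr0.
have := proj1 (has_sum_inj _ tpow_inj _) hs; move=> h1.
have : has_sum (fun k => c (tpow k) * monomial (tpow k) (x - base p)) (f x).
  apply: h1 => a na.
  have [i ai] : exists i, a (xx i) != 0%N.
    apply/existsP; rewrite -negb_forall; apply/negP => /forallP h.
    have /eqP[] := na (tdeg a); apply/ffunP => k; rewrite ffunE.
    case: (split_ordP k) => j ->; last by rewrite (ord1 j) eqxx mul1n.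
    by rewrite eq_lrshift mul0n; exact/eqP.
  by rewrite /monomial (bigD1 (xx i))//= xb expr0n (negPf ai) !(mul0r, mulr0).
by apply: eq_has_sum => k; rewrite monomial_tpow xt.
Qed.

(** Every series is its restriction to t = 0 completed by the integral of its
    second order part. *)
Lemma fps_split c : c = ser (fps_lift (c \o memb))
   (fps_deriv tt (fps_var R tt * fps_deriv tt c)).
Proof.
apply/funext => a; rewrite /ser coefD /fps_J.
have [ta|ta] := eqVneq (tdeg a) 0%N.
  by rewrite addr0 -[in RHS](memb_xpart ta) fps_lift_memb /= memb_xpart.
rewrite fps_lift_t// add0r; set a' := msub a (munit tt).
have aE : a' + munit tt = a by rewrite addrC msubK//; exact: tle_munit.
rewrite {1}/fps_deriv coefX_deriv aE.
have -> : (a' tt).+1 = tdeg a by rewrite -[X in tdeg X]aE tdegD tdeg_t [RHS]addn1.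
rewrite -/(tdeg a); field.
by rewrite pnatr_eq0.
Qed.

Variable (h : 'rV[R]_(m + 1)).

Lemma soliton_exponent_coef0 p (v : fps R (m + 1)) g :
  soliton_exponent h (base p) (ser v g) 0 = soliton_exponent h (base p) v 0.
Proof.
rewrite /soliton_exponent !coef0M !coef_sum; congr (_ * _); apply: eq_bigr => j _.
rewrite !coef0M; congr (_ * _).
have -> : fps_coord (base p) j 0 = base p 0 j.
  by rewrite /fps_coord coefD /fps_const eqxx /fps_var /fps_delta eq_sym -mdeg_eq0 mdeg_unit addr0.
case: (split_ordP j) => i ->; last by rewrite (ord1 i) base_t !mul0r.
congr (_ * _); rewrite /ser fps_derivD coefD; set X := (X in _ + X).
suff -> : X = 0 by rewrite addr0.
by rewrite /X /fps_deriv /fps_J tdegD tdeg_x /tdeg !mzeroE /= mulr0.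
Qed.

Lemma mx_x_coef0 p (c : fps R m) i j :
  mx_x (base p) (fps_lift c) 0 i j 0 = soliton_mx p c i j 0.
Proof.
rewrite mx_xE /ser fps_J0 addr0 !soliton_mxE (inj_eq (@lshift_inj _ _)) !coefD !coef0M.
rewrite !fps_deriv_lift -memb0 !fps_lift_memb memb0.
have c0 n' (q : 'rV[R]_n') k : fps_coord q k 0 = q 0 k.
  by rewrite /fps_coord coefD /fps_const eqxx /fps_var /fps_delta eq_sym -mdeg_eq0 mdeg_unit addr0.
rewrite !c0 base_x; congr (_ * _ + _).
by rewrite -[LHS]/(fps_coef0 _) -[RHS]/(fps_coef0 _) !rmorph_nat.
Qed.

Variables (V : set 'rV[R]_m) (v : 'rV[R]_m -> R).
Hypothesis V_open : open V.
Hypothesis v_analytic : real_analytic_on V v.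
Hypothesis v_nondeg : forall p, V p -> \det (reduced_mx v p) != 0.

(** All that uniqueness of [c] relies on, so that the constructed solution and any
    other extension are compared on the same footing. *)
Definition solves_at p (c : fps R (m + 1)) (s : R) (f : 'rV[R]_(m + 1) -> R) : Prop :=
  [/\ 0 < s, ball p s `<=` V, expands (base p) s c f,
      forall x, ball (base p) s x -> reduced_equation h f x &
      forall r, ball p s r -> f (base r) = v r].

Lemma v_expands p : V p -> exists c s, [/\ 0 < s, ball p s `<=` V & expands p s c v].
Proof.
move=> Vp; have [c [s [s0 hs]]] := v_analytic Vp.
have /nbhs_ballP[e /= e0 eV] : nbhs p V by exact: open_nbhs_nbhs.
exists c, (Num.min s e); split; first by rewrite lt_min s0.
  by apply: subset_trans eV; apply: le_ball; rewrite ge_min lexx orbT.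
apply: (sub_expands (r := s)) => //; by rewrite ge_min lexx.
Qed.

(** The hypotheses under which the formal problem with initial value [v] is
    solved. The constant term of the determinant is that of the reduced matrix of
    [v], nonzero by assumption. *)
Lemma Phi_data p c s : 0 < s -> expands p s c v -> V p ->
  [/\ base p 0 tt = 0, forall a, tdeg a != 0%N -> fps_lift c a = 0,
    (\det (mx_x (base p) (fps_lift c) 0)) 0 != 0,
    forall i j, exists B, norm_le (mpow (s / 2)) (mx_x (base p) (fps_lift c) 0 i j) B &
    exists B, norm_le (mpow (s / 2)) (soliton_exponent h (base p) (fps_lift c)) B].
Proof.
move=> s0 hc Vp; have hl := expands_lift hc.
have s2 : 0 <= s / 2 < s by apply/andP; split; lra.
split; [exact: base_t | exact: fps_lift_t | | |].
- rewrite -[X in X != 0]/(fps_coef0 _) -det_map_mx.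
  suff -> : map_mx (@fps_coef0 R (m + 1)) (mx_x (base p) (fps_lift c) 0) = reduced_mx v p.
    exact: v_nondeg.
  apply/matrixP => i j; rewrite mxE [RHS]mxE.
  rewrite /fps_coef0 mx_x_coef0.
  by rewrite -(expands_center s0 (expands_soliton_mx (i:=i) (j:=j) hc)).
- move=> i j; rewrite mx_xE /ser fps_J0 addr0.
  exact: expands_bounded s2 (expands_soliton_mx (i := xx i) (j := xx j) hl).
exact: expands_bounded s2 (expands_soliton_exponent (h := h) hl).
Qed.

(** The formal solution converges near the centre, and the equation follows along
    rays. *)
Lemma solution_exists p : V p -> exists c s f, solves_at p c s f.
Proof.
move=> Vp; have [c [s [s0 sV hc]]] := v_expands Vp.
have [q_t l_t D0 mB eB] := Phi_data s0 hc Vp.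
have s20 : 0 < s / 2 by lra.
pose F0 := expR (- (soliton_exponent h (base p) (fps_lift c)) 0).
have [g [gfix [t t0 [M hM]]]] := formal_solution q_t l_t F0 erefl D0 s20 mB eB.
have [e1 e2] := (fps_eulerI_eq _ _ _).1 ((Phi_fix h q_t l_t F0 D0 g).1 gfix).
pose t' := Num.min t (s / 2).
have t'0 : 0 < t' by rewrite lt_min t0.
have t't : t' <= t by rewrite ge_min lexx.
have t's : t' <= s / 2 by rewrite ge_min lexx orbT.
have s2 : 0 <= s / 2 < s by apply/andP; split; lra.
have [N hN] := expands_bounded s2 (expands_lift hc).
have hser : norm_le (mpow t') (ser (fps_lift c) g) (N + t' * M).
  apply: norm_leD; first exact: norm_le_mpow (ltW t'0) t's hN.
  by apply: mpow_J (ltW t'0) _; exact: norm_le_mpow (ltW t'0) t't hM.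
have [f hf] := bounded_expands (base p) hser.
exists (ser (fps_lift c) g), t', f; split=> //.
- by apply: subset_trans sV; apply: le_ball; lra.
- apply: (formal_reduced_equation (h := h) hf) => //.
  by rewrite e1 /F0 soliton_exponent_coef0.
move=> r pr; have h1 := expands_restrict hf pr.
have h2 : has_sum (fun b => c b * monomial b (r - p)) (v r).
  by apply: hc; apply: le_ball pr; lra.
apply: has_sum_unique h1 _; apply: eq_has_sum h2 => b; congr (_ * _).
by rewrite /= /ser coefD fps_lift_memb /fps_J tdeg_memb eqxx addr0.
Qed.

(** The expansion of any solution gives a fixed point of [Phi], whose restriction to
    t = 0 is the expansion of [v]. *)
Lemma solution_unique p c s f c' s' f' : V p ->
  solves_at p c s f -> solves_at p c' s' f' -> c = c'.
Proof.
move=> Vp; have [c0 [s0 [s00 s0V hc0]]] := v_expands Vp.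
have [q_t l_t D0 mB eB] := Phi_data s00 hc0 Vp.
have s20 : 0 < s0 / 2 by lra.
pose F0 := expR (- (soliton_exponent h (base p) (fps_lift c0)) 0).
have key d t k : solves_at p d t k -> exists g, [/\ d = ser (fps_lift c0) g,
    Phi (base p) h (fps_lift c0) ((\det (mx_x (base p) (fps_lift c0) 0)) 0) F0 g = g &
    exists2 e, 0 < e & exists M, norm_le (mpow e) g M].
  move=> [t0 tV hk eqk kv].
  have dE : d \o memb = c0.
    pose t' := Num.min t s0.
    have t'0 : 0 < t' by rewrite lt_min t0.
    have h1 := expands_restrict hk.
    apply: (expands_inj (p := p) (f := v) t'0); last first.
      by apply: sub_expands hc0; rewrite ge_min lexx orbT.
    apply: (eq_expands (f := fun r => k (base r))).
      by move=> r pr; apply: kv; apply: le_ball pr; rewrite ge_min lexx.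
    by apply: sub_expands h1; rewrite ge_min lexx.
  set g := fps_deriv tt (fps_var R tt * fps_deriv tt d).
  have dser : d = ser (fps_lift c0) g by rewrite -dE; exact: fps_split.
  exists g; split=> //.
    apply/(Phi_fix h q_t l_t F0 D0 g)/fps_eulerI_eq.
    have [e1 e2] := reduced_equation_formal t0 hk eqk.
    rewrite -dser; split=> //; rewrite e1 /F0; congr (expR (- _)).
    by rewrite dser soliton_exponent_coef0.
  have hg : expands (base p) t g
     (partial tt (fun x => (x 0 tt - base p 0 tt) * partial tt k x)).
    by apply: expands_deriv; apply: expandsM; [exact: expands_var | exact: expands_deriv].
  exists (t / 2); first by lra.
  by apply: expands_bounded hg; apply/andP; split; lra.
move=> /key[g [-> fg [e e0 [M hM]]]] /key[g' [-> fg' [e' e'0 [M' hM']]]].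
congr ser; pose w := Num.min e e'.
have w0 : 0 < w by rewrite lt_min e0.
apply: (formal_unique q_t l_t erefl D0 s20 mB eB w0 (M := M) (M' := M') _ _ fg fg').
  by apply: (norm_le_mpow (ltW w0) _ hM); rewrite ge_min lexx.
by apply: (norm_le_mpow (ltW w0) _ hM'); rewrite ge_min lexx orbT.
Qed.

End InitialHyperplane.

(** ** Gluing the local solutions *)

Section Gluing.
Variables (R : realType) (m : nat) (h : 'rV[R]_(m + 1)).
Variables (V : set 'rV[R]_m) (v : 'rV[R]_m -> R).
Hypothesis V_open : open V.
Hypothesis v_analytic : real_analytic_on V v.
Hypothesis v_nondeg : forall p, V p -> \det (reduced_mx v p) != 0.
Local Notation tt := (rshift m (ord0 : 'I_1)).
Local Notation solves_at := (solves_at h V v).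
Implicit Types (p r : 'rV[R]_m) (x : 'rV[R]_(m + 1)) (f g : 'rV[R]_(m + 1) -> R)
  (c : fps R (m + 1)).

Lemma solves_at_sub p c s s' f : 0 < s' <= s -> solves_at p c s f -> solves_at p c s' f.
Proof.
move=> /andP[s'0 ss] [s0 sV hf ef vf].
split=> //.
- by apply: subset_trans sV; exact: le_ball.
- exact: sub_expands hf.
- by move=> x px; apply: ef; exact: le_ball px.
- by move=> r pr; apply: vf; exact: le_ball pr.
Qed.

Lemma eq_solves_at p c s f g : (forall x, ball (base p) s x -> f x = g x) ->
  solves_at p c s f -> solves_at p c s g.
Proof.
move=> fg [s0 sV hf ef vf]; have hg := eq_expands fg hf.
split; [exact: s0 | exact: sV | exact: hg | |]; last first.
  by move=> r pr; rewrite -fg; [exact: vf | exact: ball_base].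
by have [e1 e2] := reduced_equation_formal s0 hf ef; exact: formal_reduced_equation hg e1 e2.
Qed.

Lemma solves_at_recenter p c s f r : solves_at p c s f -> ball p (s / 2) r ->
  exists d, solves_at r d (s / 2) f.
Proof.
move=> [s0 sV hf ef vf] pr; have s20 : 0 < s / 2 by lra.
have near_p i : `|base r 0 i - base p 0 i| + s / 2 <= s.
  have /ball_rVP-/(_ s20 i) := ball_base pr.
  by rewrite distrC; lra.
have sub x : ball (base r) (s / 2) x -> ball (base p) s x by apply: sub_ball.
have [|d [hd _]] := expands_recenter (s := s / 2) _ near_p hf.
  by apply/andP; split; lra.
exists d; split=> //.
- move=> r' /ball_base/sub/ball_lsub; rewrite lsub_base; exact: sV.
- by move=> x /sub; exact: ef.
- by move=> r' /ball_base/sub/ball_lsub; rewrite lsub_base; exact: vf.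
Qed.

(** The solution at [x] is read off the vertical line through [x], so that the
    local solutions fit together by uniqueness of their expansions at the points
    of the initial hyperplane. *)
Lemma glued_solution : exists (C : 'rV[R]_m -> fps R (m + 1)) u,
  forall p, V p -> exists s, solves_at p (C p) s u.
Proof.
have /choice[C hC] : forall p, exists c, V p -> exists s f, solves_at p c s f.
  move=> p; have [Vp|nVp] := pselect (V p); last by exists 0.
  by have [c cP] := solution_exists h V_open v_analytic v_nondeg Vp; exists c.
pose u x := xget 0 [set y | has_sum (fun k => C (lsubmx x) (tpow m k) * x 0 tt ^+ k) y].
exists C, u => p Vp; have [s [f hf]] := hC p Vp.
have s0 : 0 < s by case: hf.
have s20 : 0 < s / 2 by lra.
exists (s / 2); apply: (@eq_solves_at _ _ _ f); last first.
  by apply: solves_at_sub hf; apply/andP; split; lra.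
move=> x px; set r := lsubmx x; have pr : ball p (s / 2) r := ball_lsub px.
have [d hd] := solves_at_recenter hf pr.
have Vr : V r by case: hd => _ + _ _ _; apply; exact: ballxx.
have [s' [f' hr]] := hC r Vr.
have dE := solution_unique V_open v_analytic v_nondeg Vr hd hr.
have hx : has_sum (fun k => C r (tpow m k) * x 0 tt ^+ k) (f x).
  rewrite -dE; apply: (expands_vertical (p := r) (s := s / 2)) => //.
    by case: hd.
  apply/ball_rVP => // i; case: (split_ordP i) => j ->.
    by rewrite base_x /r mxE subrr normr0.
  by rewrite (ord1 j) base_t -(base_t p); move/ball_rVP: px; exact.
rewrite /u; case: xgetP => [y _ hy|none]; first exact: has_sum_unique hx hy.
by case: (none _ hx).
Qed.

Lemma solves_at_eq p c s f c' s' f' : V p -> solves_at p c s f -> solves_at p c' s' f' ->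
  forall x, ball (base p) (Num.min s s') x -> f x = f' x.
Proof.
move=> Vp hf hf'; have e := solution_unique V_open v_analytic v_nondeg Vp hf hf'.
case: hf hf' => [s0 _ hf _ _] [s'0 _ + _ _]; rewrite -e => hf' x px.
apply: has_sum_unique (hf _ _) (hf' _ _); apply: le_ball px; by rewrite ge_min lexx ?orbT.
Qed.

(** The radius is shrunk until the expansion of [u], the equation and the initial
    condition hold on the same ball. *)
Lemma extension_solves_at U u p : soliton_extension h V v U u -> V p ->
  exists s c, ball (base p) s `<=` U /\ solves_at p c s u.
Proof.
move=> [[[Uo UV] ua] uv usol _] Vp.
have Up : U (base p) by apply: UV; exists p.
have [c [s [s0 hs]]] := ua _ Up.
have /nbhs_ballP[e /= e0 eU] : nbhs (base p) U by exact: open_nbhs_nbhs.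
have /nbhs_ballP[e' /= e'0 eV] : nbhs p V by exact: open_nbhs_nbhs.
pose w := Num.min s (Num.min e e').
have [ws we we'] : [/\ w <= s, w <= e & w <= e'].
  by rewrite /w !ge_min !lexx !orbT.
have w0 : 0 < w by rewrite !lt_min s0 e0.
have hc : expands (base p) w c u by apply: (sub_expands ws).
have wU : ball (base p) w `<=` U by apply: subset_trans eU; exact: le_ball.
exists w, c; split=> //; split=> //.
- by apply: subset_trans eV; exact: le_ball.
- by apply: (soliton_reduced_equation hc) => x /wU; exact: usol.
- by move=> r pr; apply: uv; apply: eV; exact: le_ball pr.
Qed.

End Gluing.

(** * Positive definite real symmetric matrices *)

Section PosDef.
Variable R : realType.

Definition posdef_sym n (A : 'M[R]_n) : Prop :=
  A^T = A /\ forall y : 'rV[R]_n, y != 0 -> 0 < (y *m A *m y^T) 0 0.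

Section Schur.
Variable n : nat.
Implicit Types (A : 'M[R]_(1 + n)) (w b : 'rV[R]_n) (D : 'M[R]_n).

Definition schur A : 'M[R]_n :=
  drsubmx A - (A 0 0)^-1 *: (dlsubmx A *m ursubmx A).

Lemma schurE A i j : schur A i j =
  A (rshift 1 i) (rshift 1 j) - (A 0 0)^-1 * (A (rshift 1 i) 0 * A 0 (rshift 1 j)).
Proof.
rewrite /schur mxE [X in _ + X]mxE [X in _ - X]mxE [X in _ - _ * X]mxE big_ord1 mxE.
rewrite !mxE.
have -> : lshift n (0 : 'I_1) = 0 :> 'I_(1 + n) by apply/val_inj.
by [].
Qed.

Lemma schur_block A : A^T = A ->
  A = block_mx (A 0 0)%:M (ursubmx A) (ursubmx A)^T (drsubmx A) /\ (drsubmx A)^T = drsubmx A.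
Proof.
move=> AT; split; last by rewrite trmx_drsub AT.
rewrite -[LHS]submxK; congr block_mx.
  apply/matrixP => i j; rewrite !mxE (ord1 i) (ord1 j) eqxx mulr1n.
  by congr (A _ _); apply/val_inj.
by rewrite trmx_ursub AT.
Qed.

Lemma schur_blockE A : A^T = A ->
  schur A = drsubmx A - (A 0 0)^-1 *: ((ursubmx A)^T *m ursubmx A).
Proof. by move=> AT; rewrite /schur trmx_ursub AT. Qed.

(** Completing the square in the first coordinate. *)
Lemma schur_square A (s : R) w : A^T = A -> A 0 0 != 0 ->
  let b := (w *m (ursubmx A)^T) 0 0 in
  (row_mx s%:M w *m A *m (row_mx s%:M w)^T) 0 0 =
    A 0 0 * (s + b / A 0 0) ^+ 2 + (w *m schur A *m w^T) 0 0.
Proof.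
move=> AT a0 b; have [AE _] := schur_block AT.
have bT : (ursubmx A *m w^T) 0 0 = b.
  by rewrite /b -[in RHS](trmxK w) -trmx_mul [RHS]mxE.
rewrite {1}AE mul_row_block tr_row_mx mul_row_col tr_scalar_mx.
rewrite mul_mx_scalar !mul_scalar_mx mulmxDl -scalemxAl.
rewrite schur_blockE// mulmxBr mulmxBl -scalemxAr -scalemxAl.
have -> : w *m ((ursubmx A)^T *m ursubmx A) *m w^T =
   (w *m (ursubmx A)^T) *m (ursubmx A *m w^T) by rewrite !mulmxA.
set b1 := w *m (ursubmx A)^T; set b2 := ursubmx A *m w^T.
set d := w *m _ *m w^T.
have aD (X Y : 'M[R]_1) : (X + Y) 0 0 = X 0 0 + Y 0 0 by rewrite mxE.
have aN (X : 'M[R]_1) : (- X) 0 0 = - X 0 0 by rewrite mxE.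
have aZ k (X : 'M[R]_1) : (k *: X) 0 0 = k * X 0 0 by rewrite mxE.
have bb : (b1 *m b2) 0 0 = b * b by rewrite mxE big_ord1 bT.
have sc : ((A 0 0)%:M : 'M[R]_1) 0 0 = A 0 0 by rewrite mxE eqxx mulr1n.
rewrite !(aD, aN, aZ) bb sc bT -/b.
by field.
Qed.

Lemma posdef_schur A : A^T = A ->
  posdef_sym A <-> 0 < A 0 0 /\ posdef_sym (schur A).
Proof.
move=> AT; have ST : (schur A)^T = schur A.
  have [_ DT] := schur_block AT.
  by rewrite schur_blockE// linearB /= DT linearZ /= trmx_mul trmxK.
split=> [[_ pA]|[a0 [_ pS]]]; last first.
  split=> // y; rewrite -[y]hsubmxK; set w := rsubmx y; set s := lsubmx y 0 0.
  have -> : lsubmx y = s%:M by rewrite [LHS]mx11_scalar.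
  move=> y0; rewrite schur_square ?gt_eqF//; have [w0|w0] := eqVneq w 0.
    rewrite w0 !mul0mx !mxE mul0r !addr0 mulr_gt0//.
    rewrite exprn_even_gt0//=; apply: contra_neq y0 => ->.
    by rewrite w0 raddf0 row_mx0.
  by rewrite ltr_wpDl ?pS// mulr_ge0 ?sqr_ge0// ltW.
have a0 : 0 < A 0 0.
  have -> : A 0 0 = (row_mx 1%:M 0 *m A *m (row_mx 1%:M 0)^T) 0 0.
    rewrite {2}(schur_block AT).1 mul_row_block tr_row_mx mul_row_col.
    by rewrite trmx0 trmx1 !(mul0mx, mulmx0, mul1mx, mulmx1, addr0) mxE eqxx.
  apply: pA; rewrite row_mx_eq0 negb_and; apply/orP; left.
  by apply/eqP => /matrixP/(_ 0 0)/eqP; rewrite !mxE eqxx oner_eq0.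
split=> //; split=> // w w0.
pose s := - ((w *m (ursubmx A)^T) 0 0 / A 0 0).
have := pA (row_mx s%:M w); rewrite schur_square ?gt_eqF// /s addNr expr0n mulr0 add0r; apply.
by apply: contraNneq w0 => /eqP; rewrite row_mx_eq0 => /andP[].
Qed.

Lemma det_schur A : A 0 0 != 0 -> \det A = A 0 0 * \det (schur A).
Proof.
move=> a0; set a := A 0 0.
have ul : ulsubmx A = a%:M.
  apply/matrixP => i j; rewrite !mxE (ord1 i) (ord1 j) eqxx mulr1n /a.
  by congr (A _ _); apply/val_inj.
have AE : A = block_mx 1%:M 0 (a^-1 *: dlsubmx A) 1%:M *m
              block_mx a%:M (ursubmx A) 0 (schur A).
  rewrite mulmx_block !mul1mx !mul0mx !addr0 -scalemxAl mul_mx_scalar scalerA.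
  rewrite mulVf// scale1r -scalemxAl addrC subrK.
  by rewrite -[LHS]submxK ul.
by rewrite {1}AE det_mulmx det_lblock det_ublock !det1 !mul1r det_scalar1.
Qed.

End Schur.

Lemma posdef_det n (A : 'M[R]_n) : posdef_sym A -> 0 < \det A.
Proof.
elim: n A => [|n IH] A pA; first by rewrite det_mx00.
have [a0 pS] := (@posdef_schur n A (proj1 pA)).1 pA.
by rewrite (@det_schur n A) ?gt_eqF// mulr_gt0// IH.
Qed.

(** Induction on the size: the corner entry and the Schur complement depend
    continuously on the matrix. *)
Lemma posdef_near n (T : Type) (F : set_system T) (FF : Filter F) (A : T -> 'M[R]_n)
  (A0 : 'M[R]_n) : (\forall x \near F, (A x)^T = A x) ->
  (forall i j, A x i j @[x --> F] --> A0 i j) ->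
  posdef_sym A0 -> \forall x \near F, posdef_sym (A x).
Proof.
elim: n A A0 => [|n IH] A A0 AT cA pA0.
  by apply: filterS AT => x AT; split=> // y; rewrite thinmx0 eqxx.
have [a0 pS] := (@posdef_schur n A0 (proj1 pA0)).1 pA0.
have ca : A x 0 0 @[x --> F] --> A0 0 0 := cA 0 0.
have na : \forall x \near F, 0 < A x 0 0 by exact: (cvgr_gt (A0 0 0) ca 0 a0).
have ns : \forall x \near F, posdef_sym (@schur n (A x)).
  apply: IH pS => [|i j].
    apply: filterS AT => x AT; have [_ DT] := @schur_block n (A x) AT.
    by rewrite schur_blockE// linearB /= DT linearZ /= trmx_mul trmxK.
  rewrite schurE; under eq_fun do rewrite schurE.
  apply: cvgB; first exact: cA.
  apply: cvgM; last by apply: cvgM; exact: cA.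
  by apply: cvgV => //; rewrite gt_eqF.
apply: filterS3 AT na ns => x AT a1 s1.
by apply/(@posdef_schur n (A x) AT).
Qed.

(** Each permutation contributes the same product on both sides: on the points
    it moves, the factors only get permuted. *)
Lemma det_scale_sym n (d s : 'I_n -> R) (H : 'M[R]_n) :
  \det (\matrix_(i, j) ((i == j)%:R * d j + s j ^+ 2 * H i j)) =
  \det (\matrix_(i, j) ((i == j)%:R * d j + s i * s j * H i j)).
Proof.
apply: eq_bigr => /= t _; congr (_ * _).
rewrite (bigID (fun i => t i == i)) [RHS](bigID (fun i => t i == i)) /=; congr (_ * _).
  by apply: eq_bigr => i /eqP ti; rewrite !mxE ti expr2.
have E (G : 'I_n -> R) : \prod_(i | t i != i) G (t i) = \prod_(i | t i != i) G i.
  rewrite [RHS](reindex_inj (@perm_inj _ t)) /=; apply: eq_bigl => i.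
  by rewrite (inj_eq perm_inj).
transitivity (\prod_(i | t i != i) s (t i) ^+ 2 * \prod_(i | t i != i) H i (t i)).
  rewrite -big_split /=; apply: eq_bigr => i ti.
  by rewrite mxE eq_sym (negPf ti) mul0r add0r.
under [in LHS]eq_bigr do rewrite expr2.
rewrite big_split /= {1}E -big_split -big_split /=; apply: eq_bigr => i ti.
by rewrite mxE eq_sym (negPf ti) mul0r add0r.
Qed.

End PosDef.

(** * The complex Hessian of a function of the squared moduli *)

Section ComplexHessian.
Local Open Scope complex_scope.
Local Open Scope sesquilinear_scope.
Variables (R : realType) (n : nat).
Implicit Types (z : 'rV[R[i]]_n) (f g : 'rV[R]_n -> R) (q x : 'rV[R]_n) (d l : R[i]).

(** The real inner product of the plane. *)
Definition dotC d l : R := complex.Re d * complex.Re l + complex.Im d * complex.Im l.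

Definition line z i d (t : R) : 'rV[R[i]]_n := z + t%:C *: (d *: delta_mx 0 i).

Lemma muE z i : mu z 0 i = dotC (z 0 i) (z 0 i).
Proof.
rewrite mxE /dotC; case: (z 0 i) => a b /=.
by rewrite sqr_sqrtr ?addr_ge0 ?sqr_ge0// !expr2.
Qed.

Lemma lineE z i d t j : line z i d t 0 j = z 0 j + t%:C * (d * (i == j)%:R).
Proof. by rewrite !mxE eqxx [j == i]eq_sym. Qed.

(** Moving one coordinate [z 0 i] only moves the coordinate [i] of [mu z]. *)
Lemma mu_line z i d t :
  mu (line z i d t) = (t * (2 * dotC d (z 0 i)) + t ^+ 2 * dotC d d) *: delta_mx 0 i + mu z.
Proof.
apply/rowP => j; rewrite muE lineE [RHS]mxE [X in _ = X + _]mxE muE [delta_mx _ _ _ _]mxE eqxx /=.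
rewrite [j == i]eq_sym; have [<-|_] := eqVneq i j; last by rewrite !mulr0 add0r addr0.
rewrite !mulr1; case: (z 0 i) => a b; case: d => c e; rewrite /dotC /=.
by ring.
Qed.

Lemma line0 z i d : line z i d 0 = z.
Proof. by rewrite /line scale0r addr0. Qed.

Lemma is_derive_affine (a b : R) :
  is_derive (0 : R) (1 : R) (fun t : R => a + t * b) b.
Proof.
have -> : (fun t : R => a + t * b) = cst a + b \*: (id : R -> R).
  by apply/funext => t; rewrite /= mulrC.
have h := is_deriveD (is_derive_cst a (0 : R) (1 : R)) (is_deriveZ b (is_derive_id (0 : R) (1 : R))).
by apply: is_derive_eq h _; rewrite add0r [LHS]mulr1.
Qed.

Lemma is_derive_affineM (a b k : R) (G : R -> R) : is_derive (0 : R) (1 : R) G k ->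
  is_derive (0 : R) (1 : R) (fun t : R => (a + t * b) * G t) (b * G 0 + a * k).
Proof.
move=> hG; have h := is_deriveM (is_derive_affine a b) hG.
apply: is_derive_eq h _; rewrite mul0r addr0 addrC; congr (_ + _); exact: mulrC.
Qed.

Lemma is_derive_shift (a b : R) :
  is_derive (0 : R) (1 : R) (fun t : R => t * a + t ^+ 2 * b) a.
Proof.
have -> : (fun t : R => t * a + t ^+ 2 * b) = (fun t => (0 + t * 1) * (a + t * b)).
  by apply/funext => t; ring.
by apply: is_derive_eq (is_derive_affineM 0 1 (is_derive_affine a b)) _; ring.
Qed.

Lemma is_derive_mu_line q r c g z i d : expands q r c g -> ball q r (mu z) ->
  is_derive (0 : R) (1 : R) (fun t => g (mu (line z i d t)))
    (2 * dotC d (z 0 i) * partial i g (mu z)).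
Proof.
move=> hg qz.
set s := fun t : R => t * (2 * dotC d (z 0 i)) + t ^+ 2 * dotC d d.
have hs : is_derive (0 : R) (1 : R) s (2 * dotC d (z 0 i)) by exact: is_derive_shift.
have s0 : s 0 = 0 by rewrite /s expr0n !mul0r addr0.
have hgz := expands_is_derive (delta_mx 0 i) qz hg; rewrite sum_delta_mx in hgz.
have hl : is_derive (s 0) (1 : R) (fun t => g (t *: delta_mx 0 i + mu z)) (partial i g (mu z)).
  by rewrite s0; apply: is_derive_line; rewrite scale0r add0r.
have -> : (fun t => g (mu (line z i d t))) = (fun t => g (t *: delta_mx 0 i + mu z)) \o s.
  by apply/funext => t /=; rewrite mu_line.
by rewrite mulrC; exact: is_derive1_comp.
Qed.

Lemma line_near q r z i d : ball q r (mu z) ->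
  \forall t \near (0 : R), ball q r (mu (line z i d t)).
Proof.
move=> qz; have [s /andP[s0 _] sR] := ball_room qz.
have r0 := ball_radius_gt0 qz.
set k := fun t : R => t * (2 * dotC d (z 0 i)) + t ^+ 2 * dotC d d.
have [hk _] : is_derive (0 : R) (1 : R) k (2 * dotC d (z 0 i)) by exact: is_derive_shift.
have ck : k t @[t --> 0] --> k 0.
  by apply: differentiable_continuous; apply/derivable1_diffP.
have k0 : k 0 = 0 by rewrite /k expr0n !mul0r addr0.
have : \forall t \near (0 : R), `|k 0 - k t| < s by move/cvgrPdist_lt: ck; exact.
apply: filterS => t; rewrite k0 sub0r normrN => kt.
apply: (sub_ball r0 sR); apply/ball_rVP => // j.
rewrite mu_line -/(k t) [X in _ - X]mxE [X in _ - (X + _)]mxE.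
rewrite opprD addrCA subrr addr0 normrN [delta_mx _ _ _ _]mxE eqxx /=.
by case: (j == i); rewrite ?mulr1// mulr0 normr0.
Qed.

Lemma derive1_near (a b : R -> R) (s k : R) : is_derive s (1 : R) a k ->
  (\forall t \near s, a t = b t) -> derive1 b s = k.
Proof.
move=> [da va] ab; rewrite derive1E -va; symmetry; exact: near_eq_derive.
Qed.

Lemma cderive_mu q r c g z i d F l0 l1 : expands q r c g -> ball q r (mu z) ->
  (\forall t \near (0 : R), F (line z i d t) = (l0 + t%:C * l1) * (g (mu (line z i d t)))%:C) ->
  cderive (d *: delta_mx 0 i) F z =
    l1 * (g (mu z))%:C + l0 * (2 * dotC d (z 0 i) * partial i g (mu z))%:C.
Proof.
move=> hg qz FE; have hd := is_derive_mu_line i d hg qz.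
set D := 2 * _ * _ in hd *.
have hp (a b : R) : is_derive (0 : R) (1 : R)
    (fun t => (a + t * b) * g (mu (line z i d t))) (b * g (mu z) + a * D).
  by apply: is_derive_eq (is_derive_affineM a b hd) _; rewrite line0.
rewrite /cderive.
rewrite (derive1_near (hp (complex.Re l0) (complex.Re l1))); last first.
  apply: filterS FE => t; rewrite -/(line z i d t) => ->.
  by case: l0 l1 => a0 b0 [a1 b1] /=; ring.
rewrite (derive1_near (hp (complex.Im l0) (complex.Im l1))); last first.
  apply: filterS FE => t; rewrite -/(line z i d t) => ->.
  by case: l0 l1 => a0 b0 [a1 b1] /=; ring.
case: l0 l1 {FE} => a0 b0 [a1 b1]; apply/eqP; rewrite eq_complex /=; apply/andP; split; apply/eqP; ring.
Qed.

Lemma dzbar_mu q r c f z j : expands q r c f -> ball q r (mu z) ->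
  dzbar j (fun w => (f (mu w))%:C) z = z 0 j * (partial j f (mu z))%:C.
Proof.
move=> hf qz; rewrite /dzbar.
have FE d : \forall t \near (0 : R), (f (mu (line z j d t)))%:C =
    (1 + t%:C * 0) * (f (mu (line z j d t)))%:C.
  by apply/nbhs_ballP; exists 1 => //= t _; rewrite mulr0 addr0 mul1r.
rewrite -{1}[delta_mx 0 j]scale1r (cderive_mu hf qz (FE _)) (cderive_mu hf qz (FE _)).
rewrite !mul0r !add0r !mul1r.
set D := partial j f _; case: (z 0 j) => a b; rewrite /dotC /=.
apply: (mulfI (x := 2)); first by rewrite pnatr_eq0.
rewrite mulVKf ?pnatr_eq0//.
apply/eqP; rewrite eq_complex /=; apply/andP; split; apply/eqP; ring.
Qed.

(** By the chain rule a function of [mu z] has derivative along [d] in the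
    coordinate [i] equal to [2 * dotC d (z 0 i)] times its partial derivative; the
    real and imaginary directions recombine into [z 0 i] or its conjugate. *)
Lemma complex_hessianE q r c f z i j : expands q r c f -> ball q r (mu z) ->
  complex_hessian (f \o @mu R n) z i j =
  (i == j)%:R * (partial j f (mu z))%:C + z 0 j * conjc (z 0 i) * (partial i (partial j f) (mu z))%:C.
Proof.
move=> hf qz; rewrite mxE /dz.
have FE d : \forall t \near (0 : R),
    dzbar j (fun w => ((f \o @mu R n) w)%:C) (line z i d t) =
    (z 0 j + t%:C * (d * (i == j)%:R)) * (partial j f (mu (line z i d t)))%:C.
  apply: filterS (line_near i d qz) => t qt.
  by rewrite (dzbar_mu j hf qt) lineE.
rewrite -{1}[delta_mx 0 i]scale1r.
rewrite (cderive_mu (expands_deriv (i := j) hf) qz (FE _)) (cderive_mu (expands_deriv (i := j) hf) qz (FE _)).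
set D := partial j f _; set E := partial i _ _.
apply: (mulfI (x := 2)); first by rewrite pnatr_eq0.
rewrite mulVKf ?pnatr_eq0//; case: (z 0 j) => a b; case: (z 0 i) => a' b'; rewrite /dotC /=.
by case: (i == j); apply/eqP; rewrite eq_complex /=; apply/andP; split; apply/eqP; ring.
Qed.

Lemma partialC q r c f x i j : expands q r c f -> ball q r x ->
  partial i (partial j f) x = partial j (partial i f) x.
Proof.
move=> hf qx.
have h1 := expands_deriv (i := i) (expands_deriv (i := j) hf) qx.
have h2 := expands_deriv (i := j) (expands_deriv (i := i) hf) qx.
by rewrite fps_derivC in h1; exact: has_sum_unique h1 h2.
Qed.

Lemma reduced_mxE q r c f x i j : expands q r c f -> ball q r x ->
  reduced_mx f x i j = (i == j)%:R * partial j f x + x 0 j * partial i (partial j f) x.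
Proof.
move=> hf qx; rewrite mxE; have h1 := expands_soliton_mx (i := i) (j := j) hf qx.
apply: has_sum_unique h1 _; rewrite soliton_mxE.
suff h : expands q r ((i == j)%:R * fps_deriv j c + fps_coord q j * fps_deriv i (fps_deriv j c))
   (fun y => (i == j)%:R * partial j f y + y 0 j * partial i (partial j f) y) by exact: h.
apply: expandsD; last first.
  by apply: expandsM; [exact: expands_coord | do 2 apply: expands_deriv].
apply: expandsM; last exact: expands_deriv.
rewrite -[X in expands _ _ X](rmorph_nat (@fps_const R n)); exact: expands_const.
Qed.

(** The matrix that the complex Hessian becomes once the phases of the
    coordinates are absorbed. *)
Definition hess_mx f x : 'M[R]_n :=
  \matrix_(i, j) ((i == j)%:R * partial j f x
    + Num.sqrt (x 0 i) * Num.sqrt (x 0 j) * partial i (partial j f) x).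

Lemma hess_mx_sym q r c f x : expands q r c f -> ball q r x -> (hess_mx f x)^T = hess_mx f x.
Proof.
move=> hf qx; apply/matrixP => i j; rewrite !mxE (partialC j i hf qx) eq_sym.
have [->//|_] := eqVneq i j; by rewrite !mul0r !add0r [X in X * _]mulrC.
Qed.

Lemma det_hess_mx q r c f x : expands q r c f -> ball q r x -> (forall i, 0 <= x 0 i) ->
  \det (reduced_mx f x) = \det (hess_mx f x).
Proof.
move=> hf qx x0.
transitivity (\det (\matrix_(i, j) ((i == j)%:R * partial j f x
   + Num.sqrt (x 0 j) ^+ 2 * (\matrix_(i, j) partial i (partial j f) x) i j))).
  by congr (\det _); apply/matrixP => i j; rewrite (reduced_mxE i j hf qx) !mxE sqr_sqrtr.
rewrite (det_scale_sym (fun j => partial j f x) (fun i => Num.sqrt (x 0 i))).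
by congr (\det _); apply/matrixP => i j; rewrite !mxE.
Qed.

Let realcD (x y : R) : (x + y)%:C = x%:C + y%:C :> R[i]. Proof. exact: rmorphD. Qed.
Let realcM (x y : R) : (x * y)%:C = x%:C * y%:C :> R[i]. Proof. exact: rmorphM. Qed.
Let realc_bool (b : bool) : (b%:R : R)%:C = b%:R :> R[i]. Proof. exact: rmorph_nat. Qed.
Let conjcD (x y : R[i]) : conjc (x + y) = conjc x + conjc y. Proof. exact: rmorphD. Qed.
Let conjcM (x y : R[i]) : conjc (x * y) = conjc x * conjc y. Proof. exact: rmorphM. Qed.

Lemma qformE (A : 'M[R]_n) (y : 'rV[R]_n) :
  (y *m A *m y^T) 0 0 = \sum_i \sum_j y 0 i * A i j * y 0 j.
Proof.
rewrite mxE exchange_big /=; apply: eq_bigr => j _.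
by rewrite mxE big_distrl /= mxE.
Qed.

Lemma hermformE (H : 'M[R[i]]_n) (w : 'rV[R[i]]_n) :
  (w *m H *m w ^t*) 0 0 = \sum_i \sum_j w 0 i * H i j * conjc (w 0 j).
Proof.
rewrite mxE exchange_big /=; apply: eq_bigr => j _.
by rewrite mxE big_distrl /= !mxE.
Qed.

(** The Hermitian form of a real symmetric matrix is the sum of its values on the
    real and on the imaginary part of the vector. *)
Lemma posdef_complex (A : 'M[R]_n) (u : 'I_n -> R[i]) : posdef_sym A ->
  (exists i, u i != 0) -> 0 < \sum_i \sum_j u i * (A i j)%:C * conjc (u j).
Proof.
move=> [AT pA] [k uk].
pose a : 'rV[R]_n := \row_i complex.Re (u i).
pose b : 'rV[R]_n := \row_i complex.Im (u i).
pose X := \sum_i \sum_j (b 0 i * A i j * a 0 j - a 0 i * A i j * b 0 j).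
have X0 : X = 0.
  rewrite /X; under eq_bigr do rewrite big_split /=.
  rewrite big_split /= [X in X + _]exchange_big /= -big_split /= big1// => i _.
  rewrite -big_split /= big1// => j _.
  have -> : A i j = A j i by rewrite -{1}AT mxE.
  by ring.
have -> : \sum_i \sum_j u i * (A i j)%:C * conjc (u j) =
   ((a *m A *m a^T) 0 0 + (b *m A *m b^T) 0 0)%:C + 'i%C * X%:C.
  rewrite !qformE -big_split /X !rmorph_sum mulr_sumr -big_split /=; apply: eq_bigr => i _.
  rewrite -big_split !rmorph_sum mulr_sumr -big_split /=; apply: eq_bigr => j _.
  rewrite !mxE; case: (u i) => x y; case: (u j) => x' y' /=.
  by apply/eqP; rewrite eq_complex /=; apply/andP; split; apply/eqP; ring.
rewrite X0 mulr0 addr0 ltcR.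
have nn (y : 'rV[R]_n) : 0 <= (y *m A *m y^T) 0 0.
  by have [->|y0] := eqVneq y 0; [rewrite !mul0mx mxE | exact/ltW/pA].
have [a0|a0] := eqVneq a 0; last by rewrite ltr_pwDl// pA.
rewrite a0 !mul0mx mxE add0r pA//; apply: contraNneq uk => b0.
move: a0 b0 => /rowP/(_ k) + /rowP/(_ k).
by rewrite !mxE; case: (u k) => x y /= -> ->.
Qed.

(** The phase of 0 is arbitrary. *)
Lemma phase (l : R[i]) : exists2 e : R[i], e * conjc e = 1 &
  l = e * (Num.sqrt (dotC l l))%:C.
Proof.
have E : dotC l l = Normc.normc l ^+ 2.
  by case: l => a b; rewrite /dotC /= sqr_sqrtr ?addr_ge0 ?sqr_ge0// !expr2.
have nn : 0 <= Normc.normc l by case: l {E} => a b; exact: sqrtr_ge0.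
have [->|l0] := eqVneq l 0.
  by exists 1; rewrite ?conjc1 ?mulr1// /dotC /= !mul0r addr0 sqrtr0 mulr0.
have n0 : Normc.normc l != 0 by apply: contra_neq l0; exact: Normc.eq0_normc.
rewrite E sqrtr_sqr ger0_norm//.
have m0 : (Normc.normc l)%:C != 0 :> R[i] by apply: contra_neq n0 => -[].
exists (l / (Normc.normc l)%:C); last by rewrite divfK.
rewrite conjcM conjc_inv conjc_real mulrACA -invfM -rmorphM -expr2 -E.
have -> : l * conjc l = (dotC l l)%:C.
  case: (l) => a b; apply/eqP; rewrite eq_complex /dotC /=; apply/andP; split; apply/eqP; ring.
rewrite divff//; have: dotC l l != 0 by rewrite E expf_neq0.
by apply: contra_neq => -[].
Qed.

(** Multiplying the coordinates of a vector by the conjugate phases of those of [z]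
    turns the Hermitian form into that of [hess_mx]. *)
Lemma hess_mx_posdefmx q r c f z : expands q r c f -> ball q r (mu z) ->
  posdef_sym (hess_mx f (mu z)) -> posdefmx (complex_hessian (f \o @mu R n) z).
Proof.
move=> hf qz pS; have HE i j := complex_hessianE i j hf qz.
split.
  apply/is_hermitianmxP; rewrite expr0 scale1r; apply/matrixP => i j.
  have -> : (complex_hessian (f \o @mu R n) z ^t*) i j =
    conjc (complex_hessian (f \o @mu R n) z j i) by rewrite [LHS]mxE [X in _ X = _]mxE.
  rewrite !HE (partialC j i hf qz).
  rewrite conjcD !conjcM !conjc_real conjcK eq_sym conjc_nat.
  have [->|_] := eqVneq i j; last by rewrite !mul0r !add0r [X in X * _]mulrC.
  by rewrite [X in _ + X * _]mulrC.
move=> w w0; rewrite hermformE.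
have /choice[e he] : forall i, exists e : R[i], e * conjc e = 1 /\
    z 0 i = e * (Num.sqrt (mu z 0 i))%:C.
  by move=> i; have [e e1 e2] := phase (z 0 i); exists e; rewrite muE.
pose u i := w 0 i * conjc (e i).
have [k wk] : exists k, w 0 k != 0.
  apply/existsP; rewrite -negb_forall; apply: contra w0 => /forallP w0.
  by apply/eqP/rowP => k; rewrite mxE; apply/eqP.
have ek i : e i != 0.
  by apply/eqP => e0; have := (he i).1; rewrite e0 mul0r => /eqP; rewrite eq_sym oner_eq0.
have := posdef_complex (u := u) pS; rewrite /=.
have -> : \sum_i \sum_j w 0 i * complex_hessian (f \o @mu R n) z i j * conjc (w 0 j) =
    \sum_i \sum_j u i * (hess_mx f (mu z) i j)%:C * conjc (u j).
  apply: eq_bigr => i _; apply: eq_bigr => j _; rewrite HE [hess_mx _ _ _ _]mxE /u.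
  rewrite (he i).2 (he j).2 !conjcM conjc_real conjcK realcD !realcM realc_bool.
  set si := Num.sqrt _; set sj := Num.sqrt _.
  have [<-|_] := eqVneq i j; last by rewrite !mul0r !add0r; ring.
  have ee := (he i).1; rewrite [true%:R](_ : _ = 1)//; ring: ee.
apply; exists k; rewrite mulf_neq0// conjc_eq0; exact: ek.
Qed.

(** At the real point over [x] no phases are needed, and real vectors suffice. *)
Lemma posdefmx_hess_mx q r c f x : expands q r c f -> ball q r x -> (forall i, 0 <= x 0 i) ->
  (forall z, mu z = x -> posdefmx (complex_hessian (f \o @mu R n) z)) ->
  posdef_sym (hess_mx f x).
Proof.
move=> hf qx x0 pH; split; first exact: hess_mx_sym hf qx.
pose z : 'rV[R[i]]_n := \row_i (Num.sqrt (x 0 i))%:C.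
have zx : mu z = x.
  by apply/rowP => i; rewrite muE mxE /dotC /= mul0r addr0 -expr2 sqr_sqrtr.
have [_ pz] := pH z zx.
move=> y y0; have qz : ball q r (mu z) by rewrite zx.
have := pz (map_mx (fun t : R => t%:C) y); rewrite hermformE qformE -ltcR.
have -> : \sum_i \sum_j (map_mx (fun t : R => t%:C) y) 0 i * complex_hessian (f \o @mu R n) z i j *
    conjc ((map_mx (fun t : R => t%:C) y) 0 j) =
    (\sum_i \sum_j y 0 i * hess_mx f x i j * y 0 j)%:C.
  rewrite rmorph_sum; apply: eq_bigr => i _; rewrite rmorph_sum; apply: eq_bigr => j _ /=.
  rewrite (complex_hessianE i j hf qz) zx !mxE !conjc_real !realcM realcD !realcM realc_bool.
  by rewrite [X in _ + X * _]mulrC.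
apply; apply: contra_neq y0 => /rowP y0; apply/rowP => i.
by have := y0 i; rewrite !mxE => -[].
Qed.

End ComplexHessian.

(** * Pseudo-convexity near the initial hyperplane *)

Section Assembly.
Variables (R : realType) (m : nat) (h : 'rV[R]_(m + 1)).
Variables (V : set 'rV[R]_m) (v : 'rV[R]_m -> R).
Hypothesis V_open : open V.
Hypothesis v_analytic : real_analytic_on V v.
Hypothesis v_spc : strictly_pseudo_convex_on (@mu R m @^-1` V) (v \o @mu R m).
Hypothesis v_nondeg : nondegenerate_off_orthant V v.
Local Notation xx := (lshift 1).
Local Notation tt := (rshift m (ord0 : 'I_1)).
Local Notation solves_at := (solves_at h V v).
Implicit Types (p r : 'rV[R]_m) (x : 'rV[R]_(m + 1)) (u : 'rV[R]_(m + 1) -> R)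
  (c : fps R (m + 1)).

Lemma hess_mx_initial p : V p -> (forall i, 0 <= p 0 i) -> posdef_sym (hess_mx v p).
Proof.
move=> Vp p0; have [c [s [s0 sV hc]]] := v_expands V_open v_analytic Vp.
apply: (posdefmx_hess_mx hc (ballxx _ s0) p0) => z zp; apply: v_spc.
by rewrite /preimage /= zp.
Qed.

(** At a point of the orthant the determinant is that of a positive definite
    matrix. *)
Lemma reduced_mx_initial p : V p -> \det (reduced_mx v p) != 0.
Proof.
move=> Vp; have [neg|nneg] := pselect (exists i, p 0 i < 0); first exact: v_nondeg.
have p0 i : 0 <= p 0 i by rewrite leNgt; apply/negP => pi; apply: nneg; exists i.
have [c [s [s0 sV hc]]] := v_expands V_open v_analytic Vp.
by rewrite (det_hess_mx hc (ballxx _ s0) p0) gt_eqF// posdef_det//; exact: hess_mx_initial.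
Qed.

Lemma fps_deriv_memb c i : fps_deriv (xx i) c \o @memb m = fps_deriv i (c \o @memb m).
Proof. by apply/funext => b; rewrite /= /fps_deriv memb_x -memb_munit -membD. Qed.

(** The mixed second derivatives in t carry the factor sqrt 0, so that the matrix
    is block diagonal. *)
Lemma hess_mx_base p c s u : solves_at p c s u ->
  hess_mx u (base p) = block_mx (hess_mx v p) 0 0 (partial tt u (base p))%:M.
Proof.
move=> [s0 sV hu _ uv].
have hv : expands p s (c \o @memb m) v := eq_expands uv (expands_restrict hu).
have d1 j : partial (xx j) u (base p) = partial j v p.
  rewrite (expands_partial_center (xx j) s0 hu) (expands_partial_center j s0 hv).
  by rewrite -memb_munit.
have d2 i j : partial (xx i) (partial (xx j) u) (base p) = partial i (partial j v) p.
  rewrite (expands_center s0 (expands_deriv (i := xx i) (expands_deriv (i := xx j) hu))).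
  rewrite (expands_center s0 (expands_deriv (i := i) (expands_deriv (i := j) hv))).
  by rewrite -!fps_deriv_memb /= memb0.
apply/matrixP => i j; rewrite mxE.
case: (split_ordP i) => i' ->; case: (split_ordP j) => j' ->.
- by rewrite block_mxEul [RHS]mxE !base_x d1 d2 (inj_eq (@lshift_inj _ _)).
- rewrite block_mxEur [RHS]mxE (ord1 j') base_t sqrtr0 mulr0 mul0r.
  by rewrite eq_lrshift mul0r addr0.
- rewrite block_mxEdl [RHS]mxE (ord1 i') base_t sqrtr0 mul0r mul0r.
  by rewrite eq_rlshift mul0r addr0.
by rewrite block_mxEdr [RHS]mxE (ord1 i') (ord1 j') base_t sqrtr0 !mul0r addr0 eqxx mul1r mulr1n.
Qed.

(** The equation itself makes the remaining diagonal entry positive. *)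
Lemma hess_mx_base_posdef p c s u : V p -> (forall i, 0 <= p 0 i) -> solves_at p c s u ->
  posdef_sym (hess_mx u (base p)).
Proof.
move=> Vp p0 hs; have := hs => -[s0 sV hu ueq uv].
have pS := hess_mx_initial Vp p0; have HE := hess_mx_base hs.
have b0 k : 0 <= base p 0 k.
  by case: (split_ordP k) => j ->; rewrite ?base_x// (ord1 j) base_t.
have detE := det_hess_mx hu (ballxx _ s0) b0.
have k0 : 0 < partial tt u (base p).
  have := ueq _ (ballxx _ s0); rewrite /reduced_equation detE HE det_ublock det_scalar1 => e1.
  have : 0 < \det (hess_mx v p) * partial tt u (base p).
    by rewrite -(pmulr_lgt0 _ (expR_gt0 (exponent h u (base p)))) e1 ltr01.
  by rewrite pmulr_rgt0// posdef_det.
rewrite HE; split.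
  by rewrite tr_block_mx !trmx0 tr_scalar_mx (proj1 pS).
move=> y y0; rewrite -[y]hsubmxK in y0 *; set y1 := lsubmx y in y0 *; set y2 := rsubmx y in y0 *.
rewrite mul_row_block tr_row_mx mul_row_col !mulmx0 addr0 add0r.
rewrite [X in 0 < X]mxE mul_mx_scalar -scalemxAl [X in _ + X]mxE [X in _ + _ * X]mxE big_ord1 [y2^T _ _]mxE -expr2.
have [y10|y10] := eqVneq y1 0; last first.
  by rewrite ltr_pwDl ?(proj2 pS)// mulr_ge0 ?sqr_ge0// ltW.
rewrite y10 !mul0mx mxE add0r mulr_gt0// exprn_even_gt0//=.
apply: contra_neq y0 => y20; rewrite y10; have -> : y2 = 0.
  by apply/matrixP => i j; rewrite (ord1 i) (ord1 j) [RHS]mxE; exact: y20.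
exact: row_mx0.
Qed.

(** Positive definiteness is an open condition. *)
Lemma spc_near p c s u : V p -> solves_at p c s u ->
  exists2 r : R, 0 < r <= s & forall z, ball (base p) r (mu z) ->
    posdefmx (complex_hessian (u \o @mu R (m + 1)) z).
Proof.
move=> Vp hs; have := hs => -[s0 sV hu ueq uv].
have [[i pi]|nneg] := pselect (exists i, p 0 i < 0).
  (* such points are not in the image of the squared moduli *)
  exists (Num.min s (- p 0 i)); first by rewrite lt_min s0 oppr_gt0 pi ge_min lexx.
  have r0 : 0 < Num.min s (- p 0 i) by rewrite lt_min s0 oppr_gt0 pi.
  move=> z /ball_rVP-/(_ r0 (xx i)); rewrite base_x.
  have zi : 0 <= mu z 0 (xx i) by rewrite mxE sqr_ge0.
  rewrite lt_min => /andP[_] /ltr_normlP[h1 h2]; exfalso; lra.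
have p0 i : 0 <= p 0 i by rewrite leNgt; apply/negP => pi; apply: nneg; exists i.
have pS := hess_mx_base_posdef Vp p0 hs.
have nb : \forall x \near base p, posdef_sym (hess_mx u x).
  apply: (@posdef_near R (m + 1) _ (nbhs (base p)) _ (fun x => hess_mx u x) _ _ _ pS).
    by apply/nbhs_ballP; exists s => // x px; exact: hess_mx_sym hu px.
  move=> i j; pose F x : R := (i == j)%:R * partial j u x
      + Num.sqrt (x 0 i) * Num.sqrt (x 0 j) * partial i (partial j u) x.
  have EF : (fun x => hess_mx u x i j) = F by apply/funext => x; exact: mxE.
  suff cF : {for base p, continuous F} by have : F x @[x --> base p] --> F (base p) := cF; rewrite -EF.
  have b0 := ballxx (base p) s0.
  have cs k : {for base p, continuous (fun x : 'rV[R]_(m + 1) => Num.sqrt (x 0 k))}.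
    apply: (@continuous_comp _ _ _ (fun x : 'rV[R]_(m + 1) => x 0 k) Num.sqrt).
      exact: coord_continuous.
    exact: sqrt_continuous.
  apply: continuousD.
    apply: continuousM; first exact: cst_continuous.
    exact: expands_continuous b0 (expands_deriv (i := j) hu).
  apply: continuousM; first by apply: continuousM; exact: cs.
  exact: expands_continuous b0 (expands_deriv (i := i) (expands_deriv (i := j) hu)).
have /nbhs_ballP[e /= e0 he] := nb.
exists (Num.min s e); first by rewrite lt_min s0 e0 ge_min lexx.
move=> z zp; apply: (hess_mx_posdefmx hu).
  by apply: le_ball zp; rewrite ge_min lexx.
by apply: he; apply: le_ball zp; rewrite ge_min lexx orbT.
Qed.

Definition tube (rho : 'rV[R]_m -> R) : set 'rV[R]_(m + 1) :=
  [set x | exists2 p, V p & ball (base p) (rho p) x].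

Lemma tube_nbhd rho : (forall p, V p -> 0 < rho p) -> open_nbhd_of (zero_section V) (tube rho).
Proof.
move=> rho0; split; last first.
  by move=> _ [p Vp <-]; exists p => //; apply: ballxx; exact: rho0.
rewrite openE => x [p Vp px]; have [s /andP[s0 _] sR] := ball_room px.
apply/nbhs_ballP; exists s => // y xy; exists p => //.
by apply: sub_ball xy; [exact: rho0 | exact: sR].
Qed.

Lemma soliton_extension_exists_unique :
  exists (U : set 'rV[R]_(m + 1)) (u : 'rV[R]_(m + 1) -> R),
    soliton_extension h V v U u /\
    forall (U' : set 'rV[R]_(m + 1)) (u' : 'rV[R]_(m + 1) -> R),
      soliton_extension h V v U' u' ->
      exists W : set 'rV[R]_(m + 1),
        [/\ open_nbhd_of (zero_section V) W,
            W `<=` U `&` U' &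
            forall r : 'rV[R]_(m + 1), W r -> u r = u' r].
Proof.
have [C [u hC]] := glued_solution h V_open v_analytic reduced_mx_initial.
have /choice[rho hrho] : forall p, exists r : R, V p -> [/\ 0 < r, solves_at p (C p) r u &
    forall z, ball (base p) r (mu z) -> posdefmx (complex_hessian (u \o @mu R (m + 1)) z)].
  move=> p; have [Vp|nVp] := pselect (V p); last by exists 0.
  have [s hs] := hC p Vp; have [r /andP[r0 rs] hr] := spc_near Vp hs.
  by exists r => _; split=> //; apply: solves_at_sub hs; rewrite r0.
have rho0 p : V p -> 0 < rho p by move=> /hrho[].
exists (tube rho), u; split.
  split.
  - split; first exact: tube_nbhd.
    move=> x [p Vp px]; have [_ [_ _ hu _ _] _] := hrho p Vp.
    have [s sr sR] := ball_room px; have [d [hd _]] := expands_recenter sr sR hu.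
    by exists d, s; split; [case/andP: sr | exact: hd].
  - move=> r Vr; have [r0 [_ _ _ _ uv] _] := hrho r Vr.
    exact: (uv r (ballxx _ r0)).
  - move=> x [p Vp px]; have [_ [_ _ _ ueq _] _] := hrho p Vp.
    by apply: reduced_equation_soliton; exact: ueq.
  - by move=> z [p Vp pz]; have [_ _ hz] := hrho p Vp; exact: hz.
move=> U' u' hU'.
have /choice[sigma hsigma] : forall p, exists s : R, V p ->
    [/\ 0 < s, ball (base p) s `<=` U' & forall x, ball (base p) (Num.min (rho p) s) x -> u x = u' x].
  move=> p; have [Vp|nVp] := pselect (V p); last by exists 0.
  have [s [c [sU hs]]] := extension_solves_at V_open hU' Vp.
  have [_ hu _] := hrho p Vp; exists s => _; split=> //; first by case: hs.
  exact: (solves_at_eq V_open v_analytic reduced_mx_initial Vp hu hs).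
exists (tube (fun p => Num.min (rho p) (sigma p))); split.
- by apply: tube_nbhd => p Vp; rewrite lt_min rho0//; case: (hsigma p Vp).
- move=> x [p Vp px]; split.
    by exists p => //; apply: le_ball px; rewrite ge_min lexx.
  by have [_ sU _] := hsigma p Vp; apply: sU; apply: le_ball px; rewrite ge_min lexx orbT.
by move=> x [p Vp px]; have [_ _ e] := hsigma p Vp; exact: e.
Qed.

End Assembly.

Theorem theorem5 (R : realType) (m : nat) (h : 'rV[R]_(m + 1))
    (V : set 'rV[R]_m) (v : 'rV[R]_m -> R)
    (V_open : open V)
    (v_analytic : real_analytic_on V v)
    (v_spc : strictly_pseudo_convex_on (@mu R m @^-1` V) (v \o @mu R m))
    (v_nondeg : nondegenerate_off_orthant V v) :
  exists (U : set 'rV[R]_(m + 1)) (u : 'rV[R]_(m + 1) -> R),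
    soliton_extension h V v U u /\
    forall (U' : set 'rV[R]_(m + 1)) (u' : 'rV[R]_(m + 1) -> R),
      soliton_extension h V v U' u' ->
      exists W : set 'rV[R]_(m + 1),
        [/\ open_nbhd_of (zero_section V) W,
            W `<=` U `&` U' &
            forall r, W r -> u r = u' r].
Proof. exact: soliton_extension_exists_unique. Qed.
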